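(* Let $n\ge 3$ and let $a,b$ be real numbers with $a<n$, $b<n$. Let $\mathbf X$ be an i.i.d. sample of size $n$ from the bivariate normal distribution with parameters $(\mu_1,\mu_2,\sigma_1,\sigma_2,\rho)$, use the prior $\pi_{ab}$, and let $\theta_5=\mu_1/\sigma_1$. (a) The posterior distribution of $\theta_5$ given $\mathbf X$ is the distribution (with the data held fixed) of $$\theta_5^*=\frac{Z_1^*}{\sqrt n}+\frac{\overline x_1}{\sqrt{s_{11}}}\sqrt{\chi^{2*}_{n-a}}.$$ (b) For every $\alpha\in(0,1)$, the frequentist coverage of the credible interval $(-\infty,(\theta_5^* )_{1-\alpha})$ is $$P(\theta_5<(\theta_5^* )_{1-\alpha}\mid\mu_1,\mu_2,\sigma_1,\sigma_2,\rho)=P\left(\frac{Z_1-\theta_5\sqrt n}{\sqrt{\chi^2_{n-1}}}<\left(\frac{Z_1^*-\theta_5\sqrt n}{\sqrt{\chi^{2*}_{n-a}}}\right)_{1-\alpha}\ \Big|\ \theta_5\right),$$ which depends on $\theta_5$ only, and it equals $1-\alpha$ for all $\theta_5\in\mathbb R$ if and only if $a=1$.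
   Context: Model: $\mathbf x_k=(x_{1k},x_{2k})'$, $k=1,\dots,n$, are i.i.d. bivariate normal with mean $(\mu_1,\mu_2)'\in\mathbb R^2$ and covariance matrix $\boldsymbol\Sigma=\begin{pmatrix}\sigma_1^2&\rho\sigma_1\sigma_2\\ \rho\sigma_1\sigma_2&\sigma_2^2\end{pmatrix}$, $\sigma_1,\sigma_2>0$, $|\rho|<1$. Statistics: $\overline x_1=n^{-1}\sum_k x_{1k}$, $s_{11}=\sum_k(x_{1k}-\overline x_1)^2$. Prior: $\pi_{ab}$ is the (improper) density, with respect to $d\mu_1\,d\mu_2\,d\sigma_1\,d\sigma_2\,d\rho$, $$\pi_{ab}(\mu_1,\mu_2,\sigma_1,\sigma_2,\rho)=\frac{1}{\sigma_1^{3-a}\sigma_2^{2-b}(1-\rho^2)^{2-b/2}},$$ and the posterior given $\mathbf X$ is the normalized product of likelihood and prior (proper when $a<n$, $b<n$). Random variables: $Z_1,Z_1^*$ are standard normal; $\chi^2_m$ and $\chi^{2*}_m$ denote chi-squared random variables with $m$ (real, positive) degrees of freedom, i.e. Gamma with shape $m/2$ and rate $1/2$; $Z_1,\chi^2_{n-1},Z_1^*,\chi^{2*}_{n-a}$ are mutually independent. Quantiles: $(W)_{\beta}$ denotes the $\beta$ quantile of $W$ with respect to the distribution of the starred variables only, all non-starred quantities (in particular the data) being held fixed; so $(\theta_5^* )_{1-\alpha}$ is a function of $\mathbf X$, the posterior $1-\alpha$ quantile of $\theta_5$. Frequentist coverage: $P(\cdot\mid\mu_1,\mu_2,\sigma_1,\sigma_2,\rho)$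 is probability under the sampling distribution of $\mathbf X$ with the parameters fixed. *)

(* Defs.v *)
From HB Require Import structures.
From mathcomp Require Import all_boot all_order all_algebra.
From mathcomp Require Import all_classical all_reals all_analysis.

Set Implicit Arguments.
Unset Strict Implicit.
Unset Printing Implicit Defensive.

Import Order.TTheory GRing.Theory Num.Theory.
Import numFieldNormedType.Exports.

Local Open Scope classical_set_scope.
Local Open Scope ring_scope.

Section probability_notions.
Context {R : realType} {d : measure_display} {T : measurableType d}.
Variable P : probability T R.

Definition has_law d' (T' : measurableType d') (X : {RV P >-> T'})
    (nu : set T' -> \bar R) : Prop :=
  forall A, measurable A -> distribution P X A = nu A.

(* The sets [A i] may be taken to be [setT], so this is the product rule for
   every subfamily. *)
Definition mutually_independent d' (T' : measurableType d') (I : finType)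
    (X : I -> {RV P >-> T'}) : Prop :=
  forall A : I -> set T', (forall i, measurable (A i)) ->
    P (\bigcap_(i in [set: I]) (X i @^-1` A i)) =
    (\prod_(i : I) P (X i @^-1` A i))%E.

Definition quantile (W : T -> R) (beta : R) : R :=
  inf [set q | (beta%:E <= P [set w | (W w <= q)%R])%E].

End probability_notions.

Section distributions.
Context {R : realType}.
Implicit Types m s x : R.

Definition Gamma_fun s : R :=
  (\int[@lebesgue_measure R]_(x in `]0, +oo[) (x `^ (s - 1) * expR (- x))).

Definition chi2_pdf m x : R :=
  if 0 < x then
    x `^ (m / 2 - 1) * expR (- x / 2) / (2 `^ (m / 2) * Gamma_fun (m / 2))
  else 0.

Definition chi2_prob m (A : set R) : \bar R :=
  (\int[@lebesgue_measure R]_(x in A) (chi2_pdf m x)%:E)%E.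

End distributions.

Section bivariate_normal_model.
Context {R : realType}.

Local Notation leb := (@lebesgue_measure R).

(* (mu1, mu2, sigma1, sigma2, rho) *)
Definition param : Type := (R * R * R * R * R)%type.

Definition param_space : set param :=
  [set t | let: (_, _, s1, s2, r) := t in [/\ 0 < s1, 0 < s2 & `|r| < 1]].

Definition theta5 (t : param) : R := let: (m1, _, s1, _, _) := t in m1 / s1.

(* The Gaussian density exp(-(x-mu)' Sigma^-1 (x-mu) / 2) / (2 pi sqrt(det Sigma))
   with Sigma = (s1^2, r s1 s2; r s1 s2, s2^2) written out. *)
Definition binormal_pdf (t : param) (x : R * R) : R :=
  let: (m1, m2, s1, s2, r) := t in
  let u := (x.1 - m1) / s1 in
  let v := (x.2 - m2) / s2 in
  expR (- (u ^+ 2 - 2 * r * u * v + v ^+ 2) / (2 * (1 - r ^+ 2)))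
  / (2 * pi * s1 * s2 * Num.sqrt (1 - r ^+ 2)).

Definition binormal_prob (t : param) (A : set (R * R)) : \bar R :=
  (\int[leb \x leb]_(x in A) (binormal_pdf t x)%:E)%E.

Definition binormal_sample d (T : measurableType d) (P : probability T R)
    n (t : param) (X : 'I_n -> {RV P >-> (R * R)%type}) : Prop :=
  mutually_independent X /\
  forall k, has_law (X k) (binormal_prob t).

Section data.
Variables (n : nat) (x : 'I_n -> R * R).

Definition xbar1 : R := n%:R^-1 * \sum_(k < n) (x k).1.
Definition xbar2 : R := n%:R^-1 * \sum_(k < n) (x k).2.
Definition s11 : R := \sum_(k < n) ((x k).1 - xbar1) ^+ 2.
Definition s22 : R := \sum_(k < n) ((x k).2 - xbar2) ^+ 2.
Definition s12 : R := \sum_(k < n) ((x k).1 - xbar1) * ((x k).2 - xbar2).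

(* The posterior is proper only for such data; for n >= 3 they have
   probability one under the sampling distribution. *)
Definition positive_scatter : Prop := 0 < s11 * s22 - s12 ^+ 2.

Definition likelihood (t : param) : R := \prod_(k < n) binormal_pdf t (x k).

Definition prior (a b : R) (t : param) : R :=
  let: (_, _, s1, s2, r) := t in
  (s1 `^ (3 - a) * s2 `^ (2 - b) * (1 - r ^+ 2) `^ (2 - b / 2))^-1.

Definition posterior_mass (a b : R) (B : set param) : \bar R :=
  (\int[leb \x leb \x leb \x leb \x leb]_(t in B `&` param_space)
     (likelihood t * prior a b t)%:E)%E.

(* [posterior a b [set: param]] is 1 exactly when the normalizing constant is
   positive and finite; otherwise it is 0 by the conventions for [fine] and
   for the inverse of 0. *)
Definition posterior (a b : R) (B : set param) : \bar R :=
  (posterior_mass a b B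
   * ((fine (posterior_mass a b [set: param]))^-1)%:E)%E.

Definition theta5_star (z c : R) : R :=
  z / Num.sqrt n%:R + xbar1 / Num.sqrt s11 * Num.sqrt c.

End data.
End bivariate_normal_model.

(* Main.v *)
Require Import Defs.
From HB Require Import structures.
From mathcomp Require Import all_boot all_order all_algebra.
From mathcomp Require Import all_classical all_reals all_analysis.
From mathcomp Require Import measurable_realfun ring lra.

Import Order.TTheory GRing.Theory Num.Theory.
Import numFieldNormedType.Exports HBNNSimple.

Local Open Scope classical_set_scope.
Local Open Scope ring_scope.

(* (a) In the posterior integral, mu2 is integrated out as a Gaussian; the substitutions
   s2 = t / sqrt (1 - r^2), r = w / sqrt (1 + w^2) and a rescaling of w by s1 turn the
   integral over (s2, r) into s1 times a finite positive constant. What remains is a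
   density in (mu1, s1), which c = s11 / s1^2 identifies with the joint law of
   (theta5*, chi^2_{n-a}); normalizing constants are compared through total masses.
   (b) theta < quantile W beta holds iff P (W <= theta) < beta. The posterior cdf of
   theta5 at theta depends on the data only through t = - sqrt n * xbar1 / sqrt s11, where it
   equals P ((Z1* - theta sqrt n) / sqrt chi^2_{n-a} <= t), so the coverage is the
   probability that t is below the quantile of that ratio. The Helmert recursion shows
   that t has the law of (Z1 - theta sqrt n) / sqrt chi^2_{n-1}.
   The right-hand side is E Phi (theta sqrt n + q sqrt chi^2_{n-1}), and by definition of q
   the same expression with n - a degrees of freedom is 1 - alpha. When q <> 0 the integrand
   is strictly monotone and chi^2 has a strictly monotone likelihood ratio in the degrees of
   freedom, so the two agree only if a = 1; one of theta = 0, 1 / sqrt n gives q <> 0. *)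

(** * Densities, image measures and substitution *)

(** The powers of [s1] decide the degrees of freedom. Likelihood and prior contribute s1^(a - 3 -
    n); the integral over (s2, r) adds one factor [s1], and the substitution m1 = s1 u adds another.
    With c = s11 / s1^2 the resulting s1^(a - 1 - n) ds1 turns into c^((n - a)/2 - 1) dc up to a
    constant, against c^((n - 1)/2 - 1) dc under sampling. The exponent 2 - b/2 in the prior makes
    [b] cancel from the power of 1 - r^2, so [b] survives only in a constant, which is finite
    because b < n. Normalizing constants are never evaluated: Gamma and beta integrals stay
    symbolic, possibly infinite a priori, and are pinned down only because the variables of the
    statement have laws of total mass one. Independence is given as a product rule for events. The
    sample is therefore read one observation at a time, through a state that depends on the earlier
    observations only; this device serves both the Helmert recursion and the almost sure positivity
    of the scatter. *)

(** Both sides are continuous along an increasing sequence of simple functions, by monotone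
    convergence, and on indicators the claim is the hypothesis. It turns laws specified as set
    functions into rules for integrating test functions. *)
Lemma integral_density d (T : measurableType d) (R : realType)
    (mu nu : {measure set T -> \bar R}) (g : T -> R) (h : T -> \bar R) :
  measurable_fun setT g -> (forall x, 0 <= g x) ->
  (forall A, measurable A -> nu A = (\int[mu]_(x in A) (g x)%:E)%E) ->
  measurable_fun setT h -> (forall x, (0 <= h x)%E) ->
  (\int[nu]_x h x = \int[mu]_x (h x * (g x)%:E))%E.
Proof.
move=> mg g0 nuE mh h0.
pose h_ := nnsfun_approx measurableT mh.
transitivity (limn (fun n => \int[nu]_x (h_ n x)%:E)%E).
  rewrite -monotone_convergence//.
  - by apply: eq_integral => x _; apply/esym/cvg_lim => //; apply: cvg_nnsfun_approx.
  - by move=> n; exact/measurable_EFinP/measurable_funTS.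
  - by move=> n x _; rewrite lee_fin; exact: fun_ge0.
  - by move=> x _ m n mn; rewrite lee_fin; exact/lefP/nd_nnsfun_approx.
rewrite [RHS](_ : _ = limn (fun n => \int[mu]_x ((h_ n x)%:E * (g x)%:E))%E); last first.
  rewrite -monotone_convergence//.
  - apply: eq_integral => x _; apply/esym/cvg_lim => //.
    by apply: cvgeZr => //; exact: cvg_nnsfun_approx.
  - by move=> n; apply: emeasurable_funM; apply/measurable_EFinP => //; exact/measurable_funTS.
  - by move=> n x _; rewrite -EFinM lee_fin mulr_ge0//; exact: fun_ge0.
  - move=> x _ m n mn; rewrite -!EFinM lee_fin ler_wpM2r//.
    by apply/lefP; exact/nd_nnsfun_approx.
congr (limn _); apply/funext => n.
under eq_integral do rewrite fimfunE -fsumEFin//.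
rewrite ge0_integral_fsum//; last 2 first.
- by move=> r; exact/measurable_EFinP/measurable_funM.
- by move=> r x _; rewrite nnfun_muleindic_ge0.
under [RHS]eq_integral => x _.
  rewrite fimfunE -fsumEFin// ge0_mule_fsuml; last first.
    by move=> r; rewrite nnfun_muleindic_ge0.
  over.
rewrite ge0_integral_fsum//; last 2 first.
- move=> r; apply: emeasurable_funM; apply/measurable_EFinP => //.
  exact: measurable_funM.
- move=> r x _; apply: mule_ge0; last by rewrite lee_fin.
  exact: nnfun_muleindic_ge0.
apply: eq_fsbigr => r _.
rewrite integralZl_indic_nnsfun// integral_indic// setIT nuE//.
(* A negative value is never taken, so both sides vanish; for the others the scalar is nonnegative
   and can be pulled out of the integral. *)
have [r0|r0] := ltP r 0.
  rewrite preimage_nnfun0// integral_set0 mule0.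
  by apply/esym/integral0_eq => x _; rewrite indicE in_set0 mulr0 mul0e.
under [RHS]eq_integral do rewrite EFinM -muleA.
rewrite ge0_integralZl//; last 2 first.
- by apply: emeasurable_funM; apply/measurable_EFinP.
- by move=> x _; rewrite mule_ge0// lee_fin.
congr (_ * _)%E; rewrite integral_mkcond; apply: eq_integral => x _.
by rewrite patchE indicE; case: ifP => _; rewrite ?mul1e ?mul0e.
Qed.

Lemma density_measure d (T : measurableType d) (R : realType)
    (mu : {measure set T -> \bar R}) (g : T -> R) :
  measurable_fun setT g -> (forall x, 0 <= g x) ->
  exists nu : {measure set T -> \bar R},
    forall A, nu A = (\int[mu]_(x in A) (g x)%:E)%E.
Proof.
move=> mg g0; pose nu (A : set T) := (\int[mu]_(x in A) (g x)%:E)%E.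
have nu0 : nu set0 = 0%E by rewrite /nu integral_set0.
have nu_ge0 A : (0 <= nu A)%E by apply: integral_ge0 => x _; rewrite lee_fin.
have nuS : semi_sigma_additive nu.
  move=> F mF tF mUF; rewrite /nu ge0_integral_bigcup//.
  - by apply: is_cvg_ereal_nneg_natsum => // n _; exact: nu_ge0.
  - by apply/measurable_EFinP; exact: measurable_funTS.
  - by move=> x _; rewrite lee_fin.
pose mx := isMeasure.Build _ _ _ nu nu0 nu_ge0 nuS.
pose m : {measure set T -> \bar R} := HB.pack nu mx.
by exists m.
Qed.

Lemma pushforward_measure d d' (T : measurableType d) (T' : measurableType d')
    (R : realType) (mu : {measure set T -> \bar R}) (phi : T -> T') :
  measurable_fun setT phi ->
  exists2 nu : {measure set T' -> \bar R},
    forall A, nu A = mu (phi @^-1` A) &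
    forall h : T' -> \bar R, measurable_fun setT h -> (forall y, (0 <= h y)%E) ->
      (\int[nu]_y h y = \int[mu]_x h (phi x))%E.
Proof.
move=> mphi; unshelve eexists (pushforward mu phi) => //.
move=> h mh h0; by rewrite ge0_integral_pushforward.
Qed.

Section substitution.
Context {R : realType}.
Local Notation leb := (@lebesgue_measure R).

(* Pushing the measure psi(x)dx forward along phi gives Lebesgue measure on the
   half-open intervals of `]phi a, phi b], hence on all Borel sets. *)
Lemma increasing_substitution_oc (phi psi : R -> R) (a b : R) (F : R -> \bar R) :
  a < b ->
  {in `[a, b] &, {homo phi : x y / x < y}} ->
  (forall x, x \in `[a, b] -> is_derive x 1 phi (psi x)) ->
  (forall x, x \in `[a, b] -> {for x, continuous psi}) ->
  measurable_fun setT phi -> measurable_fun setT psi ->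
  (forall x, x \in `[a, b] -> 0 <= psi x) ->
  measurable_fun setT F -> (forall x, (0 <= F x)%E) ->
  (\int[leb]_(y in `]phi a, phi b]) F y =
   \int[leb]_(x in `]a, b]) (F (phi x) * (psi x)%:E))%E.
Proof.
move=> ab phi_incr dphi cpsi mphi mpsi psi0 mF F0.
have phi_mono : {in `[a, b] &, {mono phi : x y / x <= y}} by exact: le_mono_in.
have phi_lt : {in `[a, b] &, {mono phi : x y / x < y}} by exact: leW_mono_in.
pose g x := psi x * \1_(`]a, b]%classic) x.
have mg : measurable_fun setT g by exact: measurable_funM.
have g0 x : 0 <= g x.
  rewrite /g indicE; case: (boolP (_ \in _)); last by rewrite mulr0.
  rewrite inE/= mulr1 => xab.
  by apply: psi0; exact: subset_itv_oc_cc.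
have [nu nuE] := @density_measure _ _ R leb g mg g0.
have FTC x y : x \in `[a, b] -> y \in `[a, b] -> x < y ->
    (\int[leb]_(z in `]x, y]) (psi z)%:E = (phi y - phi x)%:E)%E.
  move=> xab yab xy.
  have sub z : z \in `[x, y] -> z \in `[a, b].
    move: xab yab; rewrite !in_itv/= => /andP[ax _] /andP[_ yb] /andP[xz zy].
    by rewrite (le_trans ax)//= (le_trans zy).
  have := @continuous_FTC2 R psi phi x y xy; rewrite EFinB => <-.
  - by rewrite integral_itv_obnd_cbnd//; exact/measurable_EFinP/measurable_funTS.
  - apply: continuous_in_subspaceT => z; rewrite inE/= => zxy.
    by apply: cpsi; exact: sub.
  - have ct z : z \in `[x, y] -> {for z, continuous phi}.
      move=> zxy; apply/differentiable_continuous/derivable1_diffP.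
      by have [] := dphi z (sub _ zxy).
    split.
    + by move=> z /subset_itv_oo_cc/sub/dphi[].
    + apply: cvg_at_right_filter; apply: ct.
      by rewrite in_itv/= lexx ltW.
    + apply: cvg_at_left_filter; apply: ct.
      by rewrite in_itv/= lexx ltW.
  - move=> z /subset_itv_oo_cc/sub zab; rewrite derive1E.
    by have [_ ->] := dphi z zab.
have aab : a \in `[a, b] by rewrite in_itv/= lexx ltW.
have bab : b \in `[a, b] by rewrite in_itv/= lexx ltW.
have phiab : phi a <= phi b by rewrite phi_mono// ltW.
have ivt y : y \in `[phi a, phi b] -> exists2 x, x \in `[a, b] & phi x = y.
  move=> yab; apply: IVT; first exact: ltW.
    apply: continuous_in_subspaceT => z; rewrite inE/= => zab.
    apply/differentiable_continuous/derivable1_diffP.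
    by have [] := dphi z zab.
  by rewrite min_l// max_r.
have [nu' nu'E nu'h] := @pushforward_measure _ _ _ (measurableTypeR R) _ nu phi mphi.
have phi_oc x : x \in `]a, b] -> x \in `[a, b] by exact: subset_itv_oc_cc.
have gE A : measurable A -> nu A = (\int[leb]_(x in A `&` `]a, b]) (psi x)%:E)%E.
  move=> mA; rewrite nuE// integral_mkcondr; apply: eq_integral => x _.
  by rewrite epatch_indic/= -EFinM.
have eqJ A : measurable A -> mrestr leb (measurable_itv `]phi a, phi b]) A = nu' A.
  move=> mA; pose I k : set (measurableTypeR R) := `]- k%:R, k%:R]%classic.
  apply: (@measure_unique _ R (measurableTypeR R) (@ocitv R) I) => //=.
  - by move=> X Y; exact: ocitvI.
  - by move=> k; exists (- k%:R, k%:R).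
  - exact: bigcup_itvT.
  - move=> _ [[p q] _ <-] /=; rewrite nu'E /mrestr /=.
    rewrite gE; last by rewrite -[X in measurable X]setTI; exact: mphi.
    (* The trace of []p, q]] on the image interval. If it is nonempty, its endpoints are values
       [phi x] and [phi y] by the intermediate value theorem, and both measures give it the mass
       [phi y - phi x]. *)
    pose p' := Num.max p (phi a); pose q' := Num.min q (phi b).
    have -> : `]p, q] `&` `]phi a, phi b] = `]p', q']%classic.
      apply/seteqP; split => z /=; rewrite !in_itv/= /p' /q' gt_max le_min.
        by move=> [/andP[-> ->] /andP[-> ->]].
      by move=> /andP[/andP[-> ->] /andP[-> ->]].
    have [pq'|qp'] := ltP p' q'; last first.
      rewrite set_itv_ge ?bnd_simp -?leNgt// measure0.
      rewrite (_ : _ `&` _ = set0) ?integral_set0//.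
      apply/seteqP; split => z //= [] /[!in_itv]/= /andP[pz zq] zab.
      suff : p' < q' by rewrite ltNge qp'.
      apply: (@lt_le_trans _ _ (phi z)).
        by rewrite gt_max pz phi_lt//; [case/andP: zab|exact: phi_oc].
      by rewrite le_min zq phi_mono//; [case/andP: zab|exact: phi_oc].
    have [x xab phix] : exists2 x, x \in `[a, b] & phi x = p'.
      apply: ivt; rewrite in_itv/= le_max lexx orbT/=.
      by rewrite (le_trans (ltW pq'))// ge_min lexx orbT.
    have [y yab phiy] : exists2 x, x \in `[a, b] & phi x = q'.
      apply: ivt; rewrite in_itv/= ge_min lexx orbT andbT.
      by rewrite (le_trans _ (ltW pq'))// le_max lexx orbT.
    have xy : x < y by rewrite -phi_lt// phix phiy.
    rewrite lebesgue_measure_itv/= lte_fin pq' -phix -phiy -EFinB -(FTC x y)//.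
    congr integral; apply/seteqP; split => z /=; rewrite !in_itv/=.
      move=> /andP[xz zy].
      have zab : a < z <= b.
        move: xab yab; rewrite !in_itv/= => /andP[ax _] /andP[_ yb].
        by rewrite (le_lt_trans ax)//= (le_trans zy).
      have zab' := phi_oc _ zab.
      move: xz zy; rewrite -phi_lt// phix gt_max => /andP[-> _].
      by rewrite -phi_mono// phiy le_min => /andP[-> _].
    move=> [/andP[pz zq]] zab; have zab' := phi_oc _ zab.
    rewrite -phi_lt// -(phi_mono z y)// phix phiy gt_max le_min pz zq/=.
    by rewrite phi_lt// phi_mono.
  - move=> k; rewrite /mrestr /=; apply: le_lt_trans.
        apply: (@le_measure _ _ _ leb _ (I k)); rewrite ?inE//.
      - by apply: (@measurableI _ (measurableTypeR R)); exact: measurable_itv.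
      - exact: measurable_itv.
    by rewrite /I/= lebesgue_measure_itv/=; case: ifP => _; rewrite ltry.
transitivity (\int[nu']_(y in `]phi a, phi b]) F y)%E.
  apply: eq_measure_integral => A mA AJ.
  by rewrite -eqJ// /mrestr setIidl.
pose J : set (measurableTypeR R) := `]phi a, phi b]%classic.
have mJ : measurable J by exact: measurable_itv.
rewrite [LHS]integral_mkcond nu'h; last 2 first.
- by apply/(measurable_restrictT _ mJ); exact: measurable_funTS.
- by move=> x; rewrite patchE; case: ifP.
have mJ' : measurable (phi @^-1` J) by rewrite -[X in measurable X]setTI; exact: mphi.
rewrite [LHS](@integral_density _ _ _ leb nu g).
- rewrite [RHS]integral_mkcond; apply: eq_integral => x _.
  rewrite [RHS]patchE /g indicE; case: ifPn => xI; last first.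
    by rewrite /= mulr0 mule0.
  rewrite /= mulr1 patchE ifT// inE /=; move: xI; rewrite inE/= => xI.
  rewrite in_itv/= phi_lt ?phi_mono//; [exact: phi_oc|exact: phi_oc].
- by [].
- by [].
- by move=> A _; exact: nuE.
- apply: measurableT_comp; last exact: mphi.
  by apply/(measurable_restrictT _ mJ); exact: measurable_funTS.
- by move=> x; rewrite patchE; case: ifP.
Qed.

(** Exhaustion: the half-open intervals increase to [I], while their closures stay inside [I], where
    [phi] is differentiable. The formula on each of them passes to the limit by monotone convergence
    over increasing sets. *)
Let increasing_substitution (phi psi : R -> R) (a b : nat -> R) (I J : set R)
    (F : R -> \bar R) :
  (forall k, a k < b k) -> nonincreasing_seq a -> nondecreasing_seq b ->
  (forall k, `[a k, b k] `<=` I) ->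
  I = \bigcup_k `]a k, b k]%classic -> J = phi @` I ->
  (forall x y, I x -> I y -> x < y -> phi x < phi y) ->
  (forall x, I x -> is_derive x 1 phi (psi x)) ->
  (forall x, I x -> {for x, continuous psi}) ->
  measurable_fun setT phi -> measurable_fun setT psi -> (forall x, I x -> 0 <= psi x) ->
  measurable_fun setT F -> (forall x, (0 <= F x)%E) ->
  (\int[leb]_(y in J) F y = \int[leb]_(x in I) (F (phi x) * (psi x)%:E))%E.
Proof.
move=> ab da db subI IE JE phi_incr dphi cpsi mphi mpsi psi0 mF F0.
have phi_le x y : I x -> I y -> x <= y -> phi x <= phi y.
  by rewrite le_eqVlt => Ix Iy /predU1P[->//|xy]; exact/ltW/phi_incr.
have aI k : I (a k) by apply: (subI k); rewrite /= in_itv/= lexx ltW.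
have bI k : I (b k) by apply: (subI k); rewrite /= in_itv/= lexx ltW.
have {}JE : J = \bigcup_k `]phi (a k), phi (b k)]%classic.
  rewrite JE; apply/seteqP; split => [_ [x Ix <-]|y].
    have := Ix; rewrite {1}IE => -[k _ /=]; rewrite in_itv/= => /andP[ax xb].
    by exists k => //=; rewrite in_itv/= phi_incr// phi_le.
  move=> [k _ /=]; rewrite in_itv/= => /andP[ay yb].
  have [|||x xab <-] := @IVT R phi (a k) (b k) y.
  + exact: ltW.
  + apply: continuous_in_subspaceT => z; rewrite inE/= => /(subI k) Iz.
    by apply/differentiable_continuous/derivable1_diffP; have [] := dphi z Iz.
  + have phik : phi (a k) <= phi (b k) by apply: phi_le => //; exact: ltW.
    by rewrite min_l// max_r// (ltW ay).
  + by exists x => //; exact: (subI k).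
have cvgL : (\int[leb]_(y in `]phi (a k), phi (b k)]) F y @[k --> \oo] -->
    \int[leb]_(y in J) F y)%E.
  rewrite JE; apply: ge0_nondecreasing_set_cvg_integral => //.
  - move=> m k mk; apply/subsetPset; apply: subset_itv; rewrite bnd_simp.
      by apply: phi_le => //; exact: da.
    by apply: phi_le => //; exact: db.
  - by move=> k; exact: measurable_funTS.
have cvgR : (\int[leb]_(x in `]a k, b k]) (F (phi x) * (psi x)%:E) @[k --> \oo] -->
    \int[leb]_(x in I) (F (phi x) * (psi x)%:E))%E.
  rewrite IE; apply: ge0_nondecreasing_set_cvg_integral => //.
  - by move=> m k mk; apply/subsetPset; apply: subset_itv; rewrite bnd_simp;
      [exact: da|exact: db].
  - move=> k; apply: measurable_funTS; apply: emeasurable_funM.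
      exact: measurableT_comp mF mphi.
    exact/measurable_EFinP.
  - move=> k x xk; rewrite mule_ge0// lee_fin psi0//; apply: (subI k).
    exact: subset_itv_oc_cc.
rewrite -(cvg_lim _ cvgL)// -(cvg_lim _ cvgR)//; congr (limn _); apply/funext => k.
apply: increasing_substitution_oc => //.
- by move=> x y xk yk; apply: phi_incr; exact: (subI k).
- by move=> x xk; apply: dphi; exact: (subI k).
- by move=> x xk; apply: cpsi; exact: (subI k).
- by move=> x xk; apply: psi0; exact: (subI k).
Qed.

Lemma increasing_substitutionT (phi psi : R -> R) (J : set R) (F : R -> \bar R) :
  J = range phi ->
  {homo phi : x y / x < y} ->
  (forall x : R, is_derive x 1 phi (psi x)) -> continuous psi ->
  measurable_fun setT phi -> measurable_fun setT psi -> (forall x, 0 <= psi x) ->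
  measurable_fun setT F -> (forall x, (0 <= F x)%E) ->
  (\int[leb]_(y in J) F y = \int[leb]_x (F (phi x) * (psi x)%:E))%E.
Proof.
move=> JE phi_incr dphi cpsi mphi mpsi psi0 mF F0.
apply: (increasing_substitution phi psi (fun k => - k.+1%:R) (fun k => k.+1%:R)) => //.
- by move=> k; rewrite (@lt_trans _ _ 0)// ?oppr_lt0 ltr0n.
- by move=> m k mk; rewrite lerN2 ler_nat.
- by move=> m k mk; rewrite ler_nat.
- apply/esym; rewrite -subTset => x _; exists (Num.truncn `|x|) => //=.
  have xlt := truncnS_gt `|x|.
  rewrite in_itv/= ltrNl (le_lt_trans _ xlt) ?ler_normr ?lexx ?orbT//=.
  by rewrite (le_trans _ (ltW xlt))// ler_norm.
- by move=> x y _ _; exact: phi_incr.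
- by move=> x _; exact: cpsi.
Qed.

Lemma increasing_substitution_pos (phi psi : R -> R) (J : set R) (F : R -> \bar R) :
  J = phi @` `]0, +oo[%classic ->
  (forall x y, 0 < x -> x < y -> phi x < phi y) ->
  (forall x : R, 0 < x -> is_derive x 1 phi (psi x)) ->
  (forall x, 0 < x -> {for x, continuous psi}) ->
  measurable_fun setT phi -> measurable_fun setT psi -> (forall x, 0 < x -> 0 <= psi x) ->
  measurable_fun setT F -> (forall x, (0 <= F x)%E) ->
  (\int[leb]_(y in J) F y =
   \int[leb]_(x in `]0%R, +oo[) (F (phi x) * (psi x)%:E))%E.
Proof.
move=> JE phi_incr dphi cpsi mphi mpsi psi0 mF F0.
(* [k.+2] rather than [k.+1] at the left end, so that the interval of index 0, []1/2, 1]], is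
   already nondegenerate. *)
apply: (increasing_substitution phi psi (fun k => k.+2%:R^-1) (fun k => k.+1%:R)) => //.
- by move=> k; rewrite (@lt_le_trans _ _ 1)// ?ler1n// invf_lt1// ltr1n.
- by move=> m k mk; rewrite lef_pV2 ?posrE ?ltr0n// ler_nat.
- by move=> m k mk; rewrite ler_nat.
- by move=> k x /=; rewrite !in_itv/= andbT => /andP[+ _]; apply: lt_le_trans; rewrite invr_gt0.
- apply/seteqP; split => [x /=|x [k _ /=]]; rewrite !in_itv/= andbT; last first.
    by move=> /andP[+ _]; apply: lt_trans; rewrite invr_gt0.
  (* An index that bounds [x] and its inverse at once. *)
  move=> x0; exists (Num.truncn (x + x^-1)) => //=.
  have xlt := truncnS_gt (x + x^-1); rewrite in_itv/=; apply/andP; split; last first.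
    by rewrite (le_trans _ (ltW xlt))// lerDl invr_ge0 ltW.
  rewrite -[ltRHS]invrK ltf_pV2 ?posrE ?invr_gt0//.
  rewrite (@le_lt_trans _ _ (x + x^-1))//; first by rewrite lerDr ltW.
  by rewrite (lt_trans xlt)// ltr_nat.
- by move=> x y /=; rewrite !in_itv/= !andbT => x0 _; exact: phi_incr.
- by move=> x /=; rewrite in_itv/= andbT; exact: dphi.
- by move=> x /=; rewrite in_itv/= andbT; exact: cpsi.
- by move=> x /=; rewrite in_itv/= andbT; exact: psi0.
Qed.

Lemma integral_reflection (F : R -> \bar R) :
  measurable_fun setT F -> (forall x, (0 <= F x)%E) ->
  (\int[leb]_x F x = \int[leb]_x F (- x)%R)%E.
Proof.
move=> mF F0.
have mN : measurable_fun setT (-%R : measurableTypeR R -> measurableTypeR R).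
  exact: oppr_measurable.
have [nu nuE nuh] := @pushforward_measure _ _ (measurableTypeR R)
  (measurableTypeR R) _ leb -%R mN.
rewrite -nuh//; apply: eq_measure_integral => A mA _.
by rewrite nuE -[LHS]lebesgue_measureN.
Qed.

Let integral_affine_gt0 (F : R -> \bar R) (a b : R) : 0 < a ->
  measurable_fun setT F -> (forall x, (0 <= F x)%E) ->
  (\int[leb]_x F x = \int[leb]_x (F (a * x + b)%R * a%:E))%E.
Proof.
move=> a0 mF F0; pose phi x := a * x + b; pose psi (_ : R) := a.
apply: (increasing_substitutionT phi psi) => //.
- apply/esym; rewrite -subTset => x _; exists ((x - b) / a) => //.
  by rewrite /phi mulrC divfK ?gt_eqF// subrK.
- by move=> x y xy; rewrite /phi ltrD2r ltr_pM2l.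
- move=> x; have -> : phi = (a \*: id) + cst b by apply/funext.
  by apply: is_derive_eq; rewrite addr0 -[RHS]mulr1.
- by move=> x; exact: cst_continuous.
- by apply: measurable_funD => //; exact: measurable_funM.
- exact: measurable_cst.
- by move=> x; exact: ltW.
Qed.

Lemma integral_affine (F : R -> \bar R) (a b : R) : a != 0 ->
  measurable_fun setT F -> (forall x, (0 <= F x)%E) ->
  (\int[leb]_x F x = \int[leb]_x (F (a * x + b)%R * `|a|%:E))%E.
Proof.
move=> aN0 mF F0; have [a0|a0|a0] := ltgtP a 0; last by rewrite a0 eqxx in aN0.
  rewrite integral_reflection// (integral_affine_gt0 _ (- a) (- b)) ?oppr_gt0//.
    by apply: eq_integral => x _; rewrite ltr0_norm// mulNr -opprD opprK.
  exact: measurableT_comp.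
by rewrite (integral_affine_gt0 _ a b) ?gtr0_norm.
Qed.
End substitution.

(** * Independence *)

Lemma measurable_preimage d d' (T : measurableType d) (T' : measurableType d')
    (f : T -> T') (A : set T') :
  measurable_fun setT f -> measurable A -> measurable (f @^-1` A).
Proof. by move=> mf mA; rewrite -[X in measurable X]setTI; exact: mf. Qed.

Lemma integral_indic_preimage d d' (T : measurableType d) (T' : measurableType d')
    (R : realType) (mu : {measure set T -> \bar R}) (f : T -> T') (A : set T') :
  measurable_fun setT f -> measurable A ->
  (\int[mu]_x (\1_A (f x) : R)%:E = mu (f @^-1` A))%E.
Proof.
move=> mf mA; transitivity (\int[mu]_x (\1_(f @^-1` A) x : R)%:E)%E.
  apply: eq_integral => x _; rewrite !indicE.
  suff -> : (f x \in A) = (x \in f @^-1` A) by [].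
  by apply/idP/idP; rewrite !inE.
by rewrite integral_indic ?setIT//; exact: measurable_preimage.
Qed.

(** Rectangles are stable under intersection, generate the product sigma-algebra and include the
    whole space, on which [m1] is finite. *)
Lemma measure_eq_rectangles d1 d2 (T1 : measurableType d1) (T2 : measurableType d2)
    (R : realType) (m1 m2 : {measure set (T1 * T2)%type -> \bar R}) :
  (m1 setT < +oo)%E ->
  (forall A B, measurable A -> measurable B -> m1 (A `*` B) = m2 (A `*` B)) ->
  forall D, measurable D -> m1 D = m2 D.
Proof.
move=> m1oo m12 D mD.
pose C : set (set (T1 * T2)%type) := [set A `*` B | A in measurable & B in measurable].
apply: (measure_unique C (fun=> setT)) => //.
- exact: measurable_prod_measurableType.
- move=> _ _ [A1 mA1 [B1 mB1 <-]] [A2 mA2 [B2 mB2 <-]].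
  exists (A1 `&` A2); first exact: measurableI.
  exists (B1 `&` B2); first exact: measurableI.
  by rewrite setXI.
- by move=> _; exists setT => //; exists setT => //; rewrite setXTT.
- by rewrite bigcup_const//; exists 0%N.
- by move=> _ [A mA [B mB <-]]; exact: m12.
Qed.

(** The pair has the product of the two laws, so Tonelli applies. Both laws are then pulled back to
    the same space [S]: the inner [s'] plays the role of an independent copy. *)
Lemma independent_integral d d1 d2 (S : measurableType d) (T1 : measurableType d1)
    (T2 : measurableType d2) (R : realType) (P : probability S R)
    (V : S -> T1) (W : S -> T2) (h : (T1 * T2)%type -> \bar R) :
  measurable_fun setT V -> measurable_fun setT W ->
  (forall A B, measurable A -> measurable B ->
     P (V @^-1` A `&` W @^-1` B) = (P (V @^-1` A) * P (W @^-1` B))%E) ->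
  measurable_fun setT h -> (forall x, (0 <= h x)%E) ->
  (\int[P]_s h (V s, W s) = \int[P]_s \int[P]_s' h (V s, W s'))%E.
Proof.
move=> mV mW VW mh h0.
pose V' : {mfun S >-> T1} := HB.pack V (isMeasurableFun.Build _ _ _ _ _ mV).
pose W' : {mfun S >-> T2} := HB.pack W (isMeasurableFun.Build _ _ _ _ _ mW).
have mVW : measurable_fun setT (fun s => (V s, W s)) by exact: measurable_fun_pair.
pose VW' : {mfun S >-> (T1 * T2)%type} :=
  HB.pack (fun s => (V s, W s)) (isMeasurableFun.Build _ _ _ _ _ mVW).
transitivity (\int[distribution P VW']_x h x)%E.
  by rewrite ge0_integral_distribution.
transitivity (\int[distribution P V' \x distribution P W']_x h x)%E.
  apply: eq_measure_integral => D mD _; apply/esym.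
  by apply: product_measure_unique => // A B mA mB; exact: VW.
rewrite fubini_tonelli1// ge0_integral_distribution//; last 2 first.
- exact: measurable_fun_fubini_tonelli_F.
- by move=> x; exact: integral_ge0.
apply: eq_integral => s _; rewrite /= /fubini_F ge0_integral_distribution//.
exact/measurableT_comp.
Qed.

Section prefix_independence.
Context d d1 d2 (S : measurableType d) (T1 : measurableType d1)
  (T2 : measurableType d2) (R : realType) (P : probability S R).
Variables (n : nat) (X : 'I_n -> {RV P >-> T2}).
Variables (V : nat -> S -> T1) (phi : nat -> (T1 * T2)%type -> T1) (v0 : T1).
Hypothesis indX : mutually_independent X.
Hypothesis mphi : forall k, measurable_fun setT (phi k).
Hypothesis V0 : forall s, V 0 s = v0.
Hypothesis VS : forall (k : 'I_n) s, V k.+1 s = phi k (V k s, X k s).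

Lemma measurable_prefix k : (k <= n)%N -> measurable_fun setT (V k).
Proof.
elim: k => [_|k ih kn].
  by rewrite (_ : V 0 = cst v0); [exact: measurable_cst|apply/funext].
rewrite (_ : V k.+1 = phi k \o (fun s => (V k s, X (Ordinal kn) s))); last first.
  by apply/funext => s; rewrite (VS (Ordinal kn)).
apply: measurableT_comp => //; apply: measurable_fun_pair => //.
by apply: ih; exact: ltnW.
Qed.

(** An event about the observations that the state [V k] has not read yet. *)
Let tail (A : 'I_n -> set T2) (k : nat) : set S :=
  \bigcap_(j in [set j : 'I_n | (k <= j)%N]) (X j @^-1` A j).

Let measurable_tail A k : (forall j, measurable (A j)) -> measurable (tail A k).
Proof.
move=> mA; apply: fin_bigcap_measurable => // j _.
by rewrite -[X in measurable X]setTI; exact: (measurable_funP (X j)).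
Qed.

Let tailS A (k : 'I_n) : tail A k = X k @^-1` A k `&` tail A k.+1.
Proof.
apply/seteqP; split => s.
  move=> h; split; first by apply: (h k) => /=.
  by move=> j /= kj; apply: h => /=; exact: ltnW.
move=> [hk h] j /=; rewrite leq_eqVlt => /predU1P[kj|kj]; last exact: h.
by have -> : j = k by exact: val_inj.
Qed.

Let tail_single (k : 'I_n) (D : set T1) (B : set T2) : measurable B ->
  (forall A, (forall j, measurable (A j)) -> P (V k @^-1` D `&` tail A k) =
    (P (V k @^-1` D) * \prod_(j : 'I_n | (k <= j)%N) P (X j @^-1` A j))%E) ->
  P (V k @^-1` D `&` X k @^-1` B) = (P (V k @^-1` D) * P (X k @^-1` B))%E.
Proof.
move=> mB hA; pose A (j : 'I_n) := if j == k then B else setT.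
have mA j : measurable (A j) by rewrite /A; case: ifP.
have := hA A mA; rewrite tailS {1}/A eqxx.
have -> : tail A k.+1 = setT.
  apply/seteqP; split => // s _ j /= kj; rewrite /A; case: eqP => // jk.
  by move: kj; rewrite jk ltnn.
rewrite setIT => ->; congr (_ * _)%E.
rewrite (bigD1 k)//= {1}/A eqxx big1 ?mule1// => j /andP[_ /negbTE jk].
by rewrite /A jk preimage_setT probability_setT.
Qed.

(** Induction on the number of observations read. The claim must involve all remaining observations
    at once: to pass from [V k] to [V k.+1], one of them moves into the state while the others must
    stay independent of the pair. *)
Let prefix_independence_tail k (D : set T1) (A : 'I_n -> set T2) : (k <= n)%N ->
  measurable D -> (forall j, measurable (A j)) ->
  P (V k @^-1` D `&` tail A k) =
  (P (V k @^-1` D) * \prod_(j : 'I_n | (k <= j)%N) P (X j @^-1` A j))%E.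
Proof.
elim: k D A => [|k ih] D A.
  move=> _ mD mA.
  have -> : (\prod_(j : 'I_n | (0 <= j)%N) P (X j @^-1` A j) = P (tail A 0))%E.
    rewrite [LHS](_ : _ = \prod_(j < n) P (X j @^-1` A j))%E//.
    by rewrite -indX//; congr (P _); apply: eq_bigcapl.
  have [vD|vD] := pselect (D v0).
    have -> : V 0 @^-1` D = setT.
      by apply/seteqP; split => // s _ /=; rewrite V0.
    by rewrite setTI probability_setT mul1e.
  have -> : V 0 @^-1` D = set0.
    by apply/seteqP; split => // s /=; rewrite V0.
  by rewrite set0I measure0 mul0e.
move=> kn mD mA; pose k' := Ordinal kn.
(* The event at index [k'] is free: the induction hypothesis for [V k] with varying [B] yields the
   product rule for rectangles in the pair formed by [V k] and [X k']. *)
pose A' (B : set T2) (j : 'I_n) := if j == k' then B else A j.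
have mA' B : measurable B -> forall j, measurable (A' B j).
  by move=> mB j; rewrite /A'; case: ifP.
have tailA' B : tail (A' B) k.+1 = tail A k.+1.
  apply: eq_bigcapr => j /= kj; rewrite /A'; case: eqP => // jk.
  by move: kj; rewrite jk /= ltnn.
have prodA' B : (\prod_(j : 'I_n | (k <= j)%N) P (X j @^-1` A' B j) =
    P (X k' @^-1` B) * \prod_(j : 'I_n | (k.+1 <= j)%N) P (X j @^-1` A j))%E.
  rewrite (bigD1 k')//= {1}/A' eqxx; congr (_ * _)%E.
  apply: eq_big => j; first by rewrite ltn_neqAle eq_sym andbC.
  by rewrite /A' => /andP[_ /negbTE ->].
have mE := measurable_tail A k.+1 mA.
have PE : P (tail A k.+1) = (\prod_(j : 'I_n | (k.+1 <= j)%N) P (X j @^-1` A j))%E.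
  have := ih setT (A' setT) (ltnW kn) measurableT (mA' _ measurableT).
  rewrite prodA' (tailS _ k') tailA' {1}/A' eqxx !preimage_setT !setTI.
  by rewrite probability_setT !mul1e.
have mVk := measurable_prefix k (ltnW kn).
have mVX : measurable_fun setT (fun s => (V k s, X k' s)).
  exact: measurable_fun_pair.
have mD' : measurable (phi k @^-1` D).
  by rewrite -[X in measurable X]setTI; exact: mphi.
have VSD : V k.+1 @^-1` D = (fun s => (V k s, X k' s)) @^-1` (phi k @^-1` D).
  by apply/seteqP; split => s /=; rewrite (VS k').
have PE_ge0 : 0 <= fine (P (tail A k.+1)) by exact: fine_ge0.
(* [m1] is the law of the pair restricted to the tail event, [m2] the same law multiplied by the
   probability of that event. They agree on rectangles, hence on the preimage of [D] under [phi k],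
   which is not a rectangle in general. *)
have [m1 m1E _] := pushforward_measure _ _ _ _ _ (mrestr P mE) _ mVX.
have [m2 m2E _] := pushforward_measure _ _ _ _ _ (mscale (NngNum PE_ge0) P) _ mVX.
have {}m1E B : m1 B = P ((fun s => (V k s, X k' s)) @^-1` B `&` tail A k.+1).
  by rewrite m1E.
have {}m2E B : m2 B = (P (tail A k.+1) * P ((fun s => (V k s, X k' s)) @^-1` B))%E.
  by rewrite m2E /= /mscale/= fineK ?fin_num_measure.
have m12 : m1 (phi k @^-1` D) = m2 (phi k @^-1` D).
  apply: measure_eq_rectangles => //.
    by rewrite m1E preimage_setT setTI (le_lt_trans (probability_le1 P mE))// ltry.
  move=> B C mB mC; rewrite m1E m2E.
  rewrite (_ : _ @^-1` _ = V k @^-1` B `&` X k' @^-1` C)//.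
  have := ih B (A' C) (ltnW kn) mB (mA' _ mC).
  rewrite prodA' (tailS _ k') {1}/A' eqxx tailA' setIA => ->.
  have -> : P (V k @^-1` B `&` X k' @^-1` C) = (P (V k @^-1` B) * P (X k' @^-1` C))%E.
    by apply: (tail_single k') => // A2 mA2; apply: ih => //; exact: ltnW.
  by rewrite muleA muleC -PE.
rewrite VSD -PE; move: m12; rewrite m1E m2E.
by rewrite muleC.
Qed.

Lemma prefix_independence (k : 'I_n) (D : set T1) (B : set T2) :
  measurable D -> measurable B ->
  P (V k @^-1` D `&` X k @^-1` B) = (P (V k @^-1` D) * P (X k @^-1` B))%E.
Proof.
move=> mD mB; apply: tail_single => // A mA.
by apply: prefix_independence_tail => //; exact: ltnW.
Qed.

End prefix_independence.

(** * Normal and chi-squared densities *)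

Section measurability.
Context d (T : measurableType d) (R : realType).
Implicit Types f g : T -> R.

Lemma measurable_funN f : measurable_fun setT f ->
  measurable_fun setT (fun x => - f x).
Proof. by move=> mf; apply: measurableT_comp => //; exact: oppr_measurable. Qed.

Lemma measurable_fun_expR f : measurable_fun setT f ->
  measurable_fun setT (fun x => expR (f x)).
Proof. by move=> mf; apply: measurableT_comp => //; exact: measurable_expR. Qed.

Lemma measurable_fun_powR f p : measurable_fun setT f ->
  measurable_fun setT (fun x => f x `^ p).
Proof. by move=> mf; apply: (measurableT_comp (measurable_powR p)). Qed.

(** The power of exponent -1 is the inverse on nonnegative bases, so the inverse of a function of
    any sign is written through its square; at a zero both sides are 0 since [0^-1] is 0. *)
Lemma measurable_fun_inv f : measurable_fun setT f ->
  measurable_fun setT (fun x => (f x)^-1).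
Proof.
move=> mf; rewrite (_ : (fun _ => _) = fun x => f x * (f x ^+ 2) `^ (-1)).
  by apply: measurable_funM => //; apply: measurable_fun_powR; exact: measurable_funX.
apply/funext => x; rewrite powR_inv1 ?sqr_ge0// -exprVn expr2 mulrA.
have [->|fx0] := eqVneq (f x) 0; first by rewrite invr0 !mulr0.
by rewrite divff// mul1r.
Qed.

Lemma measurable_fun_sqrt f : measurable_fun setT f ->
  measurable_fun setT (fun x => Num.sqrt (f x)).
Proof.
move=> mf; apply: (measurableT_comp _ mf).
by apply: continuous_measurable_fun; exact: sqrt_continuous.
Qed.

End measurability.

Section measurability_pair.
Context d d1 d2 (T : measurableType d) (T1 : measurableType d1) (T2 : measurableType d2).

Lemma measurable_fun_fst (f : T -> (T1 * T2)%type) : measurable_fun setT f ->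
  measurable_fun setT (fun x => (f x).1).
Proof. by move=> mf; apply: measurableT_comp. Qed.

Lemma measurable_fun_snd (f : T -> (T1 * T2)%type) : measurable_fun setT f ->
  measurable_fun setT (fun x => (f x).2).
Proof. by move=> mf; apply: measurableT_comp. Qed.
End measurability_pair.

Ltac mfun := repeat first
  [ exact: measurable_cst | exact: measurable_id | exact: measurable_fst
  | exact: measurable_snd | assumption
  | apply: measurable_funD | apply: measurable_funB | apply: measurable_funN
  | apply: measurable_funX | apply: measurable_fun_inv | apply: measurable_fun_powR
  | apply: measurable_fun_sqrt | apply: measurable_fun_expR | apply: measurable_funM
  | apply: measurable_fun_pair | apply: measurable_fun_fst | apply: measurable_fun_snd
  | apply: measurable_fun_ltr | apply: measurable_fun_ler | apply: measurable_and
  | apply: measurable_fun_ifT ].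

Section densities.
Context {R : realType}.
Local Notation leb := (@lebesgue_measure R).

(** Stated with nonnegative test functions instead of sets, the form to which Tonelli and the
    substitution rules apply without integrability conditions. *)
Definition has_density d (S : measurableType d) (P : probability S R) (V : S -> R)
    (g : R -> R) : Prop :=
  forall h : R -> \bar R, measurable_fun setT h -> (forall x, (0 <= h x)%E) ->
  (\int[P]_s h (V s) = \int[leb]_x (h x * (g x)%:E))%E.

Lemma law_has_density d (S : measurableType d) (P : probability S R)
    (X : {RV P >-> R}) (g : R -> R) :
  measurable_fun setT g -> (forall x, 0 <= g x) ->
  (forall A, measurable A -> distribution P X A = (\int[leb]_(x in A) (g x)%:E)%E) ->
  has_density d S P X g.
Proof.
move=> mg g0 XE h mh h0.
have [nu nuE nuh] := @pushforward_measure _ _ S (measurableTypeR R) R P X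
  (measurable_funP X).
rewrite -nuh//; apply: integral_density => // A mA.
by rewrite nuE -XE.
Qed.

(** The chi-squared density without its normalizing constant. *)
Definition chi_fun (m x : R) : R :=
  if 0 < x then x `^ (m / 2 - 1) * expR (- x / 2) else 0.

Lemma chi_fun_ge0 m x : 0 <= chi_fun m x.
Proof. by rewrite /chi_fun; case: ifP => // _; rewrite mulr_ge0// ?powR_ge0 ?expR_ge0. Qed.

Lemma measurable_chi_fun m : measurable_fun setT (chi_fun m).
Proof. by rewrite /chi_fun; mfun. Qed.

Lemma measurable_chi_fun_comp d (T : measurableType d) m (f : T -> R) :
  measurable_fun setT f -> measurable_fun setT (fun x => chi_fun m (f x)).
Proof. by move=> mf; apply: measurableT_comp => //; exact: measurable_chi_fun. Qed.

Lemma chi2_pdfE (m x : R) :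
  chi2_pdf m x = (2 `^ (m / 2) * Gamma_fun (m / 2))^-1 * chi_fun m x.
Proof. by rewrite /chi2_pdf /chi_fun; case: ifP => _; rewrite ?mulr0// mulrC. Qed.

Lemma chi2_pdf_ge0 (m x : R) : 0 <= chi2_pdf m x.
Proof.
rewrite chi2_pdfE mulr_ge0 ?chi_fun_ge0// invr_ge0 mulr_ge0 ?powR_ge0//.
by apply: Rintegral_ge0 => y _; rewrite mulr_ge0 ?powR_ge0 ?expR_ge0.
Qed.

Lemma measurable_chi2_pdf (m : R) : measurable_fun setT (@chi2_pdf R m).
Proof.
rewrite (_ : chi2_pdf m = fun x => (2 `^ (m / 2) * Gamma_fun (m / 2))^-1 * chi_fun m x); last first.
  by apply/funext => x; exact: chi2_pdfE.
by apply: measurable_funM; [exact: measurable_cst|exact: measurable_chi_fun].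
Qed.

Lemma std_normal_pdfE (x : R) :
  normal_pdf 0 1 x = normal_peak 1 * expR (- x ^+ 2 / 2).
Proof.
by rewrite normal_pdfE ?oner_eq0// /normal_fun subr0 expr1n -[in RHS]mulr_natl mulr1.
Qed.

Lemma measurable_std_normal_pdf d (T : measurableType d) (f : T -> R) :
  measurable_fun setT f -> measurable_fun setT (fun x => normal_pdf 0 1 (f x)).
Proof. by move=> mf; apply: measurableT_comp => //; exact: measurable_normal_pdf. Qed.

Lemma tonelli (f : R -> R -> \bar R) :
  measurable_fun setT (fun z : (R * R)%type => f z.1 z.2) ->
  (forall x y, (0 <= f x y)%E) ->
  (\int[leb]_x \int[leb]_y f x y = \int[leb]_y \int[leb]_x f x y)%E.
Proof.
move=> mf f0.
by apply: (@fubini_tonelli _ _ _ _ R leb leb (fun z => f z.1 z.2)).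
Qed.

(** Rotation invariance of the planar standard normal law. The rotation is factored into two
    one-dimensional affine substitutions, which is where [q != 0] enters; the density only depends
    on the sum of squares. *)
Lemma normal_rotation (H : (R * R)%type -> \bar R) (p q : R) : q != 0 ->
  p ^+ 2 + q ^+ 2 = 1 -> measurable_fun setT H -> (forall z, (0 <= H z)%E) ->
  (\int[leb]_u \int[leb]_y (H (u, y) * (normal_pdf 0 1 u * normal_pdf 0 1 y)%:E) =
   \int[leb]_u \int[leb]_y (H ((p * u + q * y)%R, (p * y - q * u)%R) *
     (normal_pdf 0 1 u * normal_pdf 0 1 y)%:E))%E.
Proof.
move=> q0 pq mH H0; pose N (u v : R) := normal_pdf 0 1 u * normal_pdf 0 1 v.
have N0 u v : 0 <= N u v by rewrite mulr_ge0 ?normal_pdf_ge0.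
pose G (u v : R) := (H (u, v) * (N u v)%:E)%E.
have G0 u v : (0 <= G u v)%E by rewrite mule_ge0 ?lee_fin.
have mG d (T : measurableType d) (f g : T -> R) : measurable_fun setT f ->
    measurable_fun setT g -> measurable_fun setT (fun z => G (f z) (g z)).
  move=> mf mg; apply: emeasurable_funM.
    by apply: (measurableT_comp mH); exact: measurable_fun_pair.
  by apply/measurable_EFinP/measurable_funM; exact: measurable_std_normal_pdf.
(* For fixed [u] the new variable is v = p u - q y; after exchanging the integrals, u = q y + p v
   for fixed [v]. The Jacobians 1/|q| and |q| cancel. *)
transitivity (\int[leb]_u \int[leb]_v (G u (- q^-1 * v + p * u / q)%R * `|- q^-1|%:E))%E.
  apply: eq_integral => u _; rewrite -/(G u) -integral_affine//.
  - by rewrite oppr_eq0 invr_eq0.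
  - by apply: mG; mfun.
rewrite tonelli; last 2 first.
- by apply: emeasurable_funM; [apply: mG|apply/measurable_EFinP]; mfun.
- by move=> u v; rewrite mule_ge0// lee_fin.
apply: eq_integral => v _.
rewrite (integral_affine _ q (p * v))//; last 2 first.
- by apply: emeasurable_funM; [apply: mG|apply/measurable_EFinP]; mfun.
- by move=> u; rewrite mule_ge0// lee_fin.
apply: eq_integral => y _.
rewrite -muleA (_ : `|- q^-1|%:E * `|q|%:E = 1)%E; last first.
  by rewrite -EFinM -normrM mulNr mulVf// normrN normr1.
rewrite mule1 /G.
have -> : - q^-1 * v + p * (q * y + p * v) / q = p * y - q * v.
  transitivity (p * y + (p ^+ 2 - 1) * v / q); first by field.
  by rewrite -pq; field.
rewrite [q * y + _]addrC; congr (_ * _%:E)%E.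
rewrite /N !std_normal_pdfE mulrACA [RHS]mulrACA -!expRD; congr (_ * expR _).
rewrite -!mulrDl; congr (_ / _).
have -> : - v ^+ 2 - y ^+ 2 = - ((p ^+ 2 + q ^+ 2) * (v ^+ 2 + y ^+ 2)).
  by rewrite pq mul1r opprD.
by ring.
Qed.

(** The square of a standard normal variable is chi-squared with one degree of freedom: the two
    half-lines contribute equally, and this factor 2 is absorbed by dc = 2 y dy. *)
Lemma chi_square_base (f : R -> \bar R) : measurable_fun setT f ->
  (forall x, (0 <= f x)%E) ->
  (\int[leb]_y (f (y ^+ 2)%R * (normal_pdf 0 1 y)%:E) =
   (normal_peak 1)%:E * \int[leb]_c (f c * (chi_fun 1 c)%:E))%E.
Proof.
move=> mf f0.
pose G y := (f (y ^+ 2)%R * (normal_pdf 0 1 y)%:E)%E.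
have G0 y : (0 <= G y)%E by rewrite mule_ge0// lee_fin normal_pdf_ge0.
have mG : measurable_fun setT G.
  apply: emeasurable_funM; first by apply: (measurableT_comp mf); mfun.
  by apply/measurable_EFinP; apply: measurable_std_normal_pdf; mfun.
have GN y : G (- y) = G y.
  by rewrite /G !std_normal_pdfE sqrrN.
have -> : (\int[leb]_y G y = \int[leb]_(y in `]0%R, +oo[) G y + \int[leb]_(y in `]0%R, +oo[) G y)%E.
  rewrite -{1}(setUv `]0%R, +oo[%classic) setCitvr ge0_integral_setU//=; last 2 first.
  - exact: measurable_funTS.
  - rewrite disj_set2E; apply/eqP/seteqP; split => x //= [].
    by rewrite !in_itv/= andbT => x0 /(lt_le_trans x0); rewrite ltxx.
  congr (_ + _)%E; under eq_integral do rewrite -GN.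
  by rewrite -ge0_integration_by_substitution0// integral_itv_obnd_cbnd//; exact: measurable_funTS.
pose F c := (f c * (chi_fun 1 c)%:E)%E.
have F0 c : (0 <= F c)%E by rewrite mule_ge0// lee_fin chi_fun_ge0.
have mF : measurable_fun setT F.
  by apply: emeasurable_funM => //; apply/measurable_EFinP; exact: measurable_chi_fun.
have -> : (\int[leb]_c F c = \int[leb]_(c in `]0%R, +oo[) F c)%E.
  rewrite [RHS]integral_mkcond; apply: eq_integral => c _; rewrite patchE.
  case: ifPn => //; rewrite notin_setE/= in_itv/= andbT => /negP/negbTE c0.
  by rewrite /F /chi_fun c0 mule0.
have -> : (\int[leb]_(c in `]0%R, +oo[) F c =
    \int[leb]_(x in `]0%R, +oo[) (F (x ^+ 2)%R * (2 * x)%:E))%E.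
  apply: (increasing_substitution_pos (fun x => x ^+ 2) (fun x => 2 * x)) => //.
  - apply/seteqP; split => [x /=|_ [x /= + <-]]; rewrite !in_itv/= !andbT.
      by move=> x0; exists (Num.sqrt x); rewrite ?in_itv/= ?andbT ?sqrtr_gt0// sqr_sqrtr// ltW.
    by move=> x0; rewrite exprn_gt0.
  - by move=> x y x0 xy; rewrite ltrXn2r// ltW.
  - move=> x x0; apply: is_derive_eq.
    by rewrite /GRing.scale/= mulr1 mulr_natl mulr2n.
  - by move=> x x0; apply: cvgM; [exact: cvg_cst|exact: cvg_id].
  - by mfun.
  - by move=> x x0; rewrite mulr_ge0// ltW.
rewrite -ge0_integralD//; last 2 first.
- exact: measurable_funTS.
- exact: measurable_funTS.
rewrite -ge0_integralZl//; last 3 first.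
- apply: measurable_funTS; apply: emeasurable_funM.
    by apply: (measurableT_comp mF); mfun.
  by apply/measurable_EFinP; mfun.
- by move=> x /=; rewrite in_itv/= andbT => x0; rewrite mule_ge0// lee_fin mulr_ge0// ltW.
- by rewrite lee_fin normal_peak_ge0.
apply: eq_integral => x; rewrite inE/= in_itv/= andbT => x0.
rewrite /F /G -!muleA -ge0_muleDr ?lee_fin ?normal_pdf_ge0// [RHS]muleCA; congr (_ * _)%E.
rewrite -EFinD -!EFinM std_normal_pdfE /chi_fun exprn_gt0//; congr EFin.
have -> : (x ^+ 2) `^ (1 / 2 - 1) = x^-1.
  rewrite -powR_mulrn ?ltW// -powRrM (_ : _ * _ = -1); last by field.
  by rewrite powR_inv1// ltW.
by field; rewrite gt_eqF.
Qed.

(** Adding the square of an independent normal variable raises the degrees of freedom by one. With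
    the sum as new [c] and y = sqrt(c) t, the exponentials combine to exp(-c/2) and the powers
    separate; the integral over [t] is a beta integral, left unevaluated. *)
Lemma chi_square_step (m : R) (f : R -> \bar R) : measurable_fun setT f ->
  (forall x, (0 <= f x)%E) ->
  (\int[leb]_c ((\int[leb]_y (f (c + y ^+ 2)%R * (normal_pdf 0 1 y)%:E)) *
     (chi_fun m c)%:E) =
   \int[leb]_t (normal_peak 1 * (if t ^+ 2 < 1 then (1 - t ^+ 2) `^ (m / 2 - 1) else 0))%:E
   * \int[leb]_c (f c * (chi_fun (m + 1) c)%:E))%E.
Proof.
move=> mf f0.
pose B t := normal_peak 1 * (if t ^+ 2 < 1 then (1 - t ^+ 2) `^ (m / 2 - 1) else 0) : R.
have B0 t : 0 <= B t.
  by rewrite mulr_ge0 ?normal_peak_ge0//; case: ifP => // _; exact: powR_ge0.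
have mB : measurable_fun setT B by rewrite /B; mfun.
rewrite -/B.
pose G c y := (f c * (normal_pdf 0 1 y * chi_fun m (c - y ^+ 2))%:E)%E.
have G0 c y : (0 <= G c y)%E.
  by rewrite mule_ge0// lee_fin mulr_ge0 ?normal_pdf_ge0 ?chi_fun_ge0.
have mG d (T : measurableType d) (g h : T -> R) : measurable_fun setT g ->
    measurable_fun setT h -> measurable_fun setT (fun z => G (g z) (h z)).
  move=> mg mh; apply: emeasurable_funM; first exact: (measurableT_comp mf).
  apply/measurable_EFinP; apply: measurable_funM; first exact: measurable_std_normal_pdf.
  by apply: measurable_chi_fun_comp; mfun.
transitivity (\int[leb]_c \int[leb]_y G (c + y ^+ 2)%R y)%E.
  apply: eq_integral => c _; rewrite -ge0_integralZr//; last 3 first.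
  - apply: emeasurable_funM; first by apply: (measurableT_comp mf); mfun.
    by apply/measurable_EFinP; apply: measurable_std_normal_pdf; mfun.
  - by move=> y _; rewrite mule_ge0// lee_fin normal_pdf_ge0.
  - by rewrite lee_fin chi_fun_ge0.
  by apply: eq_integral => y _; rewrite /G addrK EFinM muleA.
rewrite tonelli//; last by apply: mG; mfun.
transitivity (\int[leb]_y \int[leb]_c G c y)%E.
  apply: eq_integral => y _.
  rewrite [RHS](integral_affine _ 1 (y ^+ 2))//; last by apply: mG; mfun.
  by apply: eq_integral => c _; rewrite normr1 mule1 mul1r.
rewrite tonelli//; last by apply: mG; mfun.
rewrite -ge0_integralZl//; last 3 first.
- apply: emeasurable_funM => //.
  by apply/measurable_EFinP; exact: measurable_chi_fun.
- by move=> c _; rewrite mule_ge0// lee_fin chi_fun_ge0.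
- by apply: integral_ge0 => t _; rewrite lee_fin B0.
apply: eq_integral => c _.
have [c0|c0] := ltP 0 c; last first.
  rewrite /chi_fun ltNge c0 /= mule0 mule0; apply: integral0_eq => y _.
  rewrite /G /chi_fun ifF ?mulr0 ?mule0//; apply/negbTE; rewrite -leNgt.
  by rewrite subr_le0 (le_trans c0)// sqr_ge0.
rewrite (integral_affine _ (Num.sqrt c) 0)//; last 2 first.
- by rewrite gt_eqF// sqrtr_gt0.
- by apply: mG; mfun.
rewrite -ge0_integralZr//; last 3 first.
- by apply/measurable_EFinP.
- by move=> t _; rewrite lee_fin B0.
- by rewrite mule_ge0// lee_fin chi_fun_ge0.
apply: eq_integral => t _.
rewrite addr0 /G [RHS]muleCA -muleA; congr (_ * _)%E; rewrite -!EFinM; congr EFin.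
have c0' : 0 <= c := ltW c0.
rewrite std_normal_pdfE gtr0_norm ?sqrtr_gt0// exprMn sqr_sqrtr// /chi_fun c0 /B.
rewrite (_ : c - c * t ^+ 2 = c * (1 - t ^+ 2)); last by ring.
rewrite pmulr_rgt0// subr_gt0; case: ifPn => t1; last by rewrite !mulr0 !mul0r.
rewrite powRM ?subr_ge0 ?(ltW t1)//.
have -> : c `^ ((m + 1) / 2 - 1) = c `^ (m / 2 - 1) * Num.sqrt c.
  rewrite -powR12_sqrt// -powRD; last by apply/implyP => _; rewrite gt_eqF.
  by congr (_ `^ _); field.
have -> : expR (- c / 2) = expR (- (c * t ^+ 2) / 2) * expR (- (c * (1 - t ^+ 2)) / 2).
  by rewrite -expRD; congr expR; field.
by ring.
Qed.

End densities.

(** * Mean and scatter of a normal sample *)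

Section normal_sample.
Context {R : realType}.
Local Notation leb := (@lebesgue_measure R).
Local Notation phi := (@normal_pdf R 0 1).

(* One step of the Helmert recursion: with [z = (sqrt k * mean, sum of squared
   deviations)] of [k] observations, adding the observation [y]. *)
Definition helmert (k : nat) (z : (R * R)%type) (y : R) : R * R :=
  ((Num.sqrt k%:R * z.1 + y) / Num.sqrt k.+1%:R,
   z.2 + ((Num.sqrt k%:R * y - z.1) / Num.sqrt k.+1%:R) ^+ 2).

Fixpoint helmert_iter (y : nat -> R) (k : nat) : R * R :=
  if k is k'.+1 then helmert k' (helmert_iter y k') (y k') else (0, 0).

(** For k > 0 each step rotates the pair formed by the old first coordinate and the new observation,
    so it preserves the sum of squares; the coordinate that is split off enters the second component
    squared. At k = 0 the step just copies the observation, because [sqrt 0] is 0. *)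
Lemma helmert_iterE (y : nat -> R) k :
  Num.sqrt k%:R * (helmert_iter y k).1 = \sum_(i < k) y i /\
  (helmert_iter y k).2 + (helmert_iter y k).1 ^+ 2 = \sum_(i < k) y i ^+ 2.
Proof.
elim: k => [|k [ih1 ih2]] /=; first by rewrite !big_ord0 mulr0 expr0n addr0.
have k0 : Num.sqrt k.+1%:R != 0 :> R by rewrite gt_eqF// sqrtr_gt0 ltr0n.
rewrite !big_ord_recr/= -ih1 -ih2 /helmert/=; split.
  by rewrite mulrC divfK.
set u := (_ k).1; set v := (_ k).2.
have sk : Num.sqrt k%:R ^+ 2 = k%:R :> R by rewrite sqr_sqrtr.
have sk1 : Num.sqrt k.+1%:R ^+ 2 = k%:R + 1 :> R by rewrite sqr_sqrtr// -natr1.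
have kn0 : k%:R + 1 != 0 :> R by rewrite natr1 pnatr_eq0.
rewrite !exprMn !exprVn sk1.
transitivity (v + (Num.sqrt k%:R ^+ 2 + 1) * (u ^+ 2 + y k ^+ 2) / (k%:R + 1)).
  by field.
by rewrite sk; field.
Qed.

Context d d2 (S : measurableType d) (T : measurableType d2) (P : probability S R).
Variables (n : nat) (X : 'I_n -> {RV P >-> T}) (g : T -> R).
Hypothesis indX : mutually_independent X.
Hypothesis mg : measurable_fun setT g.
Hypothesis densX : forall k, has_density _ _ P (fun s => g (X k s)) phi.

(** Extended by 0 beyond the sample, so that the recursion can run over all natural numbers. *)
Definition observation (k : nat) (s : S) : R :=
  if insub k is Some i then g (X i s) else 0.

Let V k s := helmert_iter (observation ^~ s) k.

Let step k (z : (R * R) * T) := helmert k z.1 (g z.2).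

Let mstep k : measurable_fun setT (step k).
Proof.
have mg2 : measurable_fun setT (fun z : (R * R) * T => g z.2) by exact: measurableT_comp.
by rewrite /step /helmert; mfun.
Qed.

Let VS (k : 'I_n) s : V k.+1 s = step k (V k s, X k s).
Proof. by rewrite /V /= /step /= /observation valK. Qed.

Let V0 s : V 0 s = (0, 0). Proof. by []. Qed.

Let mV k : (k <= n)%N -> measurable_fun setT (V k).
Proof. exact: (measurable_prefix _ _ _ _ _ _ _ P n X V step (0,0)). Qed.

Let phi0 x : (0 <= (phi x)%:E)%E. Proof. by rewrite lee_fin normal_pdf_ge0. Qed.

Let mphi d' (T' : measurableType d') (f : T' -> R) : measurable_fun setT f ->
  measurable_fun setT (fun x => (phi (f x))%:E).
Proof. by move=> mf; apply/measurable_EFinP; exact: measurable_std_normal_pdf. Qed.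

Let integral_step (k : 'I_n) (h : (R * R)%type -> \bar R) : measurable_fun setT h ->
  (forall z, (0 <= h z)%E) ->
  (\int[P]_s h (V k.+1 s) =
   \int[P]_s \int[leb]_y (h (helmert k (V k s) y) * (phi y)%:E))%E.
Proof.
move=> mh h0; under eq_integral do rewrite VS.
have kn : (k <= n)%N by exact: ltnW.
have hs0 z : (0 <= (h \o step k) z)%E by exact: h0.
have mhs : measurable_fun setT (h \o step k) by exact: measurableT_comp.
rewrite (independent_integral _ _ _ _ _ _ _ P (V k) (X k) (h \o step k))//; last 2 first.
- exact: mV.
- move=> A B mA mB.
  exact: (prefix_independence _ _ _ _ _ _ _ P n X V step (0, 0)).
apply: eq_integral => s _ /=.
rewrite -(densX k (fun y => h (helmert k (V k s) y)))//.
apply: (measurableT_comp mh); rewrite /helmert; mfun.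
Qed.

Let integral_phi : (\int[leb]_u (phi u)%:E = 1)%E.
Proof. exact: integral_normal_pdf. Qed.

Let tonelliP (f : S -> R -> \bar R) :
  measurable_fun setT (fun z : (S * R)%type => f z.1 z.2) ->
  (forall s x, (0 <= f s x)%E) ->
  (\int[P]_s \int[leb]_x f s x = \int[leb]_x \int[P]_s f s x)%E.
Proof.
move=> mf f0.
by apply: (@fubini_tonelli _ _ _ _ R P leb (fun z => f z.1 z.2)).
Qed.

(** In terms of test functions: the first coordinate of the state is standard normal and independent
    of the second. *)
Let split_law k := forall h : (R * R)%type -> \bar R, measurable_fun setT h ->
  (forall z, (0 <= h z)%E) ->
  (\int[P]_s h (V k s) = \int[P]_s \int[leb]_u (h (u, (V k s).2) * (phi u)%:E))%E.

Let split_law_step (k : 'I_n) (h : (R * R)%type -> \bar R) : (0 < k)%N -> split_law k ->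
  measurable_fun setT h -> (forall z, (0 <= h z)%E) ->
  (\int[P]_s h (V k.+1 s) = \int[P]_s \int[leb]_u \int[leb]_y
     (h (u, (V k s).2 + y ^+ 2)%R * (phi u * phi y)%:E))%E.
Proof.
move=> k0 lawk mh h0; rewrite integral_step//.
pose F (z : (R * R)%type) := (\int[leb]_y (h (helmert k z y) * (phi y)%:E))%E.
have mhel d' (T' : measurableType d') (f : T' -> (R * R)%type) (f' : T' -> R) :
    measurable_fun setT f -> measurable_fun setT f' ->
    measurable_fun setT (fun x => h (helmert k (f x) (f' x))).
  by move=> mf mf'; apply: (measurableT_comp mh); rewrite /helmert; mfun.
have mF : measurable_fun setT F.
  apply: (measurable_fun_fubini_tonelli_F (m2 := leb)
    (fun z => (h (helmert k z.1 z.2) * (phi z.2)%:E)%E)).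
    by apply: emeasurable_funM; [apply: mhel|apply: mphi]; mfun.
  by move=> z; rewrite mule_ge0.
rewrite (lawk F)//; last by move=> z; apply: integral_ge0 => y _; rewrite mule_ge0.
apply: eq_integral => s _; set v := (V k s).2.
have kn0 : Num.sqrt k.+1%:R != 0 :> R by rewrite gt_eqF// sqrtr_gt0 ltr0n.
have sk : Num.sqrt k%:R ^+ 2 = k%:R :> R by rewrite sqr_sqrtr.
have sk1 : Num.sqrt k.+1%:R ^+ 2 = k%:R + 1 :> R by rewrite sqr_sqrtr// -natr1.
(* The Helmert step acts on (u, y) as the rotation with p = sqrt(k/(k+1)) and q = 1/sqrt(k+1). *)
rewrite [RHS](normal_rotation (fun z => h (z.1, v + z.2 ^+ 2)%R)
  (Num.sqrt k%:R / Num.sqrt k.+1%:R) (Num.sqrt k.+1%:R)^-1)//; last 2 first.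
- rewrite !exprMn !exprVn sk sk1 -[X in _ + X]mul1r -mulrDl divff//.
- by apply: (measurableT_comp mh); mfun.
apply: eq_integral => u _; rewrite -ge0_integralZr//; last 2 first.
- by apply: emeasurable_funM; [apply: mhel|apply: mphi]; mfun.
- by move=> y _; rewrite mule_ge0.
apply: eq_integral => y _; rewrite -muleA -EFinM [phi y * _]mulrC; congr (h _ * _)%E.
rewrite /helmert /=; congr pair; first by field.
by congr (_ + _ ^+ 2); field.
Qed.

Let chi_step (k : 'I_n) (f : R -> \bar R) : (0 < k)%N -> split_law k ->
  measurable_fun setT f -> (forall z, (0 <= f z)%E) ->
  (\int[P]_s f (V k.+1 s).2 =
   \int[P]_s \int[leb]_y (f ((V k s).2 + y ^+ 2)%R * (phi y)%:E))%E.
Proof.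
move=> k0 lawk mf f0; rewrite (split_law_step k (f \o snd))//; last 2 first.
- exact: measurableT_comp.
- by move=> z; exact: f0.
apply: eq_integral => s _ /=; set v := (V k s).2.
have mfv : measurable_fun setT (fun y : R => f (v + y ^+ 2)).
  by apply: (measurableT_comp mf); mfun.
under eq_integral => u _.
  under eq_integral => y _ do rewrite EFinM muleCA.
  rewrite ge0_integralZl//; last 2 first.
    by apply: emeasurable_funM; [exact: mfv|apply: mphi; mfun].
    by move=> y _; rewrite mule_ge0.
  over.
rewrite ge0_integralZr//; first by rewrite integral_phi mul1e.
- by apply: mphi; mfun.
- by apply: integral_ge0 => y _; rewrite mule_ge0.
Qed.

(** After the rotation the fresh normal variable [u] occurs only as the first argument of [h], and
    what remains in the second argument is, by [chi_step], distributed as the second coordinate of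
    the next state. *)
Let split_lawP k : (0 < k <= n)%N -> split_law k.
Proof.
elim: k => // -[_ n0|k ih kn] h mh h0.
  pose k0 := Ordinal n0.
  have y0 s : V 1 s = (g (X k0 s), 0).
    rewrite (VS k0) V0 /step /helmert /= sqrtr0 !mul0r add0r sqrtr1 divr1.
    by rewrite subrr mul0r expr0n addr0.
  under eq_integral do rewrite y0.
  under [RHS]eq_integral do rewrite y0 /=.
  rewrite (densX k0 (fun u => h (u, 0)))//; last first.
    by apply: (measurableT_comp mh); mfun.
  set c := (\int[leb]_u _)%E.
  transitivity (c * P setT)%E; first by rewrite probability_setT mule1.
  by rewrite -integral_cst.
have kn' : (k.+1 < n)%N by [].
pose k' := Ordinal kn'.
have lawk : split_law k' by apply: ih; rewrite /= ltnW.
rewrite (split_law_step k')//.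
have m2 : measurable_fun setT (fun s => (V k.+2 s).2).
  by apply: measurable_fun_snd; exact: mV.
have m1 : measurable_fun setT (fun s => (V k.+1 s).2).
  by apply: measurable_fun_snd; apply: mV; exact: ltnW.
rewrite [RHS]tonelliP; last 2 first.
- apply: emeasurable_funM; last by apply: mphi; mfun.
  apply: (measurableT_comp mh); apply: measurable_fun_pair; first by mfun.
  exact: (measurableT_comp m2).
- by move=> s u; rewrite mule_ge0.
rewrite [LHS]tonelliP; last 2 first.
- apply: (measurable_fun_fubini_tonelli_F (m2 := leb) (fun w : (S * R * R)%type =>
    (h (w.1.2, (V k.+1 w.1.1).2 + w.2 ^+ 2)%R * (phi w.1.2 * phi w.2)%:E)%E)).
    apply: emeasurable_funM.
      apply: (measurableT_comp mh); apply: measurable_fun_pair; first by mfun.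
      apply: measurable_funD; last by mfun.
      by apply: (measurableT_comp m1); mfun.
    by apply/measurable_EFinP; apply: measurable_funM; apply: measurable_std_normal_pdf; mfun.
  by move=> w; rewrite mule_ge0// lee_fin mulr_ge0// normal_pdf_ge0.
- move=> s u; apply: integral_ge0 => y _.
  by rewrite mule_ge0// lee_fin mulr_ge0// normal_pdf_ge0.
apply: eq_integral => u _.
rewrite ge0_integralZr//; last first.
  by apply: (measurableT_comp mh); apply: measurable_fun_pair => //; mfun.
have -> : (\int[P]_s h (u, (V k.+2 s).2) = \int[P]_s \int[leb]_y
    (h (u, (V k.+1 s).2 + y ^+ 2)%R * (phi y)%:E))%E.
  apply: (chi_step k' (fun c => h (u, c))) => //.
  by apply: (measurableT_comp mh); mfun.
rewrite -ge0_integralZr//; last 2 first.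
- apply: (measurable_fun_fubini_tonelli_F (m2 := leb) (fun w : (S * R)%type =>
    (h (u, (V k.+1 w.1).2 + w.2 ^+ 2)%R * (phi w.2)%:E)%E)).
    apply: emeasurable_funM; last by apply: mphi; mfun.
    apply: (measurableT_comp mh); apply: measurable_fun_pair; first by mfun.
    apply: measurable_funD; last by mfun.
    by apply: (measurableT_comp m1); mfun.
  by move=> w; rewrite mule_ge0.
- by move=> s _; apply: integral_ge0 => y _; rewrite mule_ge0.
apply: eq_integral => s _.
rewrite -ge0_integralZr//; last 2 first.
- apply: emeasurable_funM; last by apply: mphi; mfun.
  by apply: (measurableT_comp mh); mfun.
- by move=> y _; rewrite mule_ge0.
by apply: eq_integral => y _; rewrite EFinM -muleA [X in (_ * X)%E]muleC.
Qed.

(** [kappa] accumulates the beta integrals of [chi_square_step]. It stays an unevaluated extended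
    real until a total mass of one determines it. The induction starts from the first state, whose
    second coordinate is 0, so the second one carries a single square. *)
Let chi_law k : (0 < k < n)%N -> exists2 kappa : \bar R, (0 <= kappa)%E &
  forall f : R -> \bar R, measurable_fun setT f -> (forall x, (0 <= f x)%E) ->
  (\int[P]_s f (V k.+1 s).2 = kappa * \int[leb]_c (f c * (chi_fun k%:R c)%:E))%E.
Proof.
elim: k => // -[_ /= n1|k ih /= kn].
  exists (normal_peak 1)%:E; first by rewrite lee_fin normal_peak_ge0.
  move=> f mf f0; have n0 := ltnW n1.
  have law1 : split_law (Ordinal n1) by exact: split_lawP.
  rewrite (chi_step (Ordinal n1))//.
  have V1 s : (V 1 s).2 = 0.
    rewrite (VS (Ordinal n0)) V0 /step /helmert /= sqrtr0 !mul0r add0r.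
    by rewrite subrr mul0r expr0n.
  under eq_integral => s _.
    rewrite V1; under eq_integral => y _ do rewrite add0r.
    rewrite chi_square_base//; over.
  set c := (_ * _)%E; transitivity (c * P setT)%E; last by rewrite probability_setT mule1.
  by rewrite -integral_cst.
have kn' : (k.+1 < n)%N by exact: ltnW.
have [kappa kappa0 ihk] := ih kn'.
have lawk : split_law (Ordinal kn) by apply: split_lawP => /=; exact: ltnW.
exists (kappa * \int[leb]_t (normal_peak 1 *
    (if t ^+ 2 < 1 then (1 - t ^+ 2) `^ (k.+1%:R / 2 - 1) else 0))%:E)%E.
  rewrite mule_ge0//; apply: integral_ge0 => t _.
  rewrite lee_fin mulr_ge0 ?normal_peak_ge0//; case: ifP => // _; exact: powR_ge0.
move=> f mf f0; rewrite (chi_step (Ordinal kn))//=.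
rewrite (ihk (fun c => \int[leb]_y (f (c + y ^+ 2)%R * (phi y)%:E)))%E.
- by rewrite chi_square_step// natr1 muleA.
- apply: (measurable_fun_fubini_tonelli_F (m2 := leb)
    (fun w : (R * R)%type => (f (w.1 + w.2 ^+ 2)%R * (phi w.2)%:E)%E)).
    by apply: emeasurable_funM; [apply: (measurableT_comp mf)|apply: mphi]; mfun.
  by move=> w; rewrite mule_ge0.
- by move=> x; apply: integral_ge0 => y _; rewrite mule_ge0.
Qed.

Lemma helmert_law : (1 < n)%N -> exists2 kappa : \bar R, (0 <= kappa)%E &
  forall h : (R * R)%type -> \bar R, measurable_fun setT h -> (forall z, (0 <= h z)%E) ->
  (\int[P]_s h (helmert_iter (observation ^~ s) n) =
   kappa * \int[leb]_c ((\int[leb]_u (h (u, c) * (phi u)%:E)) *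
                         (chi_fun n.-1%:R c)%:E))%E.
Proof.
move=> n1; have nE : n = n.-1.+1 by rewrite prednK// ltnW.
have [|kappa kappa0 lawS] := chi_law n.-1.
  by rewrite -ltnS prednK ?(ltnW n1)// n1 leqnn.
exists kappa => // h mh h0.
transitivity (\int[P]_s h (V n s))%E; first by [].
rewrite (split_lawP n)//; last by rewrite leqnn ltnW.
rewrite -(lawS (fun c => \int[leb]_u (h (u, c) * (phi u)%:E)))%E; last 2 first.
- apply: (measurable_fun_fubini_tonelli_F (m2 := leb)
    (fun w : (R * R)%type => (h (w.2, w.1) * (phi w.2)%:E)%E)).
    by apply: emeasurable_funM; [apply: (measurableT_comp mh)|apply: mphi]; mfun.
  by move=> w; rewrite mule_ge0.
- by move=> x; apply: integral_ge0 => y _; rewrite mule_ge0.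
by rewrite -nE.
Qed.

Lemma measurable_helmert_iter :
  measurable_fun setT (fun s => helmert_iter (observation ^~ s) n).
Proof. exact: mV. Qed.

End normal_sample.

(** * Integrals over the parameter space *)

Section substitutions_and_gaussians.
Context {R : realType}.
Local Notation leb := (@lebesgue_measure R).

Lemma integral_gaussian (m s : R) : 0 < s ->
  (\int[leb]_x (expR (- (x - m) ^+ 2 / (2 * s ^+ 2)))%:E = (s / normal_peak 1)%:E)%E.
Proof.
move=> s0; have s_neq0 : s != 0 by rewrite gt_eqF.
have pk0 : 0 < normal_peak s by exact: normal_peak_gt0.
have pkE : normal_peak s = normal_peak 1 / s.
  rewrite /normal_peak expr1n mul1r -mulrnAr sqrtrM ?sqr_ge0// sqrtr_sqr gtr0_norm//.
  by rewrite invfM mulrC.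
have pk1 : 0 < normal_peak (1 : R) by apply: normal_peak_gt0; exact: oner_neq0.
transitivity (\int[leb]_x ((normal_peak s)^-1%:E * (normal_pdf m s x)%:E))%E.
  apply: eq_integral => x _.
  have -> : normal_pdf m s x = normal_peak s * normal_fun m s x by rewrite normal_pdfE.
  rewrite -EFinM; congr EFin; rewrite mulKf ?gt_eqF//.
  by rewrite /normal_fun mulr_natl.
rewrite ge0_integralZl//.
- by rewrite integral_normal_pdf mule1 pkE invf_div.
- by apply/measurable_EFinP; exact: measurable_normal_pdf.
- by move=> x _; rewrite lee_fin normal_pdf_ge0.
- by rewrite lee_fin invr_ge0 ltW.
Qed.

Lemma inverse_square_substitution (k : R) (F : R -> \bar R) : 0 < k ->
  measurable_fun setT F -> (forall x, (0 <= F x)%E) ->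
  (\int[leb]_(c in `]0%R, +oo[) F c =
   \int[leb]_(s in `]0%R, +oo[) (F (k / s ^+ 2)%R * (2 * k / s ^+ 3)%:E))%E.
Proof.
move=> k0 mF F0.
(* The map k / s^2 is decreasing, so the integral is reflected first and the increasing map - k /
   s^2 is substituted. *)
transitivity (\int[leb]_(c in `]-oo, 0%R[) F (- c)%R)%E.
  rewrite integral_mkcond integral_reflection; last 2 first.
  - apply/(measurable_restrictT _ (measurable_itv _)); exact: measurable_funTS.
  - by move=> x; rewrite patchE; case: ifP.
  rewrite [RHS]integral_mkcond; apply: eq_integral => x _; rewrite !patchE.
  by rewrite !mem_setE !in_itv/= andbT oppr_gt0.
transitivity (\int[leb]_(s in `]0%R, +oo[) (F (- - (k / s ^+ 2))%R * (2 * k / s ^+ 3)%:E))%E.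
  apply: (increasing_substitution_pos (fun s => - (k / s ^+ 2)) (fun s => 2 * k / s ^+ 3)
    _ (fun c => F (- c))) => //.
  - apply/seteqP; split => [x /=|_ [x /= + <-]]; rewrite !in_itv/= ?andbT => x0.
      exists (Num.sqrt (k / - x)).
        by rewrite /= in_itv/= andbT sqrtr_gt0 divr_gt0// oppr_gt0.
      have xn0 : x != 0 by rewrite lt_eqF.
      rewrite sqr_sqrtr; last by rewrite divr_ge0// ?oppr_ge0 ltW.
      by field; rewrite xn0 gt_eqF.
    by rewrite oppr_lt0 divr_gt0// exprn_gt0.
  - move=> x y x0 xy; have y0 := lt_trans x0 xy.
    rewrite ltrN2 ltr_pM2l// ltf_pV2 ?posrE ?exprn_gt0//.
    by rewrite ltrXn2r// ltW.
  - move=> x x0.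
    have xn0 : x ^+ 2 != 0 by rewrite expf_neq0// gt_eqF.
    have dsqr : is_derive x 1 (fun s : R => s ^+ 2) (2 * x).
      by apply: is_derive_eq; rewrite /GRing.scale/= mulr1 mulr_natl mulr2n.
    have dinv := is_deriveV (f := fun s : R => s ^+ 2) xn0 dsqr.
    have -> : (fun s => - (k / s ^+ 2)) = (- k) \*: (fun s => (s ^+ 2)^-1).
      by apply/funext => s; rewrite /= /GRing.scale/= mulNr.
    apply: is_derive_eq; rewrite /GRing.scale/=; field.
    by rewrite gt_eqF.
  - move=> x x0; apply: cvgM; first exact: cvg_cst.
    apply: cvgV; first by rewrite expf_neq0// gt_eqF.
    exact: exprn_continuous.
  - by mfun.
  - by mfun.
  - by move=> x x0; rewrite divr_ge0// ?exprn_ge0 ?mulr_ge0// ltW.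
  - by apply: (measurableT_comp mF); mfun.
by under eq_integral do rewrite opprK.
Qed.

(** The inverse map is w = r / sqrt(1 - r^2), and 1 - r^2 = 1 / (1 + w^2): powers of 1 - r^2 become
    powers of the same quantity as the Jacobian. *)
Lemma unit_interval_substitution (F : R -> \bar R) :
  measurable_fun setT F -> (forall x, (0 <= F x)%E) ->
  (\int[leb]_(r in `](-1)%R, 1%R[) F r =
   \int[leb]_w (F (w / Num.sqrt (1 + w ^+ 2))%R * ((Num.sqrt (1 + w ^+ 2))^-1 ^+ 3)%:E))%E.
Proof.
move=> mF F0; pose D (w : R) : R := Num.sqrt (1 + w ^+ 2).
have D2 w : D w ^+ 2 = 1 + w ^+ 2 by rewrite sqr_sqrtr// addr_ge0// sqr_ge0.
have D0 w : 0 < D w by rewrite sqrtr_gt0 ltr_wpDr// sqr_ge0.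
have D_neq0 w : D w != 0 by rewrite gt_eqF.
have dD (w : R) : is_derive w 1 D (w / D w).
  have d1 : is_derive (1 + w ^+ 2) 1 Num.sqrt (2 * Num.sqrt (1 + w ^+ 2))^-1.
    by apply: is_derive1_sqrt; rewrite ltr_wpDr// sqr_ge0.
  have d2 : is_derive w 1 (fun w : R => 1 + w ^+ 2) (2 * w).
    by apply: is_derive_eq; rewrite /GRing.scale/= add0r mul1r mulr1 mulr_natl mulr2n.
  have d3 := is_derive1_comp (g := fun w : R => 1 + w ^+ 2) d1 d2.
  have -> : w / D w = (2 * D w)^-1 * (2 * w) by field; rewrite D_neq0.
  exact: d3.
have dphi (w : R) : is_derive w 1 (fun w => w / D w) ((D w)^-1 ^+ 3).
  have dinv := is_deriveV (f := D) (D_neq0 w) (dD w).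
  have -> : (fun w => w / D w) = (id \* (fun w => (D w)^-1)) by [].
  apply: is_derive_eq; rewrite /GRing.scale/= mulr1.
  transitivity ((D w ^+ 2 - w ^+ 2) / D w ^+ 3); first by field.
  by rewrite D2 addrK mul1r exprVn.
have cD : continuous D.
  by move=> w; apply/differentiable_continuous/derivable1_diffP; have [] := dD w.
have mD : measurable_fun setT D by exact: continuous_measurable_fun.
apply: (increasing_substitutionT (fun w => w / D w) (fun w => (D w)^-1 ^+ 3)) => //.
- apply/seteqP; split => [r /=|_ [w _ <-] /=]; rewrite in_itv/= -ltr_norml.
    move=> r1.
    have r2 : 0 < 1 - r ^+ 2 by rewrite subr_gt0 -real_normK ?num_real// expr_lt1.
    exists (r / Num.sqrt (1 - r ^+ 2)) => //.
    have -> : D (r / Num.sqrt (1 - r ^+ 2)) = (Num.sqrt (1 - r ^+ 2))^-1.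
      rewrite /D exprMn exprVn sqr_sqrtr ?ltW// -sqrtrV ?ltW//; congr Num.sqrt.
      by field; rewrite gt_eqF.
    by rewrite invrK divfK// gt_eqF// sqrtr_gt0.
  rewrite normrM normfV (gtr0_norm (D0 w)) ltr_pdivrMr// mul1r.
  rewrite -sqrtr_sqr ltr_sqrt; first by rewrite ltrDr.
  by rewrite ltr_wpDr// sqr_ge0.
- move=> x y xy.
  have [|z _ zE] := MVT xy (fun z _ => dphi z).
    by apply: derivable_within_continuous => z _; have [] := dphi z.
  rewrite -subr_gt0 zE mulr_gt0 ?subr_gt0// exprn_gt0// invr_gt0.
  exact: D0.
- move=> x; apply: (cvg_comp (fun w => (D w)^-1) (fun y => y ^+ 3)).
    by apply: cvgV => //; exact: cD.
  exact: exprn_continuous.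
- by mfun.
- by mfun.
- by move=> x; rewrite exprn_ge0// invr_ge0 ltW.
Qed.

End substitutions_and_gaussians.

(** * Positivity and convergence of one-dimensional integrals *)

Section positive_integrals.
Context {R : realType}.
Local Notation leb := (@lebesgue_measure R).

Lemma integral_pos_gt0 (f : R -> \bar R) : measurable_fun setT f ->
  (forall x, (0 <= f x)%E) -> (forall x, 0 < x -> (0 < f x)%E) ->
  (0 < \int[leb]_x f x)%E.
Proof.
move=> mf f0 fpos; rewrite lt0e integral_ge0 ?andbT//; apply/eqP => I0.
have : (\int[leb]_x `|f x| = 0)%E by under eq_integral do rewrite gee0_abs//.
move=> /(ae_eq_integral_abs leb measurableT mf)[N [mN N0 sub]].
have : (leb (`]0%R, 1%R[%classic : set R) <= leb N)%E.
  apply: le_measure; rewrite ?inE//.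
  move=> x /=; rewrite in_itv/= => /andP[x0 _]; apply: sub => /= /(_ I) fx0.
  by have := fpos x x0; rewrite fx0 ltxx.
by rewrite N0 lebesgue_measure_itv/= lte_fin ltr01 oppr0 adde0 lee_fin ler10.
Qed.

Lemma powRN_cvg0 (p : R) : 0 < p -> x `^ (- p) @[x --> +oo] --> (0 : R).
Proof.
move=> p0; apply/cvgrPdist_lt => e e0; near=> x.
have x0 : 0 < x by near: x; exact: nbhs_pinfty_gt.
rewrite sub0r normrN ger0_norm ?powR_ge0// powRN -[ltRHS]invrK.
rewrite ltf_pV2 ?posrE ?powR_gt0 ?invr_gt0//.
have -> : e^-1 = (e^-1 `^ p^-1) `^ p.
  by rewrite -powRrM mulVf ?gt_eqF// powRr1// invr_ge0 ltW.
by apply: gt0_ltr_powR => //; rewrite ?nnegrE ?powR_ge0 ?ltW//; near: x; exact: nbhs_pinfty_gt.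
Unshelve. all: by end_near. Qed.

(** On []0, 1[] the exponential beats every negative power of [x], which needs D > 0; on [[1, +oo[]
    it is at most 1 and the power is integrable, which needs p > 0. *)
Lemma inverse_gamma_lty (p D : R) : 0 < p -> 0 < D ->
  (\int[leb]_(x in `]0%R, +oo[) (x `^ (- p - 1) * expR (- D / (2 * x ^+ 2)))%:E < +oo)%E.
Proof.
move=> p0 D0; pose f x := x `^ (- p - 1) * expR (- D / (2 * x ^+ 2)).
have f0 x : 0 <= f x by rewrite mulr_ge0// ?powR_ge0 ?expR_ge0.
have mf : measurable_fun setT f by rewrite /f; mfun.
have mf' A : measurable_fun A (EFin \o f) by apply/measurable_EFinP; exact: measurable_funTS.
have -> : `]0, +oo[%classic = `]0, 1[%classic `|` `[1, +oo[%classic :> set R.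
  by apply/esym; rewrite -itv_bndbnd_setU// bnd_simp.
rewrite ge0_integral_setU//=; last 3 first.
- exact: mf'.
- by move=> x _; rewrite lee_fin; exact: f0.
- rewrite disj_set2E; apply/eqP/seteqP; split => x //= [].
  by rewrite !in_itv/= andbT => /andP[_ x1] /(lt_le_trans x1); rewrite ltxx.
have [M fM] : exists M, forall x, x \in `]0, 1[ -> f x <= M.
  (* Chosen so that 2 (k + 1) exceeds p + 1; the bound exp y >= y^(k+1) / (k+1)! then compensates
     x^(- p - 1) for x < 1. *)
  pose k := Num.truncn ((p + 1) / 2).
  exists ((k.+1)`!%:R / (D / 2) ^+ k.+1) => x; rewrite in_itv/= => /andP[x0 x1].
  rewrite /f mulNr expRN ler_pdivrMr ?expR_gt0//.
  have y0 : 0 <= D / (2 * x ^+ 2) by rewrite divr_ge0 ?mulr_ge0 ?sqr_ge0// ltW.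
  apply: (@le_trans _ _ ((k.+1)`!%:R / (D / 2) ^+ k.+1 *
      ((D / (2 * x ^+ 2)) ^+ k.+1 / (k.+1)`!%:R))); last first.
    rewrite ler_wpM2l ?divr_ge0 ?exprn_ge0 ?ler0n// ?divr_ge0// ?(ltW D0)//.
    by apply: le_trans (expR_ge1Dxn k y0); rewrite lerDr.
  have -> : D / (2 * x ^+ 2) = D / 2 * (x ^+ 2)^-1 by rewrite invfM mulrA.
  have : (D / 2) ^+ k.+1 != 0 by rewrite expf_neq0// mulf_neq0 ?gt_eqF.
  rewrite [(D / 2 * _) ^+ _]exprMn; move: ((D / 2) ^+ k.+1) => y yn0.
  have -> : (k.+1)`!%:R / y * (y * (x ^+ 2)^-1 ^+ k.+1 / (k.+1)`!%:R)
     = (x ^+ 2)^-1 ^+ k.+1.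
    have : (k.+1)`!%:R != 0 :> R by rewrite pnatr_eq0 -lt0n fact_gt0.
    move: ((k.+1)`!%:R) ((x ^+ 2)^-1 ^+ k.+1) => u v un0.
    by field; rewrite yn0 un0.
  rewrite exprVn -exprM -(powR_mulrn _ (ltW x0)) -powRN.
  apply: ger_powR; first by rewrite x0 ltW.
  rewrite -opprD lerN2 natrM mulrC -ler_pdivrMr//.
  by apply/ltW/truncnS_gt.
apply: lte_add_pinfty.
  apply: (@le_lt_trans _ _ (\int[leb]_(x in `]0%R, 1%R[) (cst M%:E) x)%E).
    apply: ge0_le_integral => //=.
    - by move=> x _; rewrite lee_fin; exact: f0.
    - exact: mf'.
  rewrite integral_cst//= (_ : leb `]0, 1[%classic = 1%E) ?mule1 ?ltry//.
  by rewrite lebesgue_measure_itv/= lte_fin ltr01 oppr0 adde0.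
apply: (@le_lt_trans _ _ (\int[leb]_(x in `[1%R, +oo[) (x `^ (- p - 1))%:E)%E).
  apply: ge0_le_integral => //=.
  - by move=> x _; rewrite lee_fin; exact: f0.
  - exact: mf'.
  - by apply/measurable_EFinP; apply: measurable_funTS; mfun.
  - move=> x _; rewrite lee_fin ler_piMr ?powR_ge0// -expR0 ler_expR.
    by rewrite mulNr oppr_le0 divr_ge0 ?(ltW D0)// mulr_ge0// sqr_ge0.
have dpow (x : R) (q : R) : 0 < x -> is_derive x 1 (fun x => x `^ q) (q * x `^ (q - 1)).
  exact: is_derive1_powR.
have dF (x : R) : 0 < x -> is_derive x 1 (fun x => - p^-1 * x `^ (- p)) (x `^ (- p - 1)).
  move=> x0; have dx := dpow x (- p) x0.
  have -> : x `^ (- p - 1) = - p^-1 *: (- p * x `^ (- p - 1)).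
    by rewrite /GRing.scale/= mulrA mulrNN mulVf ?mul1r// gt_eqF.
  by apply: is_deriveZ.
rewrite (@ge0_continuous_FTC2y _ _ (fun x => - p^-1 * x `^ (- p)) 1 0)//.
- by rewrite -EFinB ltry.
- by move=> x _; exact: powR_ge0.
- by apply: derivable_within_continuous => x; rewrite in_itv/= andbT => x1; have [] := dpow x (- p - 1) (lt_le_trans ltr01 x1).
- by rewrite -(mulr0 (- p^-1)); apply: cvgM; [exact: cvg_cst|exact: powRN_cvg0].
- by move=> x x1; have [] := dF x (lt_trans ltr01 x1).
- apply: cvg_at_right_filter.
  have /derivable1_diffP/differentiable_continuous : derivable (fun x => - p^-1 * x `^ (- p)) 1 1.
    by have [] := dF 1 ltr01.
  exact.
- move=> x; rewrite in_itv/= andbT => x1; rewrite derive1E.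
  by have [_ ->] := dF x (lt_trans ltr01 x1).
Qed.

End positive_integrals.

(** * Tonelli on iterated products *)

Section product_measure.
Context d1 d2 (T1 : measurableType d1) (T2 : measurableType d2) (R : realType).
Variables (m1 : {measure set T1 -> \bar R}) (m2 : {sigma_finite_measure set T2 -> \bar R}).
Hypothesis sfm1 : sigma_finite setT m1.
Local Open Scope ereal_scope.

(** A copy of [m1] carrying the structure built from [sfm1]. With sigma-finiteness of the first
    factor as a hypothesis, the lemmas can be iterated along the left-nested fivefold product. *)
Let m1' : set T1 -> \bar R := m1.
#[local] HB.instance Definition _ := Measure.on m1'.
#[local] HB.instance Definition _ := Measure_isSigmaFinite.Build _ _ _ m1' sfm1.

Lemma product_sigma_finite : sigma_finite setT (m1 \x m2).
Proof.
have /sigma_finiteP[F [TF ndF Foo]] := sfm1.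
have /sigma_finiteP[G [TG ndG Goo]] := sigma_finiteT m2.
exists (fun k => F k `*` G k).
  apply/esym; rewrite -subTset => -[x y] _.
  have [i _ Fx] : (\bigcup_k F k) x by rewrite -TF.
  have [j _ Gy] : (\bigcup_k G k) y by rewrite -TG.
  exists (maxn i j) => //; split => /=.
    by move: x Fx; exact/subsetPset/ndF/leq_maxl.
  by move: y Gy; exact/subsetPset/ndG/leq_maxr.
move=> k; have [? ?] := Foo k; have [? ?] := Goo k; split; first exact: measurableX.
by rewrite product_measure1E// lte_mul_pinfty// ge0_fin_numE.
Qed.

Lemma product_tonelli1 (F : T1 * T2 -> \bar R) : measurable_fun setT F ->
  (forall z, 0 <= F z) -> \int[m1 \x m2]_z F z = \int[m1]_x \int[m2]_y F (x, y).
Proof.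
move=> mF F0; have := fubini_tonelli1 (m1 := m1') (m2 := m2) F mF F0.
by rewrite /fubini_F => <-; apply: eq_measure_integral.
Qed.

Lemma product_tonelli2 (F : T1 * T2 -> \bar R) : measurable_fun setT F ->
  (forall z, 0 <= F z) -> \int[m1 \x m2]_z F z = \int[m2]_y \int[m1]_x F (x, y).
Proof.
move=> mF F0; have := fubini_tonelli2 (m1 := m1') (m2 := m2) F mF F0.
by rewrite /fubini_G => <-; apply: eq_measure_integral.
Qed.

End product_measure.

Section iterated_integrals.
Context {R : realType}.
Local Notation leb := (@lebesgue_measure R).
Local Notation BR := (measurableTypeR R).

Lemma measurable_integral d (T : measurableType d) (f : T -> R -> \bar R) :
  measurable_fun setT (fun z : (T * R)%type => f z.1 z.2) ->
  (forall x y, (0 <= f x y)%E) ->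
  measurable_fun setT (fun x => \int[leb]_y f x y)%E.
Proof.
move=> mf f0.
exact: (measurable_fun_fubini_tonelli_F (m2 := leb) (fun z => f z.1 z.2)).
Qed.

Lemma integral_support (D : set R) (f : R -> \bar R) :
  (forall x, ~ D x -> f x = 0%E) -> (\int[leb]_x f x = \int[leb]_(x in D) f x)%E.
Proof.
move=> f0; rewrite [RHS]integral_mkcond; apply: eq_integral => x _.
by rewrite patchE; case: ifPn => //; rewrite notin_setE => /f0.
Qed.

(** The order of integration used for the posterior: [m2] innermost, where the integrand is
    Gaussian, then [s2] and [r], whose integral depends on [s1] alone, and [s1] outermost, as the
    variable to be matched with the chi-squared one. *)
Lemma tonelli5 (f : R -> R -> R -> R -> R -> \bar R) :
  measurable_fun setT (fun t : (BR * BR * BR * BR * BR)%type =>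
    f t.1.1.1.1 t.1.1.1.2 t.1.1.2 t.1.2 t.2) ->
  (forall m1 m2 s1 s2 r, (0 <= f m1 m2 s1 s2 r)%E) ->
  (\int[leb \x leb \x leb \x leb \x leb]_t
      f t.1.1.1.1 t.1.1.1.2 t.1.1.2 t.1.2 t.2 =
   \int[leb]_s1 \int[leb]_m1 \int[leb]_r \int[leb]_s2 \int[leb]_m2
      f m1 m2 s1 s2 r)%E.
Proof.
move=> mf f0.
have mfc d (T : measurableType d) (g1 g2 g3 g4 g5 : T -> R) :
    measurable_fun setT g1 -> measurable_fun setT g2 -> measurable_fun setT g3 ->
    measurable_fun setT g4 -> measurable_fun setT g5 ->
    measurable_fun setT (fun z => f (g1 z) (g2 z) (g3 z) (g4 z) (g5 z)).
  move=> m1 m2 m3 m4 m5.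
  have mt : measurable_fun setT (fun z => (g1 z, g2 z, g3 z, g4 z, g5 z)) by mfun.
  exact: (measurableT_comp mf mt).
have If0 m1 m2 s1 s2 : (0 <= \int[leb]_r f m1 m2 s1 s2 r)%E.
  by apply: integral_ge0.
have IIf0 m1 m2 s1 r : (0 <= \int[leb]_s2 f m1 m2 s1 s2 r)%E.
  by apply: integral_ge0.
have IIIf0 m1 m2 s1 : (0 <= \int[leb]_s2 \int[leb]_r f m1 m2 s1 s2 r)%E.
  by apply: integral_ge0.
have mfc2 d (T : measurableType d) (g1 g2 g3 : T -> R) :
    measurable_fun setT g1 -> measurable_fun setT g2 -> measurable_fun setT g3 ->
    measurable_fun setT (fun z => \int[leb]_s2 \int[leb]_r f (g1 z) (g2 z) (g3 z) s2 r)%E.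
  move=> mg1 mg2 mg3.
  apply: (measurable_integral _ _ (fun z s2 => \int[leb]_r f (g1 z) (g2 z) (g3 z) s2 r)%E).
    apply: (measurable_integral _ _ (fun w r => f (g1 w.1) (g2 w.1) (g3 w.1) w.2 r)%E).
      by apply: mfc; [apply: (measurableT_comp mg1)|apply: (measurableT_comp mg2)
        |apply: (measurableT_comp mg3)| |]; mfun.
    by move=> *; exact: f0.
  by move=> *; exact: If0.
have sf1 : sigma_finite setT leb := sigma_finiteT leb.
have sf2 := product_sigma_finite _ _ _ _ _ leb leb sf1.
have sf3 := product_sigma_finite _ _ _ _ _ (leb \x leb)%E leb sf2.
have sf4 := product_sigma_finite _ _ _ _ _ (leb \x leb \x leb)%E leb sf3.
rewrite (product_tonelli1 _ _ _ _ _ _ leb sf4 (fun t : (BR * BR * BR * BR * BR)%type =>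
    f t.1.1.1.1 t.1.1.1.2 t.1.1.2 t.1.2 t.2)); [|exact: mf|by move=> t; exact: f0].
rewrite (product_tonelli1 _ _ _ _ _ _ leb sf3 (fun q : (BR * BR * BR * BR)%type =>
  \int[leb]_r f q.1.1.1 q.1.1.2 q.1.2 q.2 r)%E); last 2 first.
- by apply: measurable_integral => //; apply: mfc; mfun.
- by move=> t; exact: If0.
rewrite (product_tonelli2 _ _ _ _ _ _ leb sf2 (fun q : (BR * BR * BR)%type =>
  \int[leb]_s2 \int[leb]_r f q.1.1 q.1.2 q.2 s2 r)%E); last 2 first.
- by apply: mfc2; mfun.
- by move=> t; exact: IIIf0.
apply: eq_integral => s1 _.
rewrite (product_tonelli1 _ _ _ _ _ _ leb sf1 (fun q : (BR * BR)%type =>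
  \int[leb]_s2 \int[leb]_r f q.1 q.2 s1 s2 r)%E); last 2 first.
- by apply: mfc2; mfun.
- by move=> t; exact: IIIf0.
apply: eq_integral => m1 _; transitivity (\int[leb]_m2 \int[leb]_r \int[leb]_s2 f m1 m2 s1 s2 r)%E.
  by apply: eq_integral => m2 _; apply: tonelli => //; apply: mfc; mfun.
rewrite (tonelli (fun m2 r => \int[leb]_s2 f m1 m2 s1 s2 r)%E).
- by apply: eq_integral => r _; apply: tonelli => //; apply: mfc; mfun.
- apply: (measurable_integral _ _ (fun w s2 => f m1 w.1 s1 s2 w.2)).
    by apply: mfc; mfun.
  by move=> *; exact: f0.
- by move=> m2 r; exact: IIf0.
Qed.

End iterated_integrals.

(** * Posterior law of theta5 *)

Lemma sum_deviations (R : realType) n (f g : 'I_n -> R) (c d : R) : (0 < n)%N ->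
  \sum_k (f k - c) * (g k - d) =
  \sum_k (f k - n%:R^-1 * \sum_i f i) * (g k - n%:R^-1 * \sum_i g i) +
  n%:R * ((n%:R^-1 * \sum_i f i - c) * (n%:R^-1 * \sum_i g i - d)).
Proof.
move=> n0; have nn0 : n%:R != 0 :> R by rewrite pnatr_eq0 -lt0n.
set fb := _ * \sum_i f i; set gb := _ * \sum_i g i.
have f0 : \sum_k (f k - fb) = 0.
  by rewrite big_split/= sumr_const card_ord -mulr_natl mulrN /fb mulVKf// subrr.
have g0 : \sum_k (g k - gb) = 0.
  by rewrite big_split/= sumr_const card_ord -mulr_natl mulrN /gb mulVKf// subrr.
under eq_bigr => k _.
  rewrite (_ : _ * _ = (f k - fb) * (g k - gb) + (fb - c) * (g k - gb) +
    (gb - d) * (f k - fb) + (fb - c) * (gb - d)); last by ring.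
  over.
rewrite !big_split/= -!mulr_sumr f0 g0 !mulr0 !addr0 sumr_const card_ord.
by rewrite mulrnAr mulr_natl.
Qed.

(** * Likelihood and elimination of the second mean *)

Section likelihood.
Context {R : realType} (n : nat) (x : 'I_n -> R * R).
Hypothesis n0 : (0 < n)%N.
Local Notation leb := (@lebesgue_measure R).

(** The sum over the sample of (e/s2 - r d/s1)^2 / (1 - r^2), for [d] and [e] the deviations of the
    two coordinates from their means: the part of the exponent that belongs to the second coordinate
    given the first. *)
Definition scatter_form (s1 s2 r : R) : R :=
  (s22 x / s2 ^+ 2 - 2 * r * s12 x / (s1 * s2) + r ^+ 2 * s11 x / s1 ^+ 2) / (1 - r ^+ 2).

Definition marginal_kernel (m1 s1 : R) : R :=
  expR (- (s11 x + n%:R * (xbar1 x - m1) ^+ 2) / (2 * s1 ^+ 2)).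

(* The last factor comes from completing the square in [m2]. *)
Lemma likelihoodE (m1 m2 s1 s2 r : R) : 0 < s1 -> 0 < s2 -> 0 < 1 - r ^+ 2 ->
  likelihood x (m1, m2, s1, s2, r) =
  ((2 * pi * s1 * s2 * Num.sqrt (1 - r ^+ 2))^-1) ^+ n *
  (marginal_kernel m1 s1 * expR (- scatter_form s1 s2 r / 2) *
   expR (- (m2 - (xbar2 x - r * s2 / s1 * (xbar1 x - m1))) ^+ 2 /
           (2 * (s2 * Num.sqrt (1 - r ^+ 2) / Num.sqrt n%:R) ^+ 2))).
Proof.
move=> s10 s20 q0; rewrite /likelihood /binormal_pdf.
rewrite big_split/=.
rewrite prodr_const card_ord mulrC; congr (_ * _).
rewrite -expR_sum -!expRD; congr expR.
set q := 1 - r ^+ 2 in q0 *.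
have nn0 : n%:R != 0 :> R by rewrite pnatr_eq0 -lt0n.
have s1n : s1 != 0 by rewrite gt_eqF.
have s2n : s2 != 0 by rewrite gt_eqF.
have qn : q != 0 by rewrite gt_eqF.
under eq_bigr => k _.
  rewrite (_ : - _ / _ = - (2 * q * s1 ^+ 2)^-1 * (((x k).1 - m1) * ((x k).1 - m1))
    + r / (q * s1 * s2) * (((x k).1 - m1) * ((x k).2 - m2))
    - (2 * q * s2 ^+ 2)^-1 * (((x k).2 - m2) * ((x k).2 - m2))); last first.
    by field; rewrite qn s1n s2n.
  over.
rewrite !big_split/= sumrN -!mulr_sumr.
rewrite (sum_deviations _ _ (fun k => (x k).1) (fun k => (x k).1) m1 m1)//.
rewrite (sum_deviations _ _ (fun k => (x k).1) (fun k => (x k).2) m1 m2)//.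
rewrite (sum_deviations _ _ (fun k => (x k).2) (fun k => (x k).2) m2 m2)//.
rewrite -/(xbar1 x) -/(xbar2 x) -/(s12 x).
have -> : \sum_(k < n) ((x k).1 - xbar1 x) * ((x k).1 - xbar1 x) = s11 x by [].
have -> : \sum_(k < n) ((x k).2 - xbar2 x) * ((x k).2 - xbar2 x) = s22 x by [].
rewrite [(s2 * _ / _) ^+ 2]exprMn [(s2 * _) ^+ 2]exprMn exprVn !sqr_sqrtr ?ler0n ?(ltW q0)//.
rewrite /scatter_form -/q.
have r2 : r ^+ 2 = 1 - q by rewrite /q subKr.
set X := xbar1 x; set Y := xbar2 x.
(* The factor (1 - r^2)/q equals 1. It splits the coefficient 1/q of the first coordinate into 1,
   which gives [marginal_kernel], and r^2/q, which goes into the squares of the second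
   coordinate. *)
transitivity (- ((s11 x + n%:R * (X - m1) ^+ 2) / (2 * s1 ^+ 2)) * ((1 - r ^+ 2) / q) +
  (- (s11 x + n%:R * (X - m1) ^+ 2) * r ^+ 2 / (2 * q * s1 ^+ 2)
   + r / (q * s1 * s2) * (s12 x + n%:R * ((X - m1) * (Y - m2)))
   - (2 * q * s2 ^+ 2)^-1 * (s22 x + n%:R * ((Y - m2) * (Y - m2))))).
  by field; rewrite qn s1n s2n.
rewrite -/q divff//; field.
by rewrite qn s1n s2n nn0.
Qed.

Lemma powR_expR (y p : R) : 0 < y -> y `^ p = expR (p * ln y).
Proof. by move=> y0; rewrite /powR gt_eqF. Qed.

Variables a b : R.

(** Equal to (2 pi)^(-n) sqrt(2 pi / n): the constants of the [n] densities and of the Gaussian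
    integral over [m2]. *)
Definition posterior_constant : R :=
  ((2 * pi)^-1) ^+ n / (Num.sqrt n%:R * normal_peak 1).

Lemma posterior_constant_gt0 : 0 < posterior_constant.
Proof.
rewrite divr_gt0 ?exprn_gt0 ?invr_gt0 ?mulr_gt0 ?pi_gt0 ?sqrtr_gt0 ?ltr0n//.
by apply: normal_peak_gt0; exact: oner_neq0.
Qed.

(** Exponents: each of [s1], [s2], sqrt(1 - r^2) receives -n from the densities, the prior adds a -
    3, b - 2 and b - 4, and the standard deviation of the Gaussian in [m2] adds 1 to the last
    two. *)
Lemma integral_likelihood_mu2 (m1 s1 s2 r : R) :
  0 < s1 -> 0 < s2 -> 0 < 1 - r ^+ 2 ->
  (\int[leb]_m2 (likelihood x (m1, m2, s1, s2, r) * prior a b (m1, m2, s1, s2, r))%:E =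
   (posterior_constant * (s1 `^ (a - 3 - n%:R) * marginal_kernel m1 s1) *
    (s2 `^ (b - 1 - n%:R) * (1 - r ^+ 2) `^ ((b - 3 - n%:R) / 2) *
     expR (- scatter_form s1 s2 r / 2)))%:E)%E.
Proof.
move=> s10 s20 q0.
under eq_integral => m2 _ do rewrite likelihoodE//.
set c := (_ ^-1) ^+ n; set g := marginal_kernel m1 s1; set e := expR (- scatter_form _ _ _ / 2).
set M := xbar2 x - _; rewrite /prior; set w := (_ * _ * _)^-1.
set sg := s2 * _ / _.
have sg0 : 0 < sg by rewrite divr_gt0 ?mulr_gt0 ?sqrtr_gt0// ltr0n.
have c0 : 0 <= c.
  by rewrite exprn_ge0// invr_ge0 !mulr_ge0 ?pi_ge0 ?sqrtr_ge0// ltW.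
have w0 : 0 <= w by rewrite invr_ge0 !mulr_ge0 ?powR_ge0.
transitivity (\int[leb]_m2 ((c * w * g * e)%:E *
    (expR (- (m2 - M) ^+ 2 / (2 * sg ^+ 2)))%:E))%E.
  by apply: eq_integral => m2 _; rewrite -EFinM; congr EFin; ring.
rewrite ge0_integralZl//; last 2 first.
- by apply/measurable_EFinP; mfun.
- by rewrite lee_fin !mulr_ge0// expR_ge0.
rewrite integral_gaussian// -EFinM; congr EFin.
(* A monomial with real exponents as one exponential, so that products amount to adding
   exponents. *)
pose E (p1 p2 p3 : R) := expR (p1 * ln s1 + p2 * ln s2 + p3 * ln (1 - r ^+ 2)).
have EE p1 p2 p3 : s1 `^ p1 * s2 `^ p2 * (1 - r ^+ 2) `^ p3 = E p1 p2 p3.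
  by rewrite !powR_expR// /E !expRD.
have ED p1 p2 p3 p1' p2' p3' : E p1 p2 p3 * E p1' p2' p3' = E (p1 + p1') (p2 + p2') (p3 + p3').
  by rewrite /E -expRD; congr expR; ring.
have sqE : Num.sqrt (1 - r ^+ 2) = (1 - r ^+ 2) `^ 2^-1 by rewrite powR12_sqrt// ltW.
have cE : c = ((2 * pi)^-1) ^+ n * E (- n%:R) (- n%:R) (- n%:R / 2).
  rewrite /c -!mulrA [2 * _]mulrA invfM exprMn; congr (_ * _).
  rewrite sqE mulrA; have -> : s1 * s2 * (1 - r ^+ 2) `^ 2^-1 = E 1 1 2^-1.
    by rewrite -EE !powRr1// ltW.
  by rewrite -expRN -expRM_natl; congr expR; field.
have wE : w = E (a - 3) (b - 2) (b / 2 - 2).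
  by rewrite /w EE -expRN; congr expR; ring.
have sgE : sg = E 0 1 2^-1 / Num.sqrt n%:R.
  by rewrite /sg sqE -EE powRr0 mul1r powRr1// ltW.
clearbody E; rewrite -[posterior_constant * _ * _]mulrA.
have -> : s1 `^ (a - 3 - n%:R) * g * (s2 `^ (b - 1 - n%:R) * (1 - r ^+ 2) `^ ((b - 3 - n%:R) / 2) * e)
    = E (a - 3 - n%:R) (b - 1 - n%:R) ((b - 3 - n%:R) / 2) * (g * e).
  by rewrite -EE; ring.
have -> : E (a - 3 - n%:R) (b - 1 - n%:R) ((b - 3 - n%:R) / 2) =
    E (- n%:R) (- n%:R) (- n%:R / 2) * E (a - 3) (b - 2) (b / 2 - 2) * E 0 1 2^-1.
  by rewrite !ED; congr E; field.
rewrite cE wE sgE /posterior_constant.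
have sn0 : Num.sqrt n%:R != 0 :> R by rewrite gt_eqF// sqrtr_gt0 ltr0n.
have pk0 : normal_peak 1 != 0 :> R.
  by rewrite gt_eqF//; apply: normal_peak_gt0; exact: oner_neq0.
move: (((2 * pi)^-1) ^+ n) (E (- n%:R) _ _) (E (a - 3) _ _) (E 0 _ _) => c1 e1 e2 e3.
move: (normal_peak 1) pk0 (Num.sqrt n%:R) sn0 => pk pk0 sn sn0.
by field; rewrite pk0 sn0.
Qed.

End likelihood.

Arguments scatter_form {R n}.
Arguments marginal_kernel {R n}.
Arguments posterior_constant {R}.

Section positive_power.
Context {R : realType}.
Implicit Types p y c : R.

(* The guarded power keeps the parameter constraints inside integrands over R. *)
Definition pos_powR p y := if 0 < y then y `^ p else 0.

Lemma pos_powR_ge0 p y : 0 <= pos_powR p y.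
Proof. by rewrite /pos_powR; case: ifP => // _; exact: powR_ge0. Qed.

Lemma pos_powRE p y : 0 < y -> pos_powR p y = y `^ p.
Proof. by rewrite /pos_powR => ->. Qed.

Lemma pos_powR_le0 p y : y <= 0 -> pos_powR p y = 0.
Proof. by rewrite /pos_powR ltNge => ->. Qed.

Lemma pos_powR_scale p c y : 0 < c -> pos_powR p (c * y) = c `^ p * pos_powR p y.
Proof.
move=> c0; rewrite /pos_powR pmulr_rgt0//; case: ifP => y0; last by rewrite mulr0.
by rewrite powRM// ltW.
Qed.

Lemma measurable_pos_powR d (T : measurableType d) p (f : T -> R) :
  measurable_fun setT f -> measurable_fun setT (fun x => pos_powR p (f x)).
Proof. by move=> mf; rewrite /pos_powR; mfun. Qed.

End positive_power.

Ltac mfun' := repeat first [ apply: measurable_pos_powR | progress mfun ].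

Lemma scatter_s11_gt0 (R : realType) n (x : 'I_n -> R * R) : positive_scatter x -> 0 < s11 x.
Proof.
move=> scatter_x.
have s11_ge0 : 0 <= s11 x by apply: sumr_ge0 => k _; exact: sqr_ge0.
rewrite lt_neqAle s11_ge0 andbT eq_sym; apply/eqP => s110; move: scatter_x.
by rewrite /positive_scatter s110 mul0r sub0r oppr_gt0 ltNge sqr_ge0.
Qed.

(** * Posterior mass of events about theta5 *)

Section posterior_mass.
Context {R : realType} (n : nat) (x : 'I_n -> R * R) (a b : R).
Hypothesis n0 : (0 < n)%N.
Hypothesis scatter_x : positive_scatter x.
Hypothesis bn : b < n%:R.
Local Notation leb := (@lebesgue_measure R).

Let beta := b - 1 - n%:R.

Let s11_gt0 : 0 < s11 x. Proof. exact: scatter_s11_gt0. Qed.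

(** Here t = s2 sqrt(1 - r^2) is the conditional standard deviation of the second coordinate and w =
    r / (s1 sqrt(1 - r^2)), so that w t is the regression slope r s2 / s1. *)
Definition scatter_kernel (t w : R) : R :=
  pos_powR beta t *
  expR (- (s22 x / t ^+ 2 - 2 * w * s12 x / t + w ^+ 2 * s11 x) / 2).

Definition scatter_mass : \bar R := (\int[leb]_w \int[leb]_t (scatter_kernel t w)%:E)%E.

Lemma scatter_kernel_ge0 t w : 0 <= scatter_kernel t w.
Proof. by rewrite mulr_ge0 ?pos_powR_ge0 ?expR_ge0. Qed.

Lemma measurable_scatter_kernel d (T : measurableType d) (f g : T -> R) :
  measurable_fun setT f -> measurable_fun setT g ->
  measurable_fun setT (fun x => (scatter_kernel (f x) (g x))%:E).
Proof. by move=> mf mg; apply/measurable_EFinP; rewrite /scatter_kernel; mfun'. Qed.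

(* Substitute [s2 = t / sqrt (1 - r ^ 2)], then [r = w / sqrt (1 + w ^ 2)], then
   rescale [w] by [s1]. *)
Lemma integral_sigma2_rho (s1 : R) : 0 < s1 ->
  (\int[leb]_r \int[leb]_s2 (pos_powR beta s2 *
     pos_powR ((b - 3 - n%:R) / 2) (1 - r ^+ 2) * expR (- scatter_form x s1 s2 r / 2))%:E =
   s1%:E * scatter_mass)%E.
Proof.
move=> s10; pose H w := (\int[leb]_t (scatter_kernel t (w / s1))%:E)%E.
have H0 w : (0 <= H w)%E.
  by apply: integral_ge0 => t _; rewrite lee_fin scatter_kernel_ge0.
have mH : measurable_fun setT H.
  rewrite /H; apply: (measurable_integral _ R (fun w t => (scatter_kernel t (w / s1))%:E)).
    by apply: measurable_scatter_kernel; mfun.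
  by move=> *; rewrite lee_fin scatter_kernel_ge0.
pose q (r : R) := 1 - r ^+ 2.
pose F r := ((pos_powR (- (3 / 2)) (q r))%:E * H (r / Num.sqrt (q r))%R)%E.
transitivity (\int[leb]_(r in `](-1)%R, 1%R[) F r)%E.
  rewrite (integral_support `]-1, 1[%classic); last first.
    move=> r; rewrite /= in_itv/= -ltr_norml => /negP; rewrite -leNgt => r1.
    apply: integral0_eq => s2 _; rewrite (pos_powR_le0 _ (1 - r ^+ 2)) ?mulr0 ?mul0r//.
    by rewrite subr_le0 -real_normK ?num_real// expr_ge1.
  apply: eq_integral => r; rewrite inE/= in_itv/= -ltr_norml => r1.
  have q0 : 0 < q r by rewrite subr_gt0 -real_normK ?num_real// expr_lt1.
  have sq0 : 0 < Num.sqrt (q r) by rewrite sqrtr_gt0.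
  have sq2 : Num.sqrt (q r) ^+ 2 = q r by rewrite sqr_sqrtr// ltW.
  rewrite (integral_affine _ (Num.sqrt (q r))^-1 0)//; last 3 first.
  - by rewrite invr_neq0// gt_eqF.
  - by apply/measurable_EFinP; rewrite /scatter_form; mfun'.
  - by move=> s2; rewrite lee_fin !mulr_ge0 ?pos_powR_ge0 ?expR_ge0.
  rewrite /F -ge0_integralZl//; last 3 first.
  - by apply: measurable_scatter_kernel; mfun.
  - by move=> t _; rewrite lee_fin scatter_kernel_ge0.
  - by rewrite lee_fin pos_powR_ge0.
  apply: eq_integral => t _.
  rewrite addr0 -!EFinM; congr EFin; rewrite /scatter_kernel.
  rewrite pos_powR_scale ?invr_gt0//.
  have [t0|t0] := ltP 0 t; last first.
    by rewrite (pos_powR_le0 _ t)// !(mulr0, mul0r).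
  rewrite -/(q r) !(pos_powRE _ (q r))// gtr0_norm ?invr_gt0//.
  have -> : scatter_form x s1 ((Num.sqrt (q r))^-1 * t) r = s22 x / t ^+ 2 -
      2 * (r / Num.sqrt (q r) / s1) * s12 x / t + (r / Num.sqrt (q r) / s1) ^+ 2 * s11 x.
    move: sq0 sq2; set S := Num.sqrt (q r) => sq0 sq2.
    rewrite /scatter_form -/(q r) -sq2; field.
    by rewrite !gt_eqF.
  (* The powers of 1 - r^2 add up to -3/2, free of [b] and [n]; the Jacobian (1 + w^2)^(-3/2) of the
     next substitution cancels this power. *)
  have -> : q r `^ (- (3 / 2)) = (Num.sqrt (q r))^-1 `^ beta *
      q r `^ ((b - 3 - n%:R) / 2) * (Num.sqrt (q r))^-1.
    have -> : (Num.sqrt (q r))^-1 = q r `^ (- 2^-1) by rewrite powRN powR12_sqrt// ltW.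
    rewrite -powRrM -!powRD; try by apply/implyP => _; rewrite gt_eqF.
    by congr (_ `^ _); rewrite /beta; field.
  by ring.
rewrite unit_interval_substitution//; last 2 first.
- apply: emeasurable_funM; first by apply/measurable_EFinP; rewrite /q; mfun'.
  by apply: (measurableT_comp mH); rewrite /q; mfun.
- by move=> r; rewrite mule_ge0// lee_fin pos_powR_ge0.
transitivity (\int[leb]_w H w)%E.
  apply: eq_integral => w _; set D := Num.sqrt (1 + w ^+ 2).
  have w0 : 0 < 1 + w ^+ 2 by rewrite ltr_wpDr// sqr_ge0.
  have D0 : 0 < D by rewrite sqrtr_gt0.
  have D2 : D ^+ 2 = 1 + w ^+ 2 by rewrite sqr_sqrtr// ltW.
  have qE : q (w / D) = D ^- 2.
    rewrite /q exprMn exprVn D2; field.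
    by rewrite gt_eqF.
  rewrite /F qE sqrtrV ?exprn_ge0 ?ltW// sqrtr_sqr gtr0_norm// invrK.
  rewrite divfK ?gt_eqF// muleAC -EFinM pos_powRE ?invr_gt0 ?exprn_gt0//.
  rewrite (_ : _ * _ = 1) ?mul1e// exprVn -!(powR_invn _ (ltW D0)) -powRrM -powRD.
    rewrite (_ : _ + _ = 0) ?powRr0//; by field.
  by apply/implyP => _; rewrite gt_eqF.
rewrite (integral_affine _ s1 0)//; last by rewrite gt_eqF.
transitivity (\int[leb]_w (s1%:E * H (s1 * w)%R))%E.
  by apply: eq_integral => w _; rewrite addr0 gtr0_norm// muleC.
rewrite ge0_integralZl.
- have -> : (\int[leb]_w H (s1 * w)%R = scatter_mass)%E; last by [].
  apply: eq_integral => w _; rewrite /H.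
  by rewrite (_ : s1 * w / s1 = w)// mulrC mulKf// gt_eqF.
- by [].
- by apply: (measurableT_comp mH); mfun.
- by move=> w _; exact: H0.
- by rewrite lee_fin ltW.
Qed.

(** The residual sum of squares in the regression of the second coordinate on the first; times [s11]
    it is the determinant in [positive_scatter]. *)
Let residual : R := s22 x - s12 x ^+ 2 / s11 x.

Let residual_gt0 : 0 < residual.
Proof.
rewrite -(pmulr_rgt0 _ s11_gt0) /residual mulrBr [X in _ - X]mulrC divfK ?gt_eqF//.
Qed.

(** Completing the square in [w], with centre s12 / (s11 t) and variance 1/s11, leaves residual /
    t^2 in the exponent. *)
Let scatter_massE : scatter_mass =
  (((Num.sqrt (s11 x))^-1 / normal_peak 1)%:E *
   \int[leb]_t (pos_powR beta t * expR (- residual / (2 * t ^+ 2)))%:E)%E.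
Proof.
rewrite /scatter_mass (tonelli (fun w t => (scatter_kernel t w)%:E)); last 2 first.
- by apply: measurable_scatter_kernel; mfun.
- by move=> w t; rewrite lee_fin scatter_kernel_ge0.
have pk0 : 0 < normal_peak (1 : R) by apply: normal_peak_gt0; exact: oner_neq0.
have sq0 : 0 < Num.sqrt (s11 x) by rewrite sqrtr_gt0.
rewrite -ge0_integralZl//; last 3 first.
- by apply/measurable_EFinP; mfun'.
- by move=> t _; rewrite lee_fin mulr_ge0 ?pos_powR_ge0 ?expR_ge0.
- by rewrite lee_fin divr_ge0 ?(ltW pk0)// invr_ge0 ltW.
apply: eq_integral => t _.
pose K := pos_powR beta t * expR (- residual / (2 * t ^+ 2)).
pose m := s12 x / (s11 x * t).
transitivity (\int[leb]_w (K%:E *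
    (expR (- (w - m) ^+ 2 / (2 * (Num.sqrt (s11 x))^-1 ^+ 2)))%:E))%E.
  apply: eq_integral => w _; rewrite /scatter_kernel /K -EFinM; congr EFin.
  have [t0|t0] := ltP 0 t; last by rewrite pos_powR_le0// !mul0r.
  rewrite -[RHS]mulrA -expRD exprVn sqr_sqrtr ?(ltW s11_gt0)// /m /residual.
  congr (_ * expR _); field.
  by rewrite !gt_eqF.
rewrite ge0_integralZl//; last 2 first.
- by apply/measurable_EFinP; mfun.
- by rewrite lee_fin mulr_ge0 ?pos_powR_ge0 ?expR_ge0.
by rewrite integral_gaussian ?invr_gt0// muleC.
Qed.

Lemma scatter_mass_gt0 : (0 < scatter_mass)%E.
Proof.
rewrite scatter_massE mule_gt0//.
  rewrite lte_fin divr_gt0//; first by rewrite invr_gt0 sqrtr_gt0 s11_gt0.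
  by apply: normal_peak_gt0; exact: oner_neq0.
apply: integral_pos_gt0.
- by apply/measurable_EFinP; mfun'.
- by move=> t; rewrite lee_fin mulr_ge0 ?pos_powR_ge0 ?expR_ge0.
- by move=> t t0; rewrite lte_fin mulr_gt0 ?expR_gt0// pos_powRE// powR_gt0.
Qed.

(** The power of [t] is -(n - b) - 1: b < n gives convergence at infinity, positivity of the
    residual gives it at 0. *)
Lemma scatter_mass_lty : (scatter_mass < +oo)%E.
Proof.
have p0 : 0 < n%:R - b by rewrite subr_gt0.
rewrite scatter_massE lte_mul_pinfty// ?lee_fin.
  by rewrite divr_ge0 ?invr_ge0 ?sqrtr_ge0 ?normal_peak_ge0.
have := inverse_gamma_lty (n%:R - b) residual p0 residual_gt0.
apply: le_lt_trans; rewrite (integral_support `]0, +oo[%classic).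
  rewrite le_eqVlt; apply/orP; left; apply/eqP.
  apply: eq_integral => t; rewrite inE/= in_itv/= andbT => t0.
  by rewrite pos_powRE//; congr (_ `^ _ * _)%:E; rewrite /beta; ring.
move=> t /=; rewrite in_itv/= andbT => /negP; rewrite -leNgt => t0.
by rewrite pos_powR_le0// mul0r.
Qed.

Let joint (m1 m2 s1 s2 r : R) : R :=
  if [&& 0 < s1, 0 < s2 & 0 < 1 - r ^+ 2]
  then likelihood x (m1, m2, s1, s2, r) * prior a b (m1, m2, s1, s2, r) else 0.

Let sqr_lt1 (r : R) : (0 < 1 - r ^+ 2) = (`|r| < 1).
Proof. by rewrite subr_gt0 -real_normK ?num_real// expr_lt1. Qed.

Let joint_ge0 m1 m2 s1 s2 r : 0 <= joint m1 m2 s1 s2 r.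
Proof.
rewrite /joint; case: ifP => // /and3P[s10 s20 q0]; rewrite mulr_ge0//.
  apply: prodr_ge0 => k _; rewrite /binormal_pdf divr_ge0 ?expR_ge0//.
  by rewrite !mulr_ge0 ?pi_ge0 ?sqrtr_ge0// ltW.
by rewrite invr_ge0 !mulr_ge0 ?powR_ge0.
Qed.

Let measurable_joint d (T : measurableType d) (f1 f2 f3 f4 f5 : T -> R) :
  measurable_fun setT f1 -> measurable_fun setT f2 -> measurable_fun setT f3 ->
  measurable_fun setT f4 -> measurable_fun setT f5 ->
  measurable_fun setT (fun t => joint (f1 t) (f2 t) (f3 t) (f4 t) (f5 t)).
Proof.
move=> mf1 mf2 mf3 mf4 mf5; rewrite /joint; apply: measurable_fun_ifT.
- by mfun.
- apply: measurable_funM; last by rewrite /prior; mfun.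
  rewrite /likelihood; apply: measurable_prod => k _.
  by rewrite /binormal_pdf; mfun.
- by mfun.
Qed.

Let integral_joint (m1 s1 : R) :
  (\int[leb]_r \int[leb]_s2 \int[leb]_m2 (joint m1 m2 s1 s2 r)%:E =
   (posterior_constant n * (pos_powR (a - 3 - n%:R) s1 * marginal_kernel x m1 s1) * s1)%:E *
   scatter_mass)%E.
Proof.
have [s10|s10] := ltP 0 s1; last first.
  rewrite pos_powR_le0// !(mul0r, mulr0) mul0e; apply: integral0_eq => r _.
  apply: integral0_eq => s2 _; apply: integral0_eq => m2 _.
  by rewrite /joint ltNge s10.
have c0 : 0 <= posterior_constant n * (pos_powR (a - 3 - n%:R) s1 * marginal_kernel x m1 s1) :> R.
  rewrite mulr_ge0 ?(ltW (posterior_constant_gt0 _ n0))//.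
  by rewrite mulr_ge0 ?pos_powR_ge0 ?expR_ge0.
rewrite EFinM -muleA -integral_sigma2_rho//.
have mG d (T : measurableType d) (f g : T -> R) : measurable_fun setT f -> measurable_fun setT g ->
    measurable_fun setT (fun t => (pos_powR beta (f t) *
     pos_powR ((b - 3 - n%:R) / 2) (1 - g t ^+ 2) * expR (- scatter_form x s1 (f t) (g t) / 2))%:E).
  by move=> mf mg; apply/measurable_EFinP; rewrite /scatter_form; mfun'.
have G0 s2 r : (0 <= (pos_powR beta s2 *
     pos_powR ((b - 3 - n%:R) / 2) (1 - r ^+ 2) * expR (- scatter_form x s1 s2 r / 2))%:E)%E.
  by rewrite lee_fin !mulr_ge0 ?pos_powR_ge0 ?expR_ge0.
rewrite -ge0_integralZl//; last 2 first.
- apply: (measurable_integral _ R (fun r s2 => (pos_powR beta s2 *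
     pos_powR ((b - 3 - n%:R) / 2) (1 - r ^+ 2) * expR (- scatter_form x s1 s2 r / 2))%:E)).
    by apply: mG; mfun.
  by move=> r s2; exact: G0.
- by move=> r _; apply: integral_ge0 => s2 _; exact: G0.
apply: eq_integral => r _; rewrite -ge0_integralZl//; last by apply: mG; mfun.
apply: eq_integral => s2 _; rewrite /joint s10/=.
have [s20|s20] := ltP 0 s2; last first.
  by rewrite (pos_powR_le0 _ s2)// !mul0r mule0 integral0_eq.
have [q0|q0] := ltP 0 (1 - r ^+ 2); last first.
  by rewrite (pos_powR_le0 _ (1 - _))// mulr0 !mul0r mule0 integral0_eq.
by rewrite integral_likelihood_mu2// !pos_powRE.
Qed.

(** Up to a constant, the mass of [A] under the normal law with mean [y] and variance 1/n; for y =
    xbar1/s1 this is the posterior law of theta5 given [s1]. *)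
Definition theta5_kernel (A : set R) (y : R) : \bar R :=
  (\int[leb]_u (\1_A u * expR (- n%:R * (y - u) ^+ 2 / 2))%:E)%E.

Lemma theta5_kernel_ge0 A y : (0 <= theta5_kernel A y)%E.
Proof. by apply: integral_ge0 => u _; rewrite lee_fin mulr_ge0 ?expR_ge0// indicE. Qed.

Lemma measurable_theta5_kernel A : measurable A -> measurable_fun setT (theta5_kernel A).
Proof.
move=> mA; apply: (measurable_integral _ R
    (fun y u => (\1_A u * expR (- n%:R * (y - u) ^+ 2 / 2))%:E)).
  apply/measurable_EFinP; apply: measurable_funM; last by mfun.
  by apply: measurableT_comp.
by move=> y u; rewrite lee_fin mulr_ge0 ?expR_ge0// indicE.
Qed.

Lemma posterior_massE (A : set R) : measurable A ->
  posterior_mass x a b [set t | A (theta5 t)] =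
  ((posterior_constant n)%:E * scatter_mass *
   \int[leb]_s ((pos_powR (a - 1 - n%:R) s * expR (- s11 x / (2 * s ^+ 2)))%:E *
                theta5_kernel A (xbar1 x / s)))%E.
Proof.
move=> mA.
transitivity (\int[leb]_s1 \int[leb]_m1 \int[leb]_r \int[leb]_s2 \int[leb]_m2
    (joint m1 m2 s1 s2 r * \1_A (m1 / s1))%:E)%E.
  rewrite -(tonelli5 (fun m1 m2 s1 s2 r => (joint m1 m2 s1 s2 r * \1_A (m1 / s1))%:E)).
  - rewrite /posterior_mass integral_mkcond; apply: eq_integral => t _.
    rewrite patchE; case: t => [[[[m1 m2] s1] s2] r] /=.
    have -> : ((m1, m2, s1, s2, r) \in [set t | A (theta5 t)] `&` param_space) =
        [&& 0 < s1, 0 < s2 & 0 < 1 - r ^+ 2] && (m1 / s1 \in A).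
      rewrite sqr_lt1; apply/idP/idP; rewrite !inE /=.
        by move=> [As [-> -> ->]] /=; rewrite inE.
      by move=> /andP[/and3P[-> -> ->]]; rewrite inE.
    rewrite /joint indicE; case: (boolP [&& _, _ & _]) => _ /=; last by rewrite mul0r.
    by case: (_ \in A); rewrite ?mulr1 ?mulr0.
  - apply/measurable_EFinP; apply: measurable_funM.
      by apply: measurable_joint; mfun.
    by apply: (measurableT_comp (measurable_indic mA)); mfun.
  - by move=> *; rewrite lee_fin mulr_ge0// indicE.
pose c := posterior_constant n : R.
have c0 : 0 <= c := ltW (posterior_constant_gt0 _ n0).
rewrite -ge0_integralZl; last 4 first.
- by [].
- apply: emeasurable_funM; first by apply/measurable_EFinP; mfun'.
  by apply: (measurableT_comp (measurable_theta5_kernel A mA)); mfun.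
- move=> s _; rewrite mule_ge0 ?theta5_kernel_ge0// lee_fin.
  by rewrite mulr_ge0 ?pos_powR_ge0 ?expR_ge0.
- by rewrite mule_ge0// ltW// scatter_mass_gt0.
apply: eq_integral => s1 _.
have mk0 m1 : 0 <= marginal_kernel x m1 s1 * \1_A (m1 / s1).
  by rewrite mulr_ge0 ?expR_ge0// indicE.
transitivity (\int[leb]_m1 ((c * pos_powR (a - 3 - n%:R) s1 * s1)%:E * scatter_mass *
    (marginal_kernel x m1 s1 * \1_A (m1 / s1))%:E))%E.
  apply: eq_integral => m1 _.
  transitivity (((\int[leb]_r \int[leb]_s2 \int[leb]_m2 (joint m1 m2 s1 s2 r)%:E) *
    (\1_A (m1 / s1))%:E)%E); last first.
    rewrite integral_joint muleAC -EFinM [RHS]muleAC -EFinM; congr (_%:E * _)%E.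
    by rewrite /c; ring.
  rewrite indicE; case: (_ \in A); last first.
    rewrite mule0 integral0_eq// => r _; rewrite integral0_eq// => s2 _.
    by rewrite integral0_eq// => m2 _; rewrite mulr0.
  rewrite mule1; apply: eq_integral => r _; apply: eq_integral => s2 _.
  by apply: eq_integral => m2 _; rewrite mulr1.
have [s10|s10] := ltP 0 s1; last first.
  rewrite !pos_powR_le0// !(mulr0, mul0r, mul0e, mule0) integral0_eq// => m1 _.
  by rewrite !mul0e.
rewrite ge0_integralZl; last 4 first.
- by [].
- apply/measurable_EFinP; apply: measurable_funM; first by rewrite /marginal_kernel; mfun.
  by apply: (measurableT_comp (measurable_indic mA)); mfun.
- by move=> m1 _; rewrite lee_fin.
- rewrite mule_ge0// ?(ltW scatter_mass_gt0)// lee_fin.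
  by rewrite mulr_ge0 ?(ltW s10)// mulr_ge0 ?pos_powR_ge0.
(* m1 = s1 u makes [u] the value of theta5 and produces the second factor [s1]. *)
rewrite (integral_affine _ s1 0); last 3 first.
- by rewrite gt_eqF.
- apply/measurable_EFinP; apply: measurable_funM; first by rewrite /marginal_kernel; mfun.
  by apply: (measurableT_comp (measurable_indic mA)); mfun.
- by move=> m1; rewrite lee_fin.
have -> : (\int[leb]_u ((marginal_kernel x (s1 * u + 0) s1 * \1_A ((s1 * u + 0) / s1))%:E *
      `|s1|%:E) =
    (s1 * expR (- s11 x / (2 * s1 ^+ 2)))%:E * theta5_kernel A (xbar1 x / s1))%E.
  rewrite -ge0_integralZl; last 4 first.
  - by [].
  - apply/measurable_EFinP; apply: measurable_funM; last by mfun.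
    exact: measurable_indic.
  - by move=> u _; rewrite lee_fin mulr_ge0 ?expR_ge0// indicE.
  - by rewrite lee_fin mulr_ge0 ?expR_ge0// ltW.
  apply: eq_integral => u _; rewrite addr0 gtr0_norm// -!EFinM; congr EFin.
  have -> : marginal_kernel x (s1 * u) s1 =
      expR (- s11 x / (2 * s1 ^+ 2)) * expR (- n%:R * (xbar1 x / s1 - u) ^+ 2 / 2).
    rewrite -expRD /marginal_kernel; congr expR; field.
    by rewrite gt_eqF.
  have -> : s1 * u / s1 = u by rewrite mulrC mulKf// gt_eqF.
  by ring.
rewrite !muleA; congr (_ * _)%E.
rewrite [(c%:E * _ * _)%E]muleAC -EFinM muleAC -EFinM; congr (_%:E * _)%E.
rewrite !pos_powRE//.
have -> : s1 `^ (a - 1 - n%:R) = s1 `^ (a - 3 - n%:R) * s1 ^+ 2.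
  rewrite -powR_mulrn ?(ltW s10)// -powRD; last by apply/implyP => _; rewrite gt_eqF.
  by congr (_ `^ _); ring.
by ring.
Qed.

End posterior_mass.

(** * Identification with the law of [theta5_star] *)

Section posterior_law.
Context {R : realType}.
Local Notation leb := (@lebesgue_measure R).

Lemma independent_density d (S : measurableType d) (P : probability S R)
    (V W : S -> R) (g1 g2 : R -> R) (h : (R * R)%type -> \bar R) :
  measurable_fun setT V -> measurable_fun setT W ->
  (forall A B, measurable A -> measurable B ->
     P (V @^-1` A `&` W @^-1` B) = (P (V @^-1` A) * P (W @^-1` B))%E) ->
  measurable_fun setT g1 -> (forall y, 0 <= g1 y) ->
  has_density _ _ P V g1 -> has_density _ _ P W g2 ->
  measurable_fun setT h -> (forall z, (0 <= h z)%E) ->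
  (\int[P]_s h (V s, W s) =
   \int[leb]_c ((\int[leb]_z (h (z, c) * (g1 z)%:E)) * (g2 c)%:E))%E.
Proof.
move=> mV mW VW mg1 g10 dV dW mh h0.
pose F c := (\int[leb]_z (h (z, c) * (g1 z)%:E))%E.
have F0 c : (0 <= F c)%E by apply: integral_ge0 => z _; rewrite mule_ge0// lee_fin.
have mF : measurable_fun setT F.
  rewrite /F; apply: (measurable_integral _ R (fun c z => (h (z, c) * (g1 z)%:E)%E)).
    apply: emeasurable_funM; first by apply: (measurableT_comp mh); mfun.
    by apply/measurable_EFinP; apply: (measurableT_comp mg1); mfun.
  by move=> c z; rewrite mule_ge0// lee_fin.
rewrite -(dW F)//.
have mh' : measurable_fun setT (fun z : (R * R)%type => h (z.2, z.1)).
  by apply: (measurableT_comp mh); mfun.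
rewrite (independent_integral _ _ _ _ _ _ _ P W V (fun z => h (z.2, z.1)))//; last first.
  by move=> A B mA mB; rewrite setIC VW// muleC.
apply: eq_integral => s _; rewrite /= (dV (fun z => h (z, W s)))//.
by apply: (measurableT_comp mh); mfun.
Qed.

Context (n : nat) (x : 'I_n -> R * R) (a b : R).
Hypothesis n0 : (0 < n)%N.
Hypothesis scatter_x : positive_scatter x.
Hypothesis bn : b < n%:R.
Context d (T : measurableType d) (P : probability T R) (V W : T -> R).
Hypotheses (mV : measurable_fun setT V) (mW : measurable_fun setT W).
Hypothesis VW : forall A B, measurable A -> measurable B ->
  P (V @^-1` A `&` W @^-1` B) = (P (V @^-1` A) * P (W @^-1` B))%E.
Hypothesis dV : has_density _ _ P V (normal_pdf 0 1).
Hypothesis dW : has_density _ _ P W (chi2_pdf (n%:R - a)).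

Let m := n%:R - a.

(** The factors come from the chi-squared density, from the normal density rescaled by sqrt(n), and
    from the substitution c = s11 / s^2. *)
Let law_constant : R := (2 `^ (m / 2) * Gamma_fun (m / 2))^-1 *
  (normal_peak 1 * Num.sqrt n%:R) * (2 * s11 x `^ (m / 2)).

Let theta5_density (A : set R) : \bar R :=
  (\int[leb]_s ((pos_powR (a - 1 - n%:R) s * expR (- s11 x / (2 * s ^+ 2)))%:E *
                theta5_kernel n A (xbar1 x / s)))%E.

Let law_constant_ge0 : 0 <= law_constant.
Proof.
have K0 : 0 <= (2 `^ (m / 2) * Gamma_fun (m / 2))^-1 :> R.
  rewrite invr_ge0 mulr_ge0 ?powR_ge0//.
  by apply: Rintegral_ge0 => y _; rewrite mulr_ge0 ?powR_ge0 ?expR_ge0.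
by rewrite mulr_ge0 ?mulr_ge0 ?normal_peak_ge0 ?sqrtr_ge0 ?powR_ge0.
Qed.

(** Given the chi-squared variable c, [theta5_star] is normal with variance 1/n and mean xbar1
    sqrt(c / s11), which is xbar1 / s when c = s11 / s^2. *)
Lemma theta5_star_law (A : set R) : measurable A ->
  P [set w | A (theta5_star x (V w) (W w))] =
  (law_constant%:E * theta5_density A)%E.
Proof.
move=> mA; have s110 := scatter_s11_gt0 _ _ _ scatter_x.
have sn0 : 0 < Num.sqrt n%:R :> R by rewrite sqrtr_gt0 ltr0n.
have ss0 : 0 < Num.sqrt (s11 x) by rewrite sqrtr_gt0.
pose k := xbar1 x / Num.sqrt (s11 x).
pose h (z : (R * R)%type) := (\1_A (theta5_star x z.1 z.2))%:E : \bar R.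
have mth d' (T' : measurableType d') (f g : T' -> R) : measurable_fun setT f ->
    measurable_fun setT g -> measurable_fun setT (fun t => theta5_star x (f t) (g t)).
  by move=> mf mg; rewrite /theta5_star; mfun.
have mh : measurable_fun setT h.
  apply/measurable_EFinP; apply: (measurableT_comp (measurable_indic mA)).
  by apply: mth; mfun.
have h0 z : (0 <= h z)%E by rewrite lee_fin indicE.
transitivity (\int[P]_w h (V w, W w))%E.
  rewrite (integral_indic_preimage _ _ _ _ _ P (fun w => theta5_star x (V w) (W w)) A)//.
  exact: (mth _ _ V W).
rewrite (independent_density _ _ P V W (normal_pdf 0 1) (chi2_pdf m))//; last 2 first.
- exact: measurable_normal_pdf.
- by move=> y; rewrite normal_pdf_ge0.
pose K : R := (2 `^ (m / 2) * Gamma_fun (m / 2))^-1.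
have K0 : 0 <= K.
  rewrite invr_ge0 mulr_ge0 ?powR_ge0//.
  by apply: Rintegral_ge0 => y _; rewrite mulr_ge0 ?powR_ge0 ?expR_ge0.
pose c := normal_peak 1 * Num.sqrt n%:R : R.
have c0 : 0 <= c by rewrite mulr_ge0 ?normal_peak_ge0// ltW.
pose G y := theta5_kernel n A y.
have mG : measurable_fun setT G by exact: measurable_theta5_kernel.
have G0 y : (0 <= G y)%E by exact: theta5_kernel_ge0.
transitivity (\int[leb]_y ((K * c)%:E * (G (k * Num.sqrt y)%R * (chi_fun m y)%:E)))%E.
  apply: eq_integral => y _.
  rewrite chi2_pdfE -/K (integral_affine _ (Num.sqrt n%:R) (- Num.sqrt n%:R * (k * Num.sqrt y))); last 3 first.
  - by rewrite gt_eqF.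
  - apply: emeasurable_funM; first by apply: (measurableT_comp mh); mfun.
    by apply/measurable_EFinP; apply: measurable_std_normal_pdf; mfun.
  - by move=> z; rewrite mule_ge0// lee_fin normal_pdf_ge0.
  have -> : (\int[leb]_u (h ((Num.sqrt n%:R * u + - Num.sqrt n%:R * (k * Num.sqrt y))%R, y) *
      (normal_pdf 0 1 (Num.sqrt n%:R * u + - Num.sqrt n%:R * (k * Num.sqrt y)))%:E * `|Num.sqrt n%:R|%:E)
      = c%:E * G (k * Num.sqrt y)%R)%E.
    rewrite /G /theta5_kernel -ge0_integralZl; last 4 first.
    - by [].
    - apply/measurable_EFinP; apply: measurable_funM; last by mfun.
      exact: measurable_indic.
    - by move=> u _; rewrite lee_fin mulr_ge0 ?expR_ge0// indicE.
    - by rewrite lee_fin.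
    apply: eq_integral => u _; rewrite gtr0_norm// -!EFinM; congr EFin.
    have -> : theta5_star x (Num.sqrt n%:R * u + - Num.sqrt n%:R * (k * Num.sqrt y)) y = u.
      by rewrite /theta5_star -/k; field; rewrite gt_eqF.
    rewrite std_normal_pdfE /c.
    have -> : - (Num.sqrt n%:R * u + - Num.sqrt n%:R * (k * Num.sqrt y)) ^+ 2 / 2 =
        - n%:R * (k * Num.sqrt y - u) ^+ 2 / 2 :> R.
      by rewrite -[in RHS](@sqr_sqrtr R n%:R)//; ring.
    by ring.
  by rewrite (EFinM K (chi_fun _ _)) (EFinM K c) -!muleA (muleCA (G _) K%:E) (muleCA c%:E).
have mGk d' (T' : measurableType d') (f : T' -> R) : measurable_fun setT f ->
    measurable_fun setT (fun y => G (k * Num.sqrt (f y))%R * (chi_fun m (f y))%:E)%E.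
  move=> mf; apply: emeasurable_funM; first by apply: (measurableT_comp mG); mfun.
  by apply/measurable_EFinP; exact: measurable_chi_fun_comp.
have Gk0 y : (0 <= G (k * Num.sqrt y)%R * (chi_fun m y)%:E)%E.
  by rewrite mule_ge0// lee_fin chi_fun_ge0.
rewrite ge0_integralZl; last 4 first.
- by [].
- by apply: mGk; mfun.
- by move=> y _; exact: Gk0.
- by rewrite lee_fin mulr_ge0.
rewrite (integral_support `]0, +oo[%classic); last first.
  by move=> y /=; rewrite in_itv/= andbT => /negP/negbTE y0; rewrite /chi_fun y0 mule0.
rewrite (inverse_square_substitution _ _ s110); last 2 first.
- by apply: mGk; mfun.
- by move=> y; exact: Gk0.
have -> : law_constant = K * c * (2 * s11 x `^ (m / 2)) by [].
rewrite [in RHS]EFinM -muleA; congr (_ * _)%E.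
rewrite /theta5_density -ge0_integralZl; last 4 first.
- by [].
- apply: emeasurable_funM; first by apply/measurable_EFinP; mfun'.
  by apply: (measurableT_comp mG); mfun.
- move=> s _; rewrite mule_ge0 ?theta5_kernel_ge0// lee_fin.
  by rewrite mulr_ge0 ?pos_powR_ge0 ?expR_ge0.
- by rewrite lee_fin mulr_ge0 ?powR_ge0.
rewrite [RHS](integral_support `]0, +oo[%classic); last first.
  move=> s /=; rewrite in_itv/= andbT => /negP; rewrite -leNgt => s0.
  by rewrite pos_powR_le0// mul0r mul0e mule0.
apply: eq_integral => s; rewrite inE/= in_itv/= andbT => s0.
have -> : k * Num.sqrt (s11 x / s ^+ 2) = xbar1 x / s.
  rewrite sqrtrM ?(ltW s110)// sqrtrV ?sqr_ge0// sqrtr_sqr gtr0_norm// /k.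
  by field; rewrite !gt_eqF.
rewrite -/(G _) -muleA -EFinM muleCA muleA -EFinM [RHS]muleC; congr (_ * _%:E)%E.
rewrite /chi_fun divr_gt0 ?exprn_gt0// pos_powRE//.
have -> : (s11 x / s ^+ 2) `^ (m / 2 - 1) = s11 x `^ (m / 2) / s11 x * s `^ (2 - m).
  rewrite powRM ?invr_ge0 ?exprn_ge0 ?(ltW s110) ?(ltW s0)//.
  congr (_ * _).
    rewrite powRD; last by apply/implyP => _; rewrite gt_eqF.
    by rewrite powR_inv1// ltW.
  by rewrite -powR_invn ?(ltW s0)// -powRrM; congr (_ `^ _); field.
have -> : s `^ (a - 1 - n%:R) = s `^ (2 - m) / s ^+ 3.
  rewrite -(powR_invn _ (ltW s0)) -powRD; last by apply/implyP => _; rewrite gt_eqF.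
  by congr (_ `^ _); rewrite /m; ring.
have -> : - (s11 x / s ^+ 2) / 2 = - s11 x / (2 * s ^+ 2).
  by field; rewrite gt_eqF.
by field; rewrite !gt_eqF.
Qed.

(** Both sides are constant multiples of [theta5_density]. Taking the whole line for [A] gives
    probability one on the right, so the total of [theta5_density] is positive and finite and the
    normalized constants coincide. *)
Lemma posterior_theta5_law (A : set R) : measurable A ->
  posterior x a b [set t | A (theta5 t)] = P [set w | A (theta5_star x (V w) (W w))].
Proof.
move=> mA.
have lawT : (law_constant%:E * theta5_density setT = 1)%E.
  rewrite -theta5_star_law//; have -> : [set w | setT (theta5_star x (V w) (W w))] = setT by [].
  exact: probability_setT.
pose c := ((posterior_constant n)%:E * scatter_mass n x b)%E : \bar R.
have c0 : (0 < c)%E.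
  rewrite mule_gt0 ?lte_fin ?posterior_constant_gt0//.
  exact: scatter_mass_gt0.
have coo : (c < +oo)%E.
  rewrite lte_mul_pinfty ?lee_fin ?(ltW (posterior_constant_gt0 _ n0))//.
  exact: scatter_mass_lty.
have massE B : measurable B ->
    posterior_mass x a b [set t | B (theta5 t)] = (c * theta5_density B)%E.
  exact: posterior_massE.
have -> : posterior x a b [set t | A (theta5 t)] =
    (c * theta5_density A * ((fine (c * theta5_density setT))^-1)%:E)%E.
  rewrite /posterior massE//; congr (_ * (fine _)^-1%:E)%E.
  by rewrite -massE.
rewrite theta5_star_law//.
have cfin : c = (fine c)%:E by rewrite fineK// ge0_fin_numE// ltW.
have fc0 : 0 < fine c by rewrite fine_gt0// c0.
have D0 : (0 <= theta5_density setT)%E.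
  apply: integral_ge0 => s _; rewrite mule_ge0 ?theta5_kernel_ge0// lee_fin.
  by rewrite mulr_ge0 ?pos_powR_ge0 ?expR_ge0.
have L0 : 0 < law_constant.
  rewrite lt_neqAle law_constant_ge0 andbT; apply/eqP => L0; move: lawT.
  by rewrite -L0 mul0e => /eqP; rewrite eq_sym onee_eq0.
have DE : theta5_density setT = (law_constant^-1)%:E.
  by rewrite -[RHS]mule1 -lawT muleA -EFinM mulVf ?gt_eqF// mul1e.
rewrite DE cfin -EFinM /= invfM invrK muleC muleA -EFinM mulrAC mulVf ?gt_eqF// mul1r.
by [].
Qed.

End posterior_law.

(** * Almost sure positivity of the scatter *)

Section almost_sure_scatter.
Context {R : realType}.
Local Notation leb := (@lebesgue_measure R).

Definition collinear (p : (R * R) * (R * R)) (y : R * R) : bool :=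
  (p.2.1 - p.1.1) * (y.2 - p.1.2) == (y.1 - p.1.1) * (p.2.2 - p.1.2).

(* Lagrange's identity writes the determinant as a sum of squares. *)
Lemma degenerate_scatter_collinear n (x : 'I_n -> R * R) (i j k : 'I_n) :
  ~ positive_scatter x -> collinear (x i, x j) (x k).
Proof.
move=> nscatter; pose d l := (x l).1 - xbar1 x; pose e l := (x l).2 - xbar2 x.
have s12E : s12 x = \sum_l d l * e l by [].
have lagrange : \sum_l \sum_m (d l * e m - d m * e l) ^+ 2 =
    2 * (s11 x * s22 x - s12 x ^+ 2).
  have -> : s11 x * s22 x - s12 x ^+ 2 =
      \sum_l \sum_m (d l ^+ 2 * e m ^+ 2 - (d l * e l) * (d m * e m)).
    under eq_bigr do rewrite big_split/= sumrN -!mulr_sumr.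
    by rewrite big_split/= sumrN -!mulr_suml expr2.
  transitivity (\sum_l \sum_m (d l ^+ 2 * e m ^+ 2 - (d l * e l) * (d m * e m)) +
    \sum_l \sum_m (d m ^+ 2 * e l ^+ 2 - (d m * e m) * (d l * e l))).
    rewrite -big_split/=; apply: eq_bigr => l _; rewrite -big_split/=.
    by apply: eq_bigr => m _; ring.
  by rewrite [X in _ + X]exchange_big/= mulr_natl mulr2n.
have cross l m : d l * e m = d m * e l.
  have sq0 : \sum_l \sum_m (d l * e m - d m * e l) ^+ 2 == 0.
    rewrite eq_le sumr_ge0 ?andbT; last first.
      by move=> *; apply: sumr_ge0 => *; exact: sqr_ge0.
    rewrite lagrange pmulr_rle0//; rewrite leNgt; exact/negP.
  move: sq0; rewrite psumr_eq0; last by move=> *; apply: sumr_ge0 => *; exact: sqr_ge0.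
  move=> /allP/(_ l (mem_index_enum l)); rewrite psumr_eq0; last by move=> *; exact: sqr_ge0.
  move=> /allP/(_ m (mem_index_enum m)); rewrite sqrf_eq0 subr_eq0.
  by move/eqP.
rewrite /collinear/=; apply/eqP.
have -> : (x j).1 - (x i).1 = d j - d i by rewrite /d; ring.
have -> : (x k).1 - (x i).1 = d k - d i by rewrite /d; ring.
have -> : (x j).2 - (x i).2 = e j - e i by rewrite /e; ring.
have -> : (x k).2 - (x i).2 = e k - e i by rewrite /e; ring.
move: (cross i j) (cross i k) (cross j k).
move: (d i) (d j) (d k) (e i) (e j) (e k) => di dj dk ei ej ek hij hik hjk.
transitivity (dj * ek - dj * ei - di * ek + di * ei); first by ring.
by rewrite hjk -hij hik; ring.
Qed.

(** By independence the probability is an integral of section probabilities, which is bounded by the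
    indicator of the null event that [V] lies in [B]. *)
Lemma null_section d d1 d2 (S : measurableType d) (T1 : measurableType d1)
    (T2 : measurableType d2) (P : probability S R) (V : S -> T1) (W : S -> T2)
    (N : set (T1 * T2)%type) (B : set T1) :
  measurable_fun setT V -> measurable_fun setT W ->
  (forall A C, measurable A -> measurable C ->
     P (V @^-1` A `&` W @^-1` C) = (P (V @^-1` A) * P (W @^-1` C))%E) ->
  measurable N -> measurable B -> P (V @^-1` B) = 0%E ->
  (forall p, ~ B p -> P (W @^-1` [set y | N (p, y)]) = 0%E) ->
  P [set s | N (V s, W s)] = 0%E.
Proof.
move=> mV mW VW mN mB PB sec0.
have mVW : measurable [set s | N (V s, W s)].
  rewrite -[X in measurable X]setTI.
  by apply: (measurable_fun_pair mV mW) => //.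
rewrite -[LHS](integral_indic_preimage _ _ _ _ _ P (fun s => (V s, W s)) N)//; last first.
  exact: measurable_fun_pair.
rewrite (independent_integral _ _ _ _ _ _ _ P V W (fun z => (\1_N z)%:E))//; last first.
  by apply/measurable_EFinP; exact: measurable_indic.
have mB' : measurable (V @^-1` B) by rewrite -[X in measurable X]setTI; exact: mV.
apply/eqP; rewrite eq_le; apply/andP; split; last first.
  by apply: integral_ge0 => s _; apply: integral_ge0 => s' _; rewrite lee_fin indicE.
rewrite -PB -[X in (_ <= P X)%E]setIT -integral_indic//.
apply: ge0_le_integral => //.
- by move=> s _; apply: integral_ge0 => s' _; rewrite lee_fin indicE.
- apply: (measurable_fun_fubini_tonelli_F (m2 := P) (fun z => (\1_N (V z.1, W z.2))%:E)).
    apply/measurable_EFinP; apply: (measurableT_comp (measurable_indic mN)).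
    by apply: measurable_fun_pair; [apply: (measurableT_comp mV)|apply: (measurableT_comp mW)]; mfun.
  by move=> z; rewrite lee_fin indicE.
- by apply/measurable_EFinP; exact: measurable_indic.
move=> s _; rewrite (integral_indic_preimage _ _ _ _ _ P (fun s' => (V s, W s')) N)//; last first.
  by apply: measurable_fun_pair => //; exact: measurable_cst.
rewrite indicE; have [Bs|Bs] := pselect (B (V s)).
  rewrite mem_set//; apply: probability_le1; apply: measurable_preimage => //.
  by apply: measurable_fun_pair => //; exact: measurable_cst.
by rewrite [leLHS](sec0 (V s) Bs) lee_fin.
Qed.

Lemma measurable_collinear d (T : measurableType d) (f : T -> ((R * R) * (R * R))%type)
    (g : T -> (R * R)%type) : measurable_fun setT f -> measurable_fun setT g ->
  measurable [set z | collinear (f z) (g z)].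
Proof.
move=> mf mg; pose h z := ((f z).2.1 - (f z).1.1) * ((g z).2 - (f z).1.2) -
  ((g z).1 - (f z).1.1) * ((f z).2.2 - (f z).1.2).
have -> : [set z | collinear (f z) (g z)] = h @^-1` [set 0].
  apply/seteqP; split => z; rewrite /collinear/= /h.
    by move=> /eqP ->; rewrite subrr.
  by move=> /eqP; rewrite subr_eq0.
by apply: measurable_preimage => //; rewrite /h; mfun.
Qed.

Variables (n : nat) (t : @param R) (d : measure_display) (S : measurableType d).
Variables (Q : probability S R) (X : 'I_n -> {RV Q >-> (R * R)%type}).
Hypotheses (n2 : (2 < n)%N) (sampleX : binormal_sample t X).

Lemma measurable_binormal_pdf (t' : @param R) : measurable_fun setT (@binormal_pdf R t').
Proof. by case: t' => [[[[m1 m2] s1] s2] r]; rewrite /binormal_pdf; mfun. Qed.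

Let sample_null k (N : set (R * R)%type) : measurable N -> (leb \x leb)%E N = 0%E ->
  Q (X k @^-1` N) = 0%E.
Proof.
move=> mN N0; rewrite -[LHS]/(distribution Q (X k) N) (sampleX.2 k)//.
rewrite /binormal_prob; apply: null_set_integral => //.
by apply/measurable_EFinP; apply: measurable_funTS; exact: measurable_binormal_pdf.
Qed.

Let vertical_null k c : Q (X k @^-1` [set y | y.1 = c]) = 0%E.
Proof.
apply: sample_null.
  have -> : [set y : (R * R)%type | y.1 = c] = fst @^-1` [set c] by [].
  by apply: measurable_preimage => //; exact: measurable_fst.
have -> : [set y : (R * R)%type | y.1 = c] = [set c] `*` setT.
  by apply/seteqP; split => y /=; [|case].
rewrite product_measure1E//.
transitivity (0 * leb setT)%E; last exact: mul0e.
exact: (congr1 (fun u => (u * leb setT)%E) (lebesgue_measure_set1 c)).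
Qed.

(** The two points of [p] have different abscissas, so each vertical section of the line through
    them is a single point. *)
Let line_null k (p : ((R * R) * (R * R))%type) : p.2.1 != p.1.1 ->
  Q (X k @^-1` [set y | collinear p y]) = 0%E.
Proof.
move=> p12; apply: sample_null.
  by apply: measurable_collinear; [exact: measurable_cst|exact: measurable_id].
rewrite /product_measure1; apply: integral0_eq => u _ /=.
pose v := p.1.2 + (u - p.1.1) * (p.2.2 - p.1.2) / (p.2.1 - p.1.1).
have dn0 : p.2.1 - p.1.1 != 0 by rewrite subr_eq0.
have -> : xsection [set y | collinear p y] u = [set v]; last exact: lebesgue_measure_set1.
apply/seteqP; split => y; rewrite /xsection/= inE /collinear/=.
  move=> /eqP h; rewrite /v -h mulrAC divff// mul1r.
  by rewrite addrC subrK.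
by move=> ->; apply/eqP; rewrite /v; field.
Qed.

Let obs k s := if insub k is Some i then X i s else (0, 0).

(** A state that stores observations 0 and 1 and ignores the later ones; [prefix_independence] then
    says that the first two observations are jointly independent of the third. *)
Let keep k (z : (((R * R) * (R * R)) * (R * R))%type) :=
  if k is 0%N then (z.2, z.1.2) else if k is 1%N then (z.1.1, z.2) else z.1.

Let V := fix V k s := if k is k'.+1 then keep k' (V k' s, obs k' s) else ((0, 0), (0, 0)).

Let mkeep k : measurable_fun setT (keep k).
Proof. by case: k => [|[|k]]; rewrite /keep; mfun. Qed.

Let VS (k : 'I_n) s : V k.+1 s = keep k (V k s, X k s).
Proof. by rewrite /= /obs valK. Qed.

Let mV k : (k <= n)%N -> measurable_fun setT (V k).
Proof. exact: (measurable_prefix _ _ _ _ _ _ _ Q n X V keep ((0, 0), (0, 0))). Qed.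

Let indV (k : 'I_n) (A : set ((R * R) * (R * R))%type) (C : set (R * R)%type) :
  measurable A -> measurable C ->
  Q (V k @^-1` A `&` X k @^-1` C) = (Q (V k @^-1` A) * Q (X k @^-1` C))%E.
Proof.
exact: (prefix_independence _ _ _ _ _ _ _ Q n X V keep ((0, 0), (0, 0)) sampleX.1 mkeep).
Qed.

(** A degenerate scatter puts the first three observations on a line. Almost surely the first two
    have different abscissas, and then the third misses the line through them. *)
Lemma almost_sure_positive_scatter : {ae Q, forall s, positive_scatter (fun k => X k s)}.
Proof.
have n1 := ltnW n2; have n0 := ltnW n1.
pose i0 := Ordinal n0; pose i1 := Ordinal n1; pose i2 := Ordinal n2.
have V2 s : V 2 s = (X i0 s, X i1 s) by rewrite (VS i1) (VS i0).
pose B : set ((R * R) * (R * R))%type := [set p | p.2.1 = p.1.1].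
pose N : set (((R * R) * (R * R)) * (R * R))%type := [set z | collinear z.1 z.2].
have mN : measurable N by apply: measurable_collinear; mfun.
have mB : measurable B.
  have -> : B = (fun p => p.2.1 - p.1.1) @^-1` [set 0].
    by apply/seteqP; split => p; rewrite /B/=; [move=> ->; rewrite subrr|move/eqP; rewrite subr_eq0 => /eqP].
  by apply: measurable_preimage => //; mfun.
have B0 : Q (V 2 @^-1` B) = 0%E.
  have -> : V 2 @^-1` B = [set s | [set z : (((R * R) * (R * R)) * (R * R))%type | z.2.1 = z.1.1.1] (V 1 s, X i1 s)].
    by apply/seteqP; split => s; rewrite /preimage /mkset V2 (VS i0).
  apply: (null_section _ _ _ _ _ _ Q (V 1) (X i1) _ set0).
  - exact: mV.
  - by [].
  - by move=> A C mA mC; exact: (indV i1).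
  - have -> : [set z : (((R * R) * (R * R)) * (R * R))%type | z.2.1 = z.1.1.1] =
        (fun z => z.2.1 - z.1.1.1) @^-1` [set 0].
      by apply/seteqP; split => p/=; [move=> ->; rewrite subrr|move/eqP; rewrite subr_eq0 => /eqP].
    by apply: measurable_preimage => //; mfun.
  - by [].
  - by rewrite preimage_set0 measure0.
  - by move=> p _; exact: vertical_null.
have N0 : Q [set s | N (V 2 s, X i2 s)] = 0%E.
  apply: (null_section _ _ _ _ _ _ Q (V 2) (X i2) _ B) => //.
  - exact: mV.
  - by move=> A C mA mC; exact: (indV i2).
  - by move=> p pB; apply: line_null; apply/eqP.
exists [set s | N (V 2 s, X i2 s)]; split => //.
  by apply: (measurable_preimage _ _ _ _ (fun s => (V 2 s, X i2 s))) => //;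
    apply: measurable_fun_pair => //; exact: mV.
move=> s /= nscatter; rewrite /N /= -[(_, _)]/(V 2 s) V2.
exact: (degenerate_scatter_collinear n (fun k => X k s)).
Qed.

End almost_sure_scatter.

(** * Quantiles and normal mixtures *)

Section quantiles.
Context {R : realType} d (T : measurableType d) (P : probability T R) (W : T -> R).
Hypothesis mW : measurable_fun setT W.
Variable beta : R.
Hypothesis beta01 : 0 < beta < 1.

Let F (r : R) : R := fine (P [set w | W w <= r]).

Let FE (r : R) : P [set w | W w <= r] = (F r)%:E.
Proof.
rewrite /F fineK// fin_num_measure//.
have -> : [set w | W w <= r] = W @^-1` `]-oo, r] by apply/seteqP; split => w /=; rewrite in_itv.
exact: measurable_preimage.
Qed.

Let W' : {RV P >-> R} := HB.pack W (isMeasurableFun.Build _ _ _ _ _ mW).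

Let FcdfE r : F r = fine (cdf W' r).
Proof. by congr (fine (P _)); apply/seteqP; split => w /=; rewrite in_itv. Qed.

Let F_homo : {homo F : x y / x <= y}.
Proof.
by move=> x y xy; rewrite !FcdfE fine_le ?fin_num_measure// cdf_nondecreasing.
Qed.

(** The level lies strictly between 0 and 1, so the set under the infimum is nonempty and bounded
    below and [inf] takes no default value. Right-continuity of the distribution function provides a
    point above [r] that is still below the level. *)
Lemma quantile_gt (r : R) :
  r < quantile P W beta <-> (P [set w | (W w <= r)%R] < beta%:E)%E.
Proof.
move: beta01 => /andP[beta0 beta1].
rewrite /quantile; set S := [set q | _].
have SE q : S q = (beta <= F q) :> Prop by rewrite /S /= FE lee_fin.
have lowS x : F x < beta -> lbound S x.
  move=> Fx q; rewrite SE => Fq; rewrite leNgt; apply/negP => /ltW/F_homo.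
  by move=> /(le_trans Fq); rewrite leNgt Fx.
have F0 : F x @[x --> -oo] --> (0 : R).
  by rewrite (funext FcdfE); apply: fine_cvg; exact: (@cvg_cdfNy0 _ _ _ _ W').
have F1 : F x @[x --> +oo] --> (1 : R).
  by rewrite (funext FcdfE); apply: fine_cvg; exact: (@cvg_cdfy1 _ _ _ _ W').
have S0 : S !=set0.
  have := cvgr_gt _ F1 _ beta1.
  move=> [M [_ /(_ (M + 1))]] h; exists (M + 1); rewrite SE ltW// h//.
  by rewrite ltrDl.
have lS : has_lbound S.
  have := cvgr_lt _ F0 _ beta0.
  move=> [M [_ /(_ (M - 1))]] h; exists (M - 1); apply: lowS; apply: h.
  by rewrite ltrBlDr ltrDl.
rewrite FE lte_fin; split => [rS|Fr].
  rewrite ltNge; apply/negP => Fr.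
  have : inf S <= r by apply: ge_inf => //; rewrite SE.
  by rewrite leNgt rS.
have Fr' : F x @[x --> r^'+] --> F r.
  rewrite (funext FcdfE); apply: fine_cvg; rewrite fineK ?fin_num_measure//.
  exact: cdf_right_continuous.
have [x [rx Fx]] : exists x, r < x /\ F x < beta.
  near r^'+ => x; exists x; split; first by near: x; exact: nbhs_right_gt.
  by near: x; exact: (cvgr_lt _ Fr').
by apply: (lt_le_trans rx); apply: lb_le_inf => //; exact: lowS.
Unshelve. all: by end_near. Qed.

Lemma cdf_quantile : P [set w | W w = quantile P W beta] = 0%E ->
  P [set w | (W w <= quantile P W beta)%R] = beta%:E.
Proof.
set q := quantile P W beta => Pq.
have ge_beta : (beta%:E <= P [set w | (W w <= q)%R])%E.
  by rewrite leNgt; apply/negP => /quantile_gt; rewrite ltxx.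
apply/eqP; rewrite eq_le ge_beta andbT.
have mle (x : R) : measurable [set w | W w <= x].
  have -> : [set w | W w <= x] = W @^-1` `]-oo, x] by apply/seteqP; split => w /=; rewrite in_itv.
  exact: measurable_preimage.
(* Approximation of [W < q] from inside: each of these events has probability below the level by
   [quantile_gt], and without an atom at [q] the union has the same probability as [W <= q]. *)
pose E k := [set w | W w <= q - k.+1%:R^-1].
have EU : \bigcup_k E k = [set w | W w < q].
  apply/seteqP; split => w /=.
    move=> [k _]; rewrite /E /= => /le_lt_trans; apply.
    by rewrite ltrBlDr ltrDl invr_gt0.
  move=> Wq; have qW : 0 < q - W w by rewrite subr_gt0.
  have [k _ hk] := near_infty_natSinv_lt (PosNum qW).
  exists k => //; rewrite /E/= lerBrDr -lerBrDl ltW//.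
  exact: hk (leqnn _).
have -> : [set w | W w <= q] = \bigcup_k E k `|` [set w | W w = q].
  rewrite EU; apply/seteqP; split => w /=.
    by rewrite le_eqVlt => /predU1P[|]; [right|left].
  by case => [/ltW//|->].
have mEU : measurable (\bigcup_k E k) by apply: bigcup_measurable => k _; exact: mle.
have mq : measurable [set w | W w = q].
  by have -> : [set w | W w = q] = W @^-1` [set q] by []; exact: measurable_preimage.
apply: (@le_trans _ _ (P (\bigcup_k E k) + 0)%E); first by rewrite -Pq; exact: measureU2.
rewrite adde0.
have cvE : P (E k) @[k --> \oo] --> P (\bigcup_k E k).
  apply: nondecreasing_cvg_mu => // [k|k l kl]; first exact: mle.
  apply/subsetPset => w; rewrite /E/= => /le_trans; apply.
  by rewrite lerD2l lerN2 lef_pV2 ?posrE// ler_nat.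
rewrite -(cvg_lim _ cvE)//; apply: lime_le; first by apply/cvg_ex; exists (P (\bigcup_k E k)).
near=> k; apply: ltW; rewrite /E; apply/quantile_gt.
by rewrite ltrBlDr ltrDl invr_gt0.
Unshelve. all: by end_near. Qed.

End quantiles.

Section normal_cdf.
Context {R : realType}.
Local Notation leb := (@lebesgue_measure R).

Definition std_normal_cdf (x : R) : R := fine (@normal_prob R 0 1 `]-oo, x]).

Lemma normal_prob_itvE x : @normal_prob R 0 1 `]-oo, x] = (std_normal_cdf x)%:E.
Proof. by rewrite /std_normal_cdf fineK// fin_num_measure. Qed.

Lemma integral_below (A : set R) (x : R) : measurable A ->
  (forall z, z != x -> A z <-> z < x) ->
  (\int[leb]_z ((\1_A z)%:E * (normal_pdf 0 1 z)%:E) = (std_normal_cdf x)%:E)%E.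
Proof.
move=> mA Ax; rewrite -normal_prob_itvE /normal_prob [RHS]integral_mkcond.
apply: ae_eq_integral => //.
- apply: emeasurable_funM; apply/measurable_EFinP; first exact: measurable_indic.
  exact: measurable_normal_pdf.
- apply/(measurable_restrictT _ _).1 => //.
  by apply/measurable_EFinP; apply: measurable_funTS; exact: measurable_normal_pdf.
exists [set x]; split; [exact: measurable_set1|exact: lebesgue_measure_set1|].
move=> z /= /not_implyP[_ h]; apply: contrapT => /eqP zx0; apply: h.
have Az := Ax z zx0.
rewrite patchE indicE mem_setE in_itv/=.
case: ifPn => [|/negP] zx.
  rewrite mem_set ?mul1e//; apply/Az.
  by rewrite lt_neqAle zx0.
rewrite memNset ?mul0e// => /Az; rewrite lt_neqAle => /andP[_ zx'].
exact: zx.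
Qed.

Lemma std_normal_cdf_ge0 x : 0 <= std_normal_cdf x.
Proof. exact: fine_ge0. Qed.

Lemma std_normal_cdf_le1 x : std_normal_cdf x <= 1.
Proof. by rewrite -lee_fin -normal_prob_itvE; exact: probability_le1. Qed.

Lemma std_normal_cdf_lt x y : x < y -> std_normal_cdf x < std_normal_cdf y.
Proof.
(* [M] dominates the absolute value on []x, y]], so the density there is at least its value at
   [M]. *)
move=> xy; pose M := `|x| + `|y|.
rewrite -lte_fin -!normal_prob_itvE.
have -> : `]-oo, y]%classic = `]-oo, x] `|` `]x, y] :> set R.
  by rewrite -itv_bndbnd_setU// bnd_simp ltW.
rewrite measureU//; last first.
  by apply/seteqP; split => // z [] /=; rewrite !in_itv/= => zx /andP[]; rewrite ltNge zx.
rewrite -[ltLHS]adde0 lteD2lE ?fin_num_measure//.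
apply: (@lt_le_trans _ _ (\int[leb]_(z in `]x, y]) (normal_peak 1 * expR (- M ^+ 2 / 2))%:E)%E).
  rewrite integral_cst//= lebesgue_measure_itv/= lte_fin xy -EFinD -EFinM lte_fin.
  by rewrite !mulr_gt0 ?normal_peak_gt0 ?expR_gt0 ?oner_eq0// subr_gt0.
apply: ge0_le_integral => //.
- by move=> z _; rewrite lee_fin mulr_ge0 ?normal_peak_ge0 ?expR_ge0.
- by apply/measurable_EFinP; apply: measurable_funTS; exact: measurable_normal_pdf.
move=> z /=; rewrite in_itv/= => /andP[xz zy].
rewrite lee_fin std_normal_pdfE ler_wpM2l ?normal_peak_ge0// ler_expR.
rewrite !mulNr lerN2 ler_pM2r ?invr_gt0//.
rewrite -[leLHS]real_normK ?num_real// lerXn2r ?nnegrE ?addr_ge0//.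
rewrite ler_norml; apply/andP; split.
  rewrite /M; have := ler_norm (- x); have := normr_ge0 y; rewrite normrN.
  by lra.
by rewrite /M; have := ler_norm y; have := normr_ge0 x; lra.
Qed.

Lemma measurable_std_normal_cdf d (T : measurableType d) (f : T -> R) :
  measurable_fun setT f -> measurable_fun setT (fun x => std_normal_cdf (f x)).
Proof.
move=> mf; apply: (measurableT_comp _ mf); apply: nondecreasing_measurable => //.
move=> x y; rewrite le_eqVlt => /predU1P[->//|/std_normal_cdf_lt]; exact: ltW.
Qed.

End normal_cdf.

Section chi_mixtures.
Context {R : realType}.
Local Notation leb := (@lebesgue_measure R).

(** For [g] the density of a positive variable C independent of a standard normal Z, the probability
    that (Z - D) / sqrt(C) is at most [q]. *)
Definition normal_mixture (D q : R) (g : R -> R) : \bar R :=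
  (\int[leb]_c ((std_normal_cdf (D + q * Num.sqrt c) * g c)%:E))%E.

(* The events [z < u c] and [z <= u c] are treated together: they agree off [z = u c]. *)
Lemma below_section_integral (A : set (R * R)%type) (u g : R -> R) : measurable A ->
  (forall c, c <= 0 -> g c = 0) ->
  (forall z c, 0 < c -> z != u c -> A (z, c) <-> z < u c) ->
  (\int[leb]_c ((\int[leb]_z ((\1_A (z, c))%:E * (normal_pdf 0 1 z)%:E)) * (g c)%:E) =
   \int[leb]_c ((std_normal_cdf (u c) * g c)%:E))%E.
Proof.
move=> mA g0 Au; apply: eq_integral => c _.
have [c0|c0] := leP c 0; first by rewrite g0// mule0 mulr0.
rewrite EFinM -(integral_below [set z | A (z, c)])//; last 2 first.
- have -> : [set z | A (z, c)] = (fun z => (z, c)) @^-1` A by [].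
  by apply: measurable_preimage => //; mfun.
- by move=> z zu; exact: Au.
Qed.

Context d (T : measurableType d) (P : probability T R) (V W : T -> R) (g : R -> R).
Hypotheses (mV : measurable_fun setT V) (mW : measurable_fun setT W).
Hypothesis VW : forall A B, measurable A -> measurable B ->
  P (V @^-1` A `&` W @^-1` B) = (P (V @^-1` A) * P (W @^-1` B))%E.
Hypothesis dV : has_density _ _ P V (normal_pdf 0 1).
Hypothesis dW : has_density _ _ P W g.
Hypothesis g0 : forall c, c <= 0 -> g c = 0.

Lemma below_section_probability (A : set (R * R)%type) (u : R -> R) : measurable A ->
  (forall z c, 0 < c -> z != u c -> A (z, c) <-> z < u c) ->
  P [set w | A (V w, W w)] = (\int[leb]_c ((std_normal_cdf (u c) * g c)%:E))%E.
Proof.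
move=> mA Au; rewrite -(below_section_integral A)//.
rewrite -(independent_density _ _ P V W _ _ (fun z => (\1_A z)%:E))//; last 3 first.
- exact: measurable_normal_pdf.
- by move=> y; rewrite normal_pdf_ge0.
- by apply/measurable_EFinP; exact: measurable_indic.
rewrite (integral_indic_preimage _ _ _ _ _ P (fun s => (V s, W s)) A)//.
exact: measurable_fun_pair.
Qed.

Let mratio (D : R) d' (T' : measurableType d') (f f' : T' -> R) :
  measurable_fun setT f -> measurable_fun setT f' ->
  measurable_fun setT (fun t => (f t - D) / Num.sqrt (f' t)).
Proof. by move=> mf mf'; mfun. Qed.

Lemma ratio_lt_probability D q :
  P [set w | (V w - D) / Num.sqrt (W w) < q] = normal_mixture D q g.
Proof.
apply: (below_section_probability [set z | (z.1 - D) / Num.sqrt z.2 < q]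
  (fun c => D + q * Num.sqrt c)).
  have -> : [set z : (R * R)%type | (z.1 - D) / Num.sqrt z.2 < q] =
      (fun z => (z.1 - D) / Num.sqrt z.2) @^-1` `]-oo, q[.
    by apply/seteqP; split => z /=; rewrite in_itv.
  by apply: measurable_preimage => //; apply: mratio; mfun.
move=> z c c0 _ /=; rewrite ltr_pdivrMr ?sqrtr_gt0//.
by rewrite ltrBlDl.
Qed.

Lemma ratio_le_probability D q :
  P [set w | (V w - D) / Num.sqrt (W w) <= q] = normal_mixture D q g.
Proof.
apply: (below_section_probability [set z | (z.1 - D) / Num.sqrt z.2 <= q]
  (fun c => D + q * Num.sqrt c)).
  have -> : [set z : (R * R)%type | (z.1 - D) / Num.sqrt z.2 <= q] =
      (fun z => (z.1 - D) / Num.sqrt z.2) @^-1` `]-oo, q].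
    by apply/seteqP; split => z /=; rewrite in_itv.
  by apply: measurable_preimage => //; apply: mratio; mfun.
move=> z c c0 zu /=; rewrite ler_pdivrMr ?sqrtr_gt0//.
by rewrite lerBlDl le_eqVlt (negbTE zu).
Qed.

(** The strict and the weak inequality have the same probability, so the ratio has no atom and its
    distribution function attains the level exactly. *)
Lemma ratio_quantile D beta : 0 < beta < 1 ->
  normal_mixture D (quantile P (fun w => (V w - D) / Num.sqrt (W w)) beta) g = beta%:E.
Proof.
move=> beta01; rewrite -ratio_le_probability.
have mr := mratio D _ _ V W mV mW.
apply: cdf_quantile => //; set q := quantile _ _ _.
pose r w := (V w - D) / Num.sqrt (W w).
have mq : measurable (r @^-1` [set q]) by exact: measurable_preimage.
have mlt : measurable (r @^-1` `]-oo, q[) by exact: measurable_preimage.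
have := ratio_lt_probability D q; rewrite -ratio_le_probability.
have -> : [set w | (V w - D) / Num.sqrt (W w) < q] = r @^-1` `]-oo, q[.
  by apply/seteqP; split => z /=; rewrite in_itv.
have -> : [set w | (V w - D) / Num.sqrt (W w) <= q] = r @^-1` `]-oo, q[ `|` r @^-1` [set q].
  apply/seteqP; split => z /=; rewrite in_itv/= /r.
    by rewrite le_eqVlt => /predU1P[|]; [right|left].
  by case => [/ltW//|->].
rewrite measureU//; last first.
  by apply/seteqP; split => // z [/=]; rewrite in_itv/= => + zq; rewrite zq ltxx.
have fin : P (r @^-1` `]-oo, q[) \is a fin_num by exact: fin_num_measure.
have fin2 : P (r @^-1` [set q]) \is a fin_num by exact: fin_num_measure.
move=> /(congr1 fine); rewrite fineD// => h.
transitivity ((fine (P (r @^-1` [set q])))%:E); first by rewrite fineK.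
by congr EFin; move: h; lra.
Qed.

(** Multiplying by sqrt(n) and moving the data term to the right gives the same half-line condition
    on the normal variable as for the ratio: [theta] becomes the shift and the data become the
    threshold. *)
Lemma theta5_star_le_probability n (x : 'I_n -> R * R) (theta : R) : (0 < n)%N ->
  P [set w | theta5_star x (V w) (W w) <= theta] =
  normal_mixture (theta * Num.sqrt n%:R)
    (- (Num.sqrt n%:R * xbar1 x / Num.sqrt (s11 x))) g.
Proof.
move=> n0; have sn0 : 0 < Num.sqrt n%:R :> R by rewrite sqrtr_gt0 ltr0n.
apply: (below_section_probability [set z | theta5_star x z.1 z.2 <= theta]
  (fun c => theta * Num.sqrt n%:R + - (Num.sqrt n%:R * xbar1 x / Num.sqrt (s11 x)) * Num.sqrt c)).
  have -> : [set z : (R * R)%type | theta5_star x z.1 z.2 <= theta] =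
      (fun z => theta5_star x z.1 z.2) @^-1` `]-oo, theta].
    by apply/seteqP; split => z /=; rewrite in_itv.
  by apply: measurable_preimage => //; rewrite /theta5_star; mfun.
move=> z c c0 zu /=; rewrite /theta5_star -lerBrDr ler_pdivrMr//.
have -> : (theta - xbar1 x / Num.sqrt (s11 x) * Num.sqrt c) * Num.sqrt n%:R =
    theta * Num.sqrt n%:R + - (Num.sqrt n%:R * xbar1 x / Num.sqrt (s11 x)) * Num.sqrt c.
  by ring.
by rewrite le_eqVlt (negbTE zu).
Qed.

End chi_mixtures.

(** * Monotone likelihood ratio of the chi-squared family *)

Section chi_order.
Context {R : realType}.
Local Notation leb := (@lebesgue_measure R).

(** Since [g] and [g'] have equal mass, the constant [h c0] may be subtracted from [h]: the
    difference of the two integrals is that of (h - h c0)(g' - g), which is positive on the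
    half-line away from [c0]. *)
Lemma strict_covariance (g g' h : R -> R) (c0 : R) :
  measurable_fun setT g -> measurable_fun setT g' -> measurable_fun setT h ->
  (forall c, 0 <= g c) -> (forall c, 0 <= g' c) -> (forall c, 0 <= h c <= 1) ->
  (\int[leb]_c (g c)%:E = 1)%E -> (\int[leb]_c (g' c)%:E = 1)%E ->
  (forall c, c <= 0 -> g c = 0) -> (forall c, c <= 0 -> g' c = 0) ->
  (forall c, 0 < c -> c != c0 -> 0 < (h c - h c0) * (g' c - g c)) ->
  (\int[leb]_c (h c * g c)%:E <> \int[leb]_c (h c * g' c)%:E)%E.
Proof.
move=> mg mg' mh g0 g'0 h01 Ig Ig' gN g'N sgn E.
have h0 c : 0 <= h c by have /andP[] := h01 c.
pose D c := (h c - h c0) * (g' c - g c).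
have D0 c : 0 <= D c.
  have [c_le0|c_gt0] := leP c 0; first by rewrite /D gN// g'N// subrr mulr0.
  have [->|cc0] := eqVneq c c0; first by rewrite /D subrr mul0r.
  by apply: ltW; exact: sgn.
have mE (f : R -> R) : measurable_fun setT f -> measurable_fun setT (fun c => (f c)%:E).
  by move=> mf; exact/measurable_EFinP.
have mD : measurable_fun setT D by rewrite /D; mfun.
have sum_integral (f f' : R -> R) : measurable_fun setT f -> measurable_fun setT f' ->
    (forall c, 0 <= f c) -> (forall c, 0 <= f' c) ->
    (\int[leb]_c (f c + f' c)%:E = \int[leb]_c (f c)%:E + \int[leb]_c (f' c)%:E)%E.
  move=> mf mf' f0 f'0; under eq_integral do rewrite EFinD.
  by apply: ge0_integralD => //; [move=> c _; rewrite lee_fin|exact: mE|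
    move=> c _; rewrite lee_fin|exact: mE].
have scale_integral (f : R -> R) : measurable_fun setT f -> (forall c, 0 <= f c) ->
    (\int[leb]_c (f c)%:E = 1 -> \int[leb]_c (h c0 * f c)%:E = (h c0)%:E)%E.
  move=> mf f0 If; under eq_integral do rewrite EFinM.
  rewrite ge0_integralZl ?If ?mule1 ?lee_fin//; first exact: mE.
  by move=> c _; rewrite lee_fin.
have mh0 (f : R -> R) : measurable_fun setT f -> measurable_fun setT (fun c => h c0 * f c) by move=> mf; mfun.
have mhf (f : R -> R) : measurable_fun setT f -> measurable_fun setT (fun c => h c * f c) by move=> mf; mfun.
(* The negative terms of [D] are moved to the other side, so that only nonnegative functions are
   integrated; all totals are finite because [h] is at most 1. *)
have IL : (\int[leb]_c (h c * g' c + h c0 * g c)%:E =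
    \int[leb]_c (h c * g c)%:E + (h c0)%:E)%E.
  rewrite sum_integral; last 4 first.
  - exact: mhf.
  - exact: mh0.
  - by move=> c; rewrite mulr_ge0.
  - by move=> c; rewrite mulr_ge0.
  by rewrite scale_integral// E.
have IR : (\int[leb]_c (h c * g c + h c0 * g' c)%:E =
    \int[leb]_c (h c * g c)%:E + (h c0)%:E)%E.
  rewrite sum_integral; last 4 first.
  - exact: mhf.
  - exact: mh0.
  - by move=> c; rewrite mulr_ge0.
  - by move=> c; rewrite mulr_ge0.
  by rewrite scale_integral.
have finA : (\int[leb]_c (h c * g c)%:E)%E \is a fin_num.
  rewrite ge0_fin_numE; last by apply: integral_ge0 => c _; rewrite lee_fin mulr_ge0.
  apply: (@le_lt_trans _ _ 1%E); last exact: ltry.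
  rewrite -Ig; apply: ge0_le_integral => //.
  - by move=> c _; rewrite lee_fin mulr_ge0.
  - by apply: mE; exact: mhf.
  - exact: mE.
  by move=> c _; rewrite lee_fin ler_piMl//; have /andP[] := h01 c.
have ID : (\int[leb]_c (D c)%:E = 0)%E.
  have : (\int[leb]_c (h c * g c + h c0 * g' c)%:E + \int[leb]_c (D c)%:E =
      \int[leb]_c (h c * g' c + h c0 * g c)%:E)%E.
    rewrite -sum_integral; last 4 first.
    - by apply: measurable_funD; [exact: mhf|exact: mh0].
    - exact: mD.
    - by move=> c; rewrite addr_ge0 ?mulr_ge0.
    - exact: D0.
    by apply: eq_integral => c _; congr EFin; rewrite /D; ring.
  rewrite IL IR -[X in _ = X]adde0; set B := (_ + (h c0)%:E)%E => BD.
  have finB : B \is a fin_num by rewrite fin_numD finA.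
  by rewrite -[LHS](addeK _ finB) [X in (X - B)%E]addeC BD adde0 subee.
(* The indicator of a null set repairs the zero of [D] at [c0], so that [integral_pos_gt0]
   applies. *)
pose f c := ((D c + \1_[set c0] c)%:E : \bar R).
have : (0 < \int[leb]_c f c)%E.
  apply: integral_pos_gt0.
  - by apply: mE; apply: measurable_funD.
  - by move=> c; rewrite /f lee_fin addr_ge0 ?D0// indicE.
  - move=> c c_gt0; rewrite /f lte_fin; have [->|cc0] := eqVneq c c0.
      by rewrite indicE mem_set// ltr_wpDl ?D0.
    by rewrite ltr_pwDl ?indicE//; exact: sgn.
rewrite sum_integral//.
rewrite ID add0e integral_indic// setIT => pos.
have : (0 < lebesgue_measure [set c0])%E := pos.
by rewrite lebesgue_measure_set1 ltxx.
Qed.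

(** The ratio of the two densities is (K'/K) c^p with p = (m' - m)/2, an increasing function that
    equals 1 exactly at c0 = (K/K')^(1/p). *)
Lemma chi_crossing (m m' K K' : R) : m < m' -> 0 < K -> 0 < K' ->
  exists c0, forall c, 0 < c -> c != c0 ->
    0 < c0 /\ 0 < (c - c0) * (K' * chi_fun m' c - K * chi_fun m c).
Proof.
move=> mm' K0 K'0; pose p := (m' - m) / 2.
have p0 : 0 < p by rewrite divr_gt0 ?subr_gt0.
pose c0 := (K / K') `^ p^-1.
have c00 : 0 < c0 by rewrite powR_gt0 ?divr_gt0.
have c0p : c0 `^ p = K / K'.
  by rewrite -powRrM mulVf ?gt_eqF// powRr1// ltW// divr_gt0.
exists c0 => c c_gt0 cc0; split=> //.
rewrite /chi_fun c_gt0.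
have -> : K' * (c `^ (m' / 2 - 1) * expR (- c / 2)) -
    K * (c `^ (m / 2 - 1) * expR (- c / 2)) =
    K' * (c `^ (m / 2 - 1) * expR (- c / 2)) * (c `^ p - c0 `^ p).
  rewrite c0p (_ : m' / 2 - 1 = (m / 2 - 1) + p); last by rewrite /p; field.
  rewrite powRD; last by apply/implyP => _; rewrite gt_eqF.
  by field; rewrite gt_eqF.
rewrite mulrCA; apply: mulr_gt0; first by rewrite !mulr_gt0 ?powR_gt0 ?expR_gt0.
have [lt_c|lt_c|eq_c] := ltgtP c c0; last by rewrite eq_c eqxx in cc0.
- rewrite nmulr_rgt0 ?subr_lt0//.
  by apply: gt0_ltr_powR => //; rewrite nnegrE ltW.
- rewrite pmulr_rgt0 ?subr_gt0//.
  by apply: gt0_ltr_powR => //; rewrite nnegrE ltW.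
Qed.

Lemma normal_mixture_inj (m m' K K' D q : R) : 0 < K -> 0 < K' -> q != 0 ->
  (\int[leb]_c (K * chi_fun m c)%:E = 1)%E -> (\int[leb]_c (K' * chi_fun m' c)%:E = 1)%E ->
  normal_mixture D q (fun c => K * chi_fun m c) =
    normal_mixture D q (fun c => K' * chi_fun m' c) -> m = m'.
Proof.
wlog mm' : m m' K K' / m < m'.
  move=> th K0 K'0 q0 IK IK' E; have [mm'|mm'|//] := ltgtP m m'.
    exact: (th m m' K K').
  exact/esym/(th m' m K' K mm' K'0 K0 q0 IK' IK (esym E)).
move=> K0 K'0 q0 IK IK' E; exfalso.
have [c0 cross] := chi_crossing m m' K K' mm' K0 K'0.
pose h c := std_normal_cdf (D + q * Num.sqrt c).
have mh : measurable_fun setT h by apply: measurable_std_normal_cdf; mfun.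
have mchi k l : measurable_fun setT (fun c => k * @chi_fun R l c).
  by apply: measurable_funM; [exact: measurable_cst|exact: measurable_chi_fun].
have chi0 k l c : 0 < k -> 0 <= k * @chi_fun R l c.
  by move=> k0; exact: (mulr_ge0 (ltW k0) (chi_fun_ge0 _ _)).
have chiN k l c : c <= 0 -> k * @chi_fun R l c = 0.
  by move=> c_le0; rewrite /chi_fun ltNge c_le0 mulr0.
have h01 c : 0 <= h c <= 1 by rewrite std_normal_cdf_ge0 std_normal_cdf_le1.
have h_sgn c : 0 < c0 -> 0 < c -> c != c0 -> 0 < q * (c - c0) * (h c - h c0).
  move=> c00 c_gt0 cc0; have sq : (c - c0) * (Num.sqrt c - Num.sqrt c0) > 0.
    have [lt_c|lt_c|eq_c] := ltgtP c c0; last by rewrite eq_c eqxx in cc0.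
    - by rewrite nmulr_rgt0 subr_lt0 ?ltr_sqrt.
    - by rewrite pmulr_rgt0 subr_gt0 ?ltr_sqrt.
  have : 0 < (q * (c - c0)) * (q * (Num.sqrt c - Num.sqrt c0)).
    have -> : q * (c - c0) * (q * (Num.sqrt c - Num.sqrt c0)) =
      q ^+ 2 * ((c - c0) * (Num.sqrt c - Num.sqrt c0)) by ring.
    by apply: (mulr_gt0 _ sq); rewrite exprn_even_gt0.
  rewrite (mulrBr _ (Num.sqrt c)) /h; have [x0|x0|x0] := ltgtP (q * (c - c0)) 0.
  - rewrite !(nmulr_rgt0 _ x0) !subr_lt0 => ?; apply: std_normal_cdf_lt.
    by rewrite ltrD2l.
  - rewrite !(pmulr_rgt0 _ x0) !subr_gt0 => ?; apply: std_normal_cdf_lt.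
    by rewrite ltrD2l.
  - by rewrite x0 mul0r ltxx.
(* Used with x = c - c0: [h] and the difference of the densities both change sign at the crossing
   point, so the sign of their product is that of [q]. *)
have prod_sgn (x y z : R) : 0 < q * x * y -> 0 < x * z -> 0 < q * (y * z).
  move=> qxy xz; have x0 : x != 0 by apply: contraTneq xz => ->; rewrite mul0r ltxx.
  have -> : q * (y * z) = (q * x * y) * (x * z) / x ^+ 2 by field.
  by apply: (divr_gt0 (mulr_gt0 qxy xz)); rewrite exprn_even_gt0.
have sgn c : 0 < c -> c != c0 ->
    0 < q * ((h c - h c0) * (K' * chi_fun m' c - K * chi_fun m c)).
  move=> c_gt0 cc0; have [c00 crossc] := cross c c_gt0 cc0.
  exact: (prod_sgn _ _ _ (h_sgn c c00 c_gt0 cc0) crossc).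
(* For q < 0 the function [h] decreases, and the two densities exchange roles. *)
have [q_lt0|q_gt0|] := ltgtP q 0; last by move/eqP: q0.
- apply: (strict_covariance _ _ h c0 (mchi K' m') (mchi K m) mh
    (fun c => chi0 K' m' c K'0) (fun c => chi0 K m c K0) h01 IK' IK
    (fun c => chiN K' m' c) (fun c => chiN K m c)); last exact/esym.
  move=> c c_gt0 cc0; have := sgn c c_gt0 cc0.
  by rewrite (nmulr_rgt0 _ q_lt0) -oppr_gt0 -mulrN opprB.
- apply: (strict_covariance _ _ h c0 (mchi K m) (mchi K' m') mh
    (fun c => chi0 K m c K0) (fun c => chi0 K' m' c K'0) h01 IK IK'
    (fun c => chiN K m c) (fun c => chiN K' m' c)); last exact: E.
  by move=> c c_gt0 cc0; have := sgn c c_gt0 cc0; rewrite (pmulr_rgt0 _ q_gt0).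
Qed.

End chi_order.

(** * Coverage *)

Section coverage.
Context {R : realType}.
Local Notation leb := (@lebesgue_measure R).
Local Notation BR := (measurableTypeR R).
Variables (m1 m2 s1 s2 r : R).
Hypotheses (s10 : 0 < s1) (s20 : 0 < s2) (r1 : `|r| < 1).
Let t : param := (m1, m2, s1, s2, r).

Let r2 : 0 < 1 - r ^+ 2.
Proof. by rewrite subr_gt0 -[X in X < _]real_normK ?num_real// expr_lt1. Qed.

(* The sign is chosen so that the pivot is an increasing function of the sample mean of
   these coordinates. *)
Definition standard_coordinate (x : R * R) : R := - (x.1 - m1) / s1.

Let measurable_standard_coordinate : measurable_fun setT standard_coordinate.
Proof. by rewrite /standard_coordinate; mfun. Qed.

(** Given the first coordinate, the second is normal with mean m2 + r s2 z and standard deviation s2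
    sqrt(1 - r^2). The sign in [standard_coordinate] disappears because the normal density is
    even. *)
Lemma binormal_marginal (u : R) :
  (\int[leb]_v (binormal_pdf t (u, v))%:E =
   (s1^-1 * normal_pdf 0 1 (standard_coordinate (u, 0%R)))%:E)%E.
Proof.
pose w := Num.sqrt (1 - r ^+ 2); pose z := (u - m1) / s1.
have w0 : 0 < w by rewrite sqrtr_gt0.
have w2 : w ^+ 2 = 1 - r ^+ 2 by rewrite sqr_sqrtr// ltW.
have pk0 : 0 < normal_peak 1 :> R by rewrite normal_peak_gt0 ?oner_eq0.
have pk2 : normal_peak 1 ^+ 2 = (2 * pi)^-1 :> R.
  by rewrite /normal_peak exprVn sqr_sqrtr ?expr1n ?mul1r ?mulr_natl// mulrn_wge0// pi_ge0.
have pi0 : 0 < pi :> R by exact: pi_gt0.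
have nz : [/\ s1 != 0, s2 != 0, w != 0, normal_peak 1 != 0 :> R & pi != 0 :> R].
  by rewrite !gt_eqF.
have [s1n s2n wn pkn pin] := nz.
transitivity (\int[leb]_v ((expR (- z ^+ 2 / 2) / (2 * pi * s1 * s2 * w))%:E *
    (expR (- (v - (m2 + s2 * r * z)) ^+ 2 / (2 * (s2 * w) ^+ 2)))%:E))%E.
  apply: eq_integral => v _; rewrite -EFinM /binormal_pdf /t /= -/w -w2.
  congr EFin; rewrite [RHS]mulrAC -expRD; congr (expR _ / _); rewrite -/z; set z' := (v - m2) / s2.
  have -> : v = s2 * z' + m2 by rewrite /z'; field.
  transitivity (- (z ^+ 2 * (w ^+ 2 + r ^+ 2) - 2 * r * z * z' + z' ^+ 2) / (2 * w ^+ 2)).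
    by rewrite w2 subrK mulr1.
  by field; rewrite s2n wn.
rewrite ge0_integralZl; last 4 first.
- by [].
- by apply/measurable_EFinP; mfun.
- by move=> v _; rewrite lee_fin expR_ge0.
- by rewrite lee_fin divr_ge0 ?expR_ge0// !mulr_ge0 ?ltW.
rewrite integral_gaussian ?mulr_gt0// -EFinM; congr EFin.
rewrite std_normal_pdfE /standard_coordinate /=.
have -> : (- (u - m1) / s1) ^+ 2 = z ^+ 2 by rewrite mulNr sqrrN.
transitivity (expR (- z ^+ 2 / 2) * s1^-1 * ((2 * pi)^-1 / normal_peak 1)).
  by move: (pi : R) pin => p pn; field; rewrite s1n s2n wn pkn pn.
by rewrite -pk2; field; rewrite ?s1n ?pkn.
Qed.

Context d (S : measurableType d) (Q : probability S R) (n : nat).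
Variable X : 'I_n -> {RV Q >-> (R * R)%type}.
Hypothesis sampleX : binormal_sample t X.

Lemma standard_coordinate_density (k : 'I_n) :
  has_density _ _ Q (fun s => standard_coordinate (X k s)) (normal_pdf 0 1).
Proof.
move=> h mh h0.
have [nu nuE nuh] := @pushforward_measure _ _ S (BR * BR)%type R Q (X k)
  (measurable_funP (X k)).
pose F (x : (R * R)%type) := h (standard_coordinate x).
have mF : measurable_fun setT F by exact: measurableT_comp.
rewrite -(nuh F)//; last by move=> x; exact: h0.
have mb := measurable_binormal_pdf t.
have b0 x : 0 <= binormal_pdf t x.
  by rewrite /binormal_pdf divr_ge0 ?expR_ge0// !mulr_ge0 ?sqrtr_ge0 ?pi_ge0 ?ltW.
rewrite (@integral_density _ (BR * BR)%type R (leb \x leb)%E nu (binormal_pdf t))//; last 2 first.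
- by move=> A mA; rewrite nuE -[LHS]/(distribution Q (X k) A) (sampleX.2 k).
- by move=> x; exact: h0.
rewrite product_tonelli1; last 3 first.
- exact: sigma_finiteT.
- by apply: emeasurable_funM => //; exact/measurable_EFinP.
- by move=> z; apply: mule_ge0; [exact: h0|rewrite lee_fin].
pose G u := (h (standard_coordinate (u, 0%R)) *
  (s1^-1 * normal_pdf 0 1 (standard_coordinate (u, 0%R)))%:E)%E.
transitivity (\int[leb]_u G u)%E.
  apply: eq_integral => u _; rewrite /G -binormal_marginal -ge0_integralZl//.
  - by apply/measurable_EFinP; apply: (measurableT_comp mb); mfun.
  - by move=> v _; rewrite lee_fin.
rewrite (integral_affine G (- s1) m1); last 3 first.
- by rewrite oppr_eq0 gt_eqF.
- apply: emeasurable_funM.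
    by apply: (measurableT_comp mh); rewrite /standard_coordinate; mfun.
  apply/measurable_EFinP; apply: measurable_funM; first exact: measurable_cst.
  by apply: measurable_std_normal_pdf; rewrite /standard_coordinate; mfun.
- by move=> u; rewrite mule_ge0// lee_fin mulr_ge0 ?normal_pdf_ge0// invr_ge0 ltW.
apply: eq_integral => y _; rewrite /G.
have -> : standard_coordinate (- s1 * y + m1, 0) = y.
  by rewrite /standard_coordinate/=; field; rewrite gt_eqF.
rewrite -muleA -EFinM normrN gtr0_norm//; congr (_ * _%:E)%E.
by rewrite mulrAC mulVf ?gt_eqF// mul1r.
Qed.

Let y s k := observation _ _ _ _ Q n X standard_coordinate k s.

(** In the standardized coordinates xbar1 = m1 - s1 U / sqrt(n) and s11 = s1^2 V, for (U, V) the
    final Helmert state; the scale [s1] cancels in the quotient. *)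
Lemma pivotE (s : S) : (0 < n)%N ->
  - (Num.sqrt n%:R * xbar1 (fun k => X k s) / Num.sqrt (s11 (fun k => X k s))) =
  ((helmert_iter (y s) n).1 - m1 / s1 * Num.sqrt n%:R) / Num.sqrt (helmert_iter (y s) n).2.
Proof.
move=> n0; set x := fun k => X k s; have [] := helmert_iterE (y s) n.
set U := (helmert_iter _ _).1; set V := (helmert_iter _ _).2 => HU HV.
have nn0 : n%:R != 0 :> R by rewrite pnatr_eq0 -lt0n.
have sn0 : Num.sqrt n%:R != 0 :> R by rewrite gt_eqF// sqrtr_gt0 ltr0n.
have sn2 : Num.sqrt n%:R ^+ 2 = n%:R :> R by rewrite sqr_sqrtr.
have s1n : s1 != 0 by rewrite gt_eqF.
have xE (k : 'I_n) : (x k).1 - m1 = - s1 * y s k.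
  by rewrite /y /observation valK /standard_coordinate /x; field.
have xbarE : xbar1 x - m1 = - s1 * (U / Num.sqrt n%:R).
  have : \sum_(k < n) ((x k).1 - m1) = - s1 * (Num.sqrt n%:R * U).
    by rewrite HU mulr_sumr; apply: eq_bigr => k _; rewrite xE.
  rewrite big_split/= sumr_const card_ord -(mulr_natl (- m1) n) => E.
  transitivity (n%:R^-1 * (\sum_(k < n) (x k).1 + n%:R * - m1)).
    by rewrite /xbar1; field.
  by rewrite E -{1}sn2; field.
have s11E : s11 x = s1 ^+ 2 * V.
  have := sum_deviations _ _ (fun k => (x k).1) (fun k => (x k).1) m1 m1 n0.
  rewrite -/(xbar1 x) xbarE; under eq_bigr do rewrite xE.
  have -> : \sum_(k < n) ((x k).1 - xbar1 x) * ((x k).1 - xbar1 x) = s11 x by [].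
  have -> : \sum_(k < n) (- s1 * y s k) * (- s1 * y s k) = s1 ^+ 2 * (V + U ^+ 2).
    by rewrite HV mulr_sumr; apply: eq_bigr => k _; ring.
  move=> E; transitivity (s1 ^+ 2 * (V + U ^+ 2) - s1 ^+ 2 * U ^+ 2); last by ring.
  by rewrite E -{1}sn2; field.
rewrite s11E sqrtrM ?sqr_ge0// sqrtr_sqr gtr0_norm// invfM.
have -> : xbar1 x = m1 - s1 * (U / Num.sqrt n%:R) by rewrite -mulNr -xbarE addrC subrK.
by move: (Num.sqrt V)^-1 => v; field; rewrite s1n.
Qed.

Lemma pivot_probability (K q : R) : (1 < n)%N -> 0 < K ->
  (\int[leb]_c (K * chi_fun (n%:R - 1) c)%:E = 1)%E ->
  Q [set s | - (Num.sqrt n%:R * xbar1 (fun k => X k s) / Num.sqrt (s11 (fun k => X k s))) < q] =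
  normal_mixture (m1 / s1 * Num.sqrt n%:R) q (fun c => K * chi_fun (n%:R - 1) c).
Proof.
move=> n1 K0 IK.
have [kappa kappa0 law] := helmert_law _ _ _ _ Q n X standard_coordinate sampleX.1
  measurable_standard_coordinate standard_coordinate_density n1.
have miter := measurable_helmert_iter _ _ _ _ Q n X standard_coordinate
  measurable_standard_coordinate.
have nE : n.-1%:R = n%:R - 1 :> R by rewrite -subn1 natrB// ltnW.
rewrite nE in law.
set D := m1 / s1 * Num.sqrt n%:R.
pose A : set (R * R)%type := [set z | (z.1 - D) / Num.sqrt z.2 < q].
have mA : measurable A.
  have -> : A = (fun z => (z.1 - D) / Num.sqrt z.2) @^-1` `]-oo, q[.
    by apply/seteqP; split => z /=; rewrite in_itv.
  by apply: measurable_preimage => //; mfun.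
have -> : [set s | - (Num.sqrt n%:R * xbar1 (fun k => X k s) /
    Num.sqrt (s11 (fun k => X k s))) < q] = (fun s => helmert_iter (y s) n) @^-1` A.
  by apply/seteqP; split => s /=; rewrite pivotE// ltnW.
rewrite -(integral_indic_preimage _ _ _ _ _ Q (fun s => helmert_iter (y s) n) A)//.
rewrite (law (fun z => (\1_A z)%:E))//; last first.
  by apply/measurable_EFinP; exact: measurable_indic.
rewrite (below_section_integral A (fun c => D + q * Num.sqrt c))//; last 2 first.
- by move=> c c0; rewrite /chi_fun ltNge c0.
- by move=> z c c0 _ /=; rewrite /A/= ltr_pdivrMr ?sqrtr_gt0// ltrBlDl.
have mchi : measurable_fun setT (fun c => (chi_fun (n%:R - 1) c)%:E : \bar R).
  by apply/measurable_EFinP; exact: measurable_chi_fun.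
(* The Helmert law applied to the constant 1. Since [K] normalizes the same integral, [kappa] must
   be [K]. *)
have Ikappa : (kappa * \int[leb]_c (chi_fun (n%:R - 1) c)%:E = 1)%E.
  transitivity (\int[Q]_s (cst 1%E : R * R -> \bar R) (helmert_iter (y s) n))%E; last first.
    by rewrite integral_cst//; exact: (etrans (mul1e _) (@probability_setT _ _ _ Q)).
  rewrite law//; congr (_ * _)%E; apply: eq_integral => c _.
  under eq_integral do rewrite mul1e.
  by rewrite integral_normal_pdf mul1e.
have KI : (K%:E * \int[leb]_c (chi_fun (n%:R - 1) c)%:E = 1)%E.
  rewrite -IK -ge0_integralZl//; last 2 first.
  - by move=> c _; rewrite lee_fin chi_fun_ge0.
  - by rewrite lee_fin ltW.
have kappaE : kappa = K%:E by rewrite -[LHS]mule1 -KI muleCA Ikappa mule1.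
rewrite kappaE /normal_mixture -ge0_integralZl//.
- by apply: eq_integral => c _; rewrite -EFinM; congr EFin; ring.
- apply/measurable_EFinP; apply: measurable_funM; last exact: measurable_chi_fun.
  by apply: measurable_std_normal_cdf; mfun.
- by move=> c _; rewrite lee_fin mulr_ge0 ?std_normal_cdf_ge0 ?chi_fun_ge0.
- by rewrite lee_fin ltW.
Qed.

End coverage.

Section auxiliary_variables.
Context {R : realType}.
Local Notation leb := (@lebesgue_measure R).

Lemma pair_independence d d' (T : measurableType d) (T' : measurableType d')
    (P : probability T R) (I : finType) (X : I -> {RV P >-> T'}) (i j : I)
    (A B : set T') : mutually_independent X -> i != j -> measurable A -> measurable B ->
  P (X i @^-1` A `&` X j @^-1` B) = (P (X i @^-1` A) * P (X j @^-1` B))%E.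
Proof.
move=> indX ij mA mB.
pose D k := if k == i then A else if k == j then B else setT.
have Di : D i = A by rewrite /D eqxx.
have Dj : D j = B by rewrite /D eq_sym (negbTE ij) eqxx.
have mD k : measurable (D k) by rewrite /D; do 2?[case: ifP => // _].
have := indX D mD.
have -> : \bigcap_(k in [set: I]) (X k @^-1` D k) = X i @^-1` A `&` X j @^-1` B.
  apply/seteqP; split => w.
    by move=> h; split; [have := h i Logic.I|have := h j Logic.I]; rewrite /= ?Di ?Dj.
  move=> [wA wB] k _ /=; rewrite /D.
  by case: eqP => [->//|_]; case: eqP => [->|].
move=> ->; rewrite (bigD1 i)//= Di; congr (_ * _)%E.
rewrite (bigD1 j)/= 1?eq_sym// Dj big1 ?mule1// => k /andP[ki kj].
by rewrite /D (negbTE ki) (negbTE kj) preimage_setT probability_setT.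
Qed.

Lemma normal_law_density d (T : measurableType d) (P : probability T R)
    (X : {RV P >-> R}) : has_law X (normal_prob 0 1) ->
  has_density _ _ P X (normal_pdf 0 1).
Proof.
move=> hX; apply: law_has_density => //; first exact: measurable_normal_pdf.
by move=> x; exact: normal_pdf_ge0.
Qed.

Lemma chi2_law_density d (T : measurableType d) (P : probability T R)
    (m : R) (X : {RV P >-> R}) : has_law X (chi2_prob m) ->
  has_density _ _ P X (chi2_pdf m).
Proof.
move=> hX; apply: law_has_density => //; first exact: measurable_chi2_pdf.
exact: chi2_pdf_ge0.
Qed.

(* The existence of a variable with law [chi2_prob m] replaces the evaluation of the
   normalizing constant. *)
Lemma chi2_law_normalized d (T : measurableType d) (P : probability T R)
    (m : R) (X : {RV P >-> R}) : has_law X (chi2_prob m) ->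
  exists K, [/\ 0 < K, chi2_pdf m = (fun c => K * chi_fun m c) &
    (\int[leb]_c (K * chi_fun m c)%:E = 1)%E].
Proof.
move=> hX; pose K : R := (2 `^ (m / 2) * Gamma_fun (m / 2))^-1.
have KE : chi2_pdf m = (fun c => K * chi_fun m c) by apply/funext => c; exact: chi2_pdfE.
have I1 : (\int[leb]_c (K * chi_fun m c)%:E = 1)%E.
  have := hX setT measurableT; rewrite /chi2_prob KE => <-.
  exact: (@probability_setT _ _ _ (distribution P X)).
exists K; split => //; rewrite lt_neqAle; apply/andP; split.
  apply/eqP => K0; move: I1; rewrite -K0; under eq_integral do rewrite mul0r.
  by rewrite integral0 => /eqP; rewrite eq_sym onee_eq0.
rewrite invr_ge0 mulr_ge0 ?powR_ge0//.
by apply: Rintegral_ge0 => y _; rewrite mulr_ge0 ?powR_ge0 ?expR_ge0.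
Qed.

End auxiliary_variables.

(** * Coverage as a function of theta5 and its exactness *)

Section pivotal_quantile.
Context {R : realType} (n : nat) (a alpha : R).
Hypothesis n1 : (1 < n)%N.
Hypothesis alpha01 : 0 < alpha < 1.
Context d (T : measurableType d) (P : probability T R) (Z C Zs Cs : {RV P >-> R}).
Hypotheses (hZ : has_law Z (normal_prob 0 1)) (hC : has_law C (chi2_prob (n%:R - 1))).
Hypotheses (hZs : has_law Zs (normal_prob 0 1)) (hCs : has_law Cs (chi2_prob (n%:R - a))).
Hypothesis indZC : forall A B, measurable A -> measurable B ->
  P (Z @^-1` A `&` C @^-1` B) = (P (Z @^-1` A) * P (C @^-1` B))%E.
Hypothesis indZCs : forall A B, measurable A -> measurable B ->
  P (Zs @^-1` A `&` Cs @^-1` B) = (P (Zs @^-1` A) * P (Cs @^-1` B))%E.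

Let ratio_q (theta : R) : R :=
  quantile P (fun w => (Zs w - theta * Num.sqrt n%:R) / Num.sqrt (Cs w)) (1 - alpha).

Let rhs (theta : R) : \bar R :=
  P [set w | (Z w - theta * Num.sqrt n%:R) / Num.sqrt (C w) < ratio_q theta].

Let beta01 : 0 < 1 - alpha < 1.
Proof. by move: alpha01 => /andP[? ?]; apply/andP; split; lra. Qed.

Let chi2_pdfN m c : c <= 0 -> @chi2_pdf R m c = 0.
Proof. by rewrite /chi2_pdf ltNge => ->. Qed.

Let rhsE theta :
  rhs theta = normal_mixture (theta * Num.sqrt n%:R) (ratio_q theta) (chi2_pdf (n%:R - 1)).
Proof.
exact: (ratio_lt_probability _ _ P Z C _ (measurable_funP Z) (measurable_funP C) indZC
  (normal_law_density _ _ P Z hZ) (chi2_law_density _ _ P _ C hC) (chi2_pdfN _)).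
Qed.

Lemma coverage_pivot (t : param) d' (S : measurableType d') (Q : probability S R)
    (X : 'I_n -> {RV Q >-> (R * R)%type}) : param_space t -> binormal_sample t X ->
  Q [set s | theta5 t < quantile P
      (fun w => theta5_star (fun k => X k s) (Zs w) (Cs w)) (1 - alpha)] = rhs (theta5 t).
Proof.
case: t => [[[[m1 m2] s1] s2] r] [s10 s20 r1] sampleX.
have n0 := ltnW n1; have [K [K0 KE IK]] := chi2_law_normalized _ _ P _ C hC.
rewrite rhsE KE -(pivot_probability m1 m2 s1 s2 r s10 s20 r1 _ _ Q n X sampleX)//.
congr (Q _); apply/seteqP.
have mZs : measurable_fun setT Zs by []; have mCs : measurable_fun setT Cs by [].
have dZs := normal_law_density _ _ P Zs hZs.
have dCs := chi2_law_density _ _ P _ Cs hCs.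
have mstar (x : 'I_n -> R * R) : measurable_fun setT (fun w => theta5_star x (Zs w) (Cs w)).
  by rewrite /theta5_star; mfun.
have mratio : measurable_fun setT
    (fun w => (Zs w - m1 / s1 * Num.sqrt n%:R) / Num.sqrt (Cs w)) by mfun.
(* By [quantile_gt] each side says that a distribution function is below the level, and both are the
   same normal mixture. *)
have E (x : 'I_n -> R * R) : m1 / s1 < quantile P (fun w => theta5_star x (Zs w) (Cs w)) (1 - alpha) <->
    - (Num.sqrt n%:R * xbar1 x / Num.sqrt (s11 x)) < ratio_q (m1 / s1).
  rewrite (quantile_gt _ _ _ _ (mstar x) _ beta01) (quantile_gt _ _ _ _ mratio _ beta01).
  rewrite (theta5_star_le_probability _ _ P Zs Cs _ mZs mCs indZCs dZs dCs (chi2_pdfN _))//.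
  by rewrite (ratio_le_probability _ _ P Zs Cs _ mZs mCs indZCs dZs dCs (chi2_pdfN _)).
by split => s /=; rewrite E.
Qed.

Lemma rhs_exact : (forall theta : R, rhs theta = (1 - alpha)%:E) <-> a = 1.
Proof.
have mZs : measurable_fun setT Zs by []; have mCs : measurable_fun setT Cs by [].
have dZs := normal_law_density _ _ P Zs hZs.
have dCs := chi2_law_density _ _ P _ Cs hCs.
have starE theta : normal_mixture (theta * Num.sqrt n%:R) (ratio_q theta)
    (chi2_pdf (n%:R - a)) = (1 - alpha)%:E.
  exact: (ratio_quantile _ _ P Zs Cs _ mZs mCs indZCs dZs dCs (chi2_pdfN _)).
split=> [exact_rhs|a1 theta]; last by rewrite rhsE -(starE theta) a1.
have sn0 : 0 < Num.sqrt n%:R :> R by rewrite sqrtr_gt0 ltr0n ltnW.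
have [K [K0 KE IK]] := chi2_law_normalized _ _ P _ C hC.
have [K' [K'0 KE' IK']] := chi2_law_normalized _ _ P _ Cs hCs.
(* At threshold 0 the chi-squared factor has no influence, so such a [theta] carries no information
   on [a] and must be avoided. *)
have mixture0 D : normal_mixture D 0 (chi2_pdf (n%:R - a)) = (std_normal_cdf D)%:E.
  rewrite /normal_mixture KE'; under eq_integral do rewrite mul0r addr0 EFinM.
  rewrite ge0_integralZl ?IK' ?mule1//.
  - apply/measurable_EFinP; apply: measurable_funM; first exact: measurable_cst.
    exact: measurable_chi_fun.
  - by move=> c _; rewrite lee_fin mulr_ge0 ?chi_fun_ge0// ltW.
  - by rewrite lee_fin std_normal_cdf_ge0.
(* If the quantile vanished at theta = 0 and at theta = 1/sqrt(n), the standard normal distribution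
   function would take the value 1 - alpha at both 0 and 1. *)
have [theta q0] : exists theta, ratio_q theta != 0.
  have [q0|] := eqVneq (ratio_q 0) 0; last by exists 0.
  exists (Num.sqrt n%:R)^-1; apply/eqP => q1.
  have := starE (Num.sqrt n%:R)^-1; rewrite -(starE 0) q0 q1 !mixture0 mul0r.
  rewrite mulVf ?gt_eqF// => -[E].
  by move/eqP: E; rewrite gt_eqF// std_normal_cdf_lt.
suff : n%:R - 1 = n%:R - a by lra.
apply: (normal_mixture_inj _ _ K K' (theta * Num.sqrt n%:R) (ratio_q theta) K0 K'0 q0 IK IK').
by rewrite -KE -KE' starE -(exact_rhs theta) rhsE.
Qed.

End pivotal_quantile.

Theorem theorem8 (R : realType) (n : nat) (hn : (3 <= n)%N)
  (a b : R) (ha : a < n%:R) (hb : b < n%:R)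
  (* the auxiliary variables Z_1, chi^2_{n-1}, Z_1^*, chi^{2*}_{n-a} *)
  (d : measure_display) (T : measurableType d) (P : probability T R)
  (Z C Zs Cs : {RV P >-> R})
  (hZ : has_law Z (normal_prob 0 1)) (hC : has_law C (chi2_prob (n%:R - 1)))
  (hZs : has_law Zs (normal_prob 0 1)) (hCs : has_law Cs (chi2_prob (n%:R - a)))
  (hind : mutually_independent (fun i : 'I_4 => tnth [tuple Z; C; Zs; Cs] i)) :
  (* (a), for all data in a set of full sampling probability *)
  [/\ (forall x : 'I_n -> R * R, positive_scatter x ->
         forall A : set R, measurable A ->
           posterior x a b [set t | A (theta5 t)]
           = P [set w | A (theta5_star x (Zs w) (Cs w))]),
      (forall (t : param) (dS : measure_display) (S : measurableType dS)
              (Q : probability S R) (X : 'I_n -> {RV Q >-> (R * R)%type}),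
         param_space t -> binormal_sample t X ->
         {ae Q, forall s, positive_scatter (fun k => X k s)})
  (* (b) *)
    & forall alpha : R, 0 < alpha < 1 ->
      let rhs (theta : R) : \bar R :=
        P [set w | (Z w - theta * Num.sqrt n%:R) / Num.sqrt (C w)
                   < quantile P
                       (fun w' => (Zs w' - theta * Num.sqrt n%:R)
                                  / Num.sqrt (Cs w'))
                       (1 - alpha)] in
      (forall (t : param) (dS : measure_display) (S : measurableType dS)
              (Q : probability S R) (X : 'I_n -> {RV Q >-> (R * R)%type}),
         param_space t -> binormal_sample t X ->
         Q [set s | theta5 t
                    < quantile P
                        (fun w => theta5_star (fun k => X k s) (Zs w) (Cs w))
                        (1 - alpha)]
         = rhs (theta5 t))
      /\ ((forall theta : R, rhs theta = (1 - alpha)%:E) <-> a = 1) ].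
Proof.
have n1 : (1 < n)%N by exact: ltnW.
have n0 : (0 < n)%N by exact: ltnW.
have indZC A B : measurable A -> measurable B ->
    P (Z @^-1` A `&` C @^-1` B) = (P (Z @^-1` A) * P (C @^-1` B))%E.
  exact: (pair_independence _ _ _ _ P _ _ (Ordinal (isT : 0 < 4)%N) (Ordinal (isT : 1 < 4)%N)
    A B hind).
have indZCs A B : measurable A -> measurable B ->
    P (Zs @^-1` A `&` Cs @^-1` B) = (P (Zs @^-1` A) * P (Cs @^-1` B))%E.
  exact: (pair_independence _ _ _ _ P _ _ (Ordinal (isT : 2 < 4)%N) (Ordinal (isT : 3 < 4)%N)
    A B hind).
split.
- move=> x scatter_x A mA.
  exact: (posterior_theta5_law n x a b n0 scatter_x hb _ _ P Zs Cs (measurable_funP Zs)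
    (measurable_funP Cs) indZCs (normal_law_density _ _ P Zs hZs)
    (chi2_law_density _ _ P _ Cs hCs) A mA).
- move=> t dS S Q X _ sampleX.
  exact: (almost_sure_positive_scatter n t _ _ Q X hn sampleX).
- move=> alpha alpha01 rhs; split.
    move=> t dS S Q X ht sampleX.
    exact: (coverage_pivot n a alpha n1 alpha01 _ _ P Z C Zs Cs hZ hC hZs hCs indZC indZCs
      t _ _ Q X ht sampleX).
  exact: (rhs_exact n a alpha n1 alpha01 _ _ P Z C Zs Cs hZ hC hZs hCs indZC indZCs).
Qed.
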